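(* Let $R$ be a unital ring with a Sylvester matrix rank function $\mathrm{rk}$, and let $S\supseteq R$ be a right amenable normal extension of $R$ with $(\mathcal{F},\mathcal{U})$ preserving $\mathrm{rk}$. Assume that $(\mathcal{F},\mathcal{U})$ has the weak quasitiling property. Then $\dim_{\mathcal{F}}(\cdot|\cdot)$ is the bivariant Sylvester module rank function for $S$ corresponding to $\mathrm{rk}_{\mathcal{F}}$.
   Context: **Sylvester rank functions.** A Sylvester matrix rank function for a unital ring $R$ is an $\mathbb{R}_{\ge 0}$-valued function $\mathrm{rk}$ on the set of rectangular matrices over $R$ such that: (1) $\mathrm{rk}(0)=0$ and $\mathrm{rk}(1_R)=1$; (2) $\mathrm{rk}(AB)\le\min(\mathrm{rk}(A),\mathrm{rk}(B))$; (3) $\mathrm{rk}\begin{pmatrix}A&0\\0&B\end{pmatrix}=\mathrm{rk}(A)+\mathrm{rk}(B)$; (4) $\mathrm{rk}\begin{pmatrix}A&C\\0&B\end{pmatrix}\ge\mathrm{rk}(A)+\mathrm{rk}(B)$. A bivariant Sylvester module rank function for $R$ is an $\mathbb{R}_{\ge0}\cup\{+\infty\}$-valued function $(\mathcal{M}_1,\mathcal{M}_2)\mapsto\dim(\mathcal{M}_1|\mathcal{M}_2)$ on the class of pairs of left $R$-modules $\mathcal{M}_1\subseteq\mathcal{M}_2$ such that: (1) it is an isomorphism invariant; (2) with $\dim(\mathcal{M}):=\dim(\mathcal{M}|\mathcal{M})$, $\dim(\{0\})=0$ and $\dim(R)=1$; (3) $\dim(\mathcal{M}_1\oplus\mathcal{M}_1'|\mathcal{M}_2\oplus\mathcal{M}_2')=\dim(\mathcal{M}_1|\mathcal{M}_2)+\dim(\mathcal{M}_1'|\mathcal{M}_2')$;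 (4) $\dim(\mathcal{M}_1|\mathcal{M}_2)=\sup\dim(\mathcal{M}_1'|\mathcal{M}_2)$ over finitely generated submodules $\mathcal{M}_1'\subseteq\mathcal{M}_1$; (5) if $\mathcal{M}_1$ is finitely generated, $\dim(\mathcal{M}_1|\mathcal{M}_2)=\inf\dim(\mathcal{M}_1|\mathcal{M}_2')$ over finitely generated submodules $\mathcal{M}_2'$ of $\mathcal{M}_2$ containing $\mathcal{M}_1$; (6) $\dim(\mathcal{M}_2)=\dim(\mathcal{M}_1|\mathcal{M}_2)+\dim(\mathcal{M}_2/\mathcal{M}_1)$. There is a one-to-one correspondence between bivariant Sylvester module rank functions and Sylvester matrix rank functions for $R$, determined by $\mathrm{rk}(A)=\dim(R^nA|R^m)$ for $A\in M_{n,m}(R)$ ($R^n$ = row vectors). $\dim(\cdot|\cdot)$ denotes the one for $R$ corresponding to the given $\mathrm{rk}$. For $\mathcal{M}$ a finitely generated free left $R$-module, $\dim(\mathcal{M})$ is its rank (well defined because $R$ has invariant basis number (IBN)). **Finite approximation systems.** Let $R\subseteq S$ be unital rings with $1_R=1_S$ and $R$ having IBN. A collection $\mathcal{F}$ of left $R$-submodules of $S$ is a finite approximation system if: (i) each $\mathcal{W}\in\mathcal{F}$ is a finitely generated free left $R$-module; (ii) $\mathcal{W}\cap\mathcal{V},\ \mathcal{W}+\mathcal{V}\in\mathcal{F}$ for all $\mathcal{W},\mathcal{V}\in\mathcal{F}$; (iii) if $\mathcal{V}\subseteq\mathcal{W}$ are in $\mathcal{F}$ then $\mathcal{W}=\mathcal{V}\oplus\mathcal{V}'$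 for some $\mathcal{V}'\in\mathcal{F}$; (iv) every finitely generated left $R$-submodule of $S$ is contained in some $\mathcal{W}\in\mathcal{F}$. $\hat{\mathcal{F}}$ is the set of nonzero elements of $\mathcal{F}$. For $\mathcal{W}\subseteq S$ and $V$ a subset of $S$ or of a left $S$-module, $\mathcal{W}V$ is the set of finite sums of elements $wv$, $w\in\mathcal{W}$, $v\in V$. $S$ is a right amenable extension of $R$ with $\mathcal{F}$ if moreover: (v) for every finite $V\subseteq S$ and $\varepsilon>0$ there is $\mathcal{W}\in\hat{\mathcal{F}}$ which is $(V,\varepsilon)$-invariant, i.e. $\dim(\tilde{\mathcal{W}})\le(1+\varepsilon)\dim(\mathcal{W})$ for some $\tilde{\mathcal{W}}\in\mathcal{F}$ containing $\mathcal{W}+\mathcal{W}V$. **Normality.** A subset of $S$ is multiplicative if it contains $1_S$ and is closed under products. A nonzero $a\in S$ is a zero-divisor if $ab=0$ or $ba=0$ for some nonzero $b\in S$. $N_S(R)$ is the set of non-zero-divisors $g\in S\setminus\{0\}$ with $gR=Rg$; $\sigma_g$ is the automorphism of $R$ with $ga=\sigma_g(a)g$ for all $a\in R$. $\mathcal{F}$ is normal if there is a multiplicative subset $\mathcal{U}$ of $N_S(R)$ such that: (i) each $\mathcal{W}\in\mathcal{F}$ has an $R$-basis consisting of elements of $\mathcal{U}$; (ii) $Rg\in\mathcal{F}$ for each $g\in\mathcal{U}$; (iii) for $g\in\mathcal{U}$ and $\mathcal{W}\in\mathcal{F}$ with $\mathcal{W}\subseteq Sg$, $\{x\in S: xg\in\mathcal{W}\}\in\mathcal{F}$.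 $S$ is a right amenable normal extension of $R$ with $(\mathcal{F},\mathcal{U})$ preserving $\mathrm{rk}$ if it is right amenable with such a normal $\mathcal{F}$ and $\mathrm{rk}(\sigma_g(B))=\mathrm{rk}(B)$ for all $g\in\mathcal{U}$ and all matrices $B$ over $R$ ($\sigma_g$ entrywise). In this case $\mathcal{W}\mathcal{V}\in\mathcal{F}$ for $\mathcal{W},\mathcal{V}\in\mathcal{F}$. **Limits.** For $\mathcal{V}\in\mathcal{F}$, $\delta>0$, $\mathcal{W}\in\hat{\mathcal{F}}$ is $(\mathcal{V},\delta)$-invariant if $\dim(\mathcal{W}+\mathcal{W}\mathcal{V})\le(1+\delta)\dim(\mathcal{W})$. $\lim_{\mathcal{W}}\psi(\mathcal{W})=L\in[-\infty,+\infty]$ means: for every neighborhood $U$ of $L$ there are $\mathcal{V}\in\mathcal{F}$, $\delta>0$ with $\psi(\mathcal{W})\in U$ for all $(\mathcal{V},\delta)$-invariant $\mathcal{W}\in\hat{\mathcal{F}}$. **$\mathrm{rk}_{\mathcal{F}}$.** For $A\in M_{n,m}(S)$ and $\mathcal{W}\in\hat{\mathcal{F}}$, choose $\tilde{\mathcal{W}}\in\hat{\mathcal{F}}$ with $\mathcal{W}A_{i,j}\subseteq\tilde{\mathcal{W}}$ for all $i,j$, $R$-bases $w_1,\dots,w_l$ of $\mathcal{W}^n$ and $\tilde w_1,\dots,\tilde w_p$ of $\tilde{\mathcal{W}}^m$ (row vectors), and $B\in M_{l,p}(R)$ with $w_iA=\sum_jB_{ij}\tilde w_j$; $\mathrm{rk}_{\mathcal{W}}(A):=\mathrm{rk}(B)$,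 independent of choices. Fix an ultrafilter $\omega$ on $\hat{\mathcal{F}}$ containing the set of $(V,\varepsilon)$-invariant $\mathcal{W}$ for every finite $V\subseteq S$ and $\varepsilon>0$; $\mathrm{rk}_{\mathcal{F}}(A):=\lim_{\mathcal{W}\to\omega}\mathrm{rk}_{\mathcal{W}}(A)/\dim(\mathcal{W})$. It is a Sylvester matrix rank function for $S$; its value does not depend on $\omega$ and equals $\inf_{\mathcal{V}\in\hat{\mathcal{F}}}\mathrm{rk}_{\mathcal{V}}(A)/\dim(\mathcal{V})$. **$\dim_{\mathcal{F}}$.** For left $S$-modules $\mathcal{N}_1\subseteq\mathcal{N}_2$ with $\mathcal{N}_1$ finitely generated, $\dim_{\mathcal{F}}(\mathcal{N}_1|\mathcal{N}_2):=\lim_{\mathcal{W}}\frac{\dim(\mathcal{W}\mathcal{M}_1|\mathcal{N}_2)}{\dim(\mathcal{W})}$ for any finitely generated $R$-submodule $\mathcal{M}_1$ of $\mathcal{N}_1$ generating $\mathcal{N}_1$ as an $S$-module (the limit exists and does not depend on $\mathcal{M}_1$). For arbitrary left $S$-modules $\mathcal{N}_1\subseteq\mathcal{N}_2$, $\dim_{\mathcal{F}}(\mathcal{N}_1|\mathcal{N}_2):=\sup\dim_{\mathcal{F}}(\mathcal{N}_1^\sharp|\mathcal{N}_2)$ over finitely generated $S$-submodules $\mathcal{N}_1^\sharp$ of $\mathcal{N}_1$. **Weak quasitiling property.** $(\mathcal{F},\mathcal{U})$ has it if for any $0<\varepsilon<1$ and $\mathcal{V}\in\hat{\mathcal{F}}$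 there are $n\in\mathbb{N}$ and $(\mathcal{V},\varepsilon)$-invariant $\mathcal{W}_1,\dots,\mathcal{W}_n\in\hat{\mathcal{F}}$ such that for any $\delta>0$ and $\mathcal{V}'\in\hat{\mathcal{F}}$ there are a $(\mathcal{V}',\delta)$-invariant $\mathcal{W}\in\hat{\mathcal{F}}$, sets $C_1,\dots,C_n\subseteq\mathcal{U}\cap\mathcal{W}$ and $\mathcal{W}_{j,c}\in\mathcal{F}$ ($1\le j\le n$, $c\in C_j$) with: (i) $\mathcal{W}_{j,c}\subseteq\mathcal{W}_j$ and $\dim(\mathcal{W}_{j,c})\ge(1-\varepsilon)\dim(\mathcal{W}_j)$; (ii) the left $R$-modules $c\mathcal{W}_{j,c}$ are linearly independent (their sum is direct); (iii) $\sum_{j}\sum_{c\in C_j}c\mathcal{W}_j\subseteq\mathcal{W}$ and $\dim(\sum_j\sum_{c\in C_j}c\mathcal{W}_j)\ge(1-\varepsilon)\dim(\mathcal{W})$. *)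

(* Defs.v *)
From HB Require Import structures.
From mathcomp Require Import all_boot all_order all_algebra.
From mathcomp Require Import generic_quotient ring_quotient.
From mathcomp Require Import all_classical all_reals all_analysis.

Set Implicit Arguments.
Unset Strict Implicit.
Unset Printing Implicit Defensive.

Import Order.TTheory GRing.Theory Num.Theory.
Import numFieldNormedType.Exports.

Local Open Scope classical_set_scope.
Local Open Scope ring_scope.

(* A submodule of M is a set A : set M satisfying [submodule]; a pair of
   modules M1 <= M2 is a pair of submodules A `<=` B of some ambient module,
   so that submodules need not be turned into types. *)

Definition submodule (R : pzRingType) (M : lmodType R) (A : set M) : Prop :=
  GRing.submod_closed (mem A).

Lemma submoduleP (R : pzRingType) (M : lmodType R) (A : set M) :
  submodule A <-> A 0 /\ forall a u v, A u -> A v -> A (a *: u + v).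
Proof.
split=> [[A0 AD]|[A0 AD]].
  split=> [|a u v Au Av]; first exact/set_mem/A0.
  by apply/set_mem; apply: AD; apply/mem_set.
split=> [|a u v /set_mem Au /set_mem Av]; first exact/mem_set/A0.
exact/mem_set/AD.
Qed.

Definition subpair (R : pzRingType) (M : lmodType R) (A B : set M) : Prop :=
  [/\ submodule A, submodule B & A `<=` B].

Definition gen (R : pzRingType) (M : lmodType R) (V : set M) : set M :=
  smallest (@submodule R M) V.

Lemma gen_submodule (R : pzRingType) (M : lmodType R) (V : set M) :
  submodule (gen V).
Proof.
apply/submoduleP; split=> [A [/submoduleP[]]|] //.
by move=> a u v gu gv A hA; case/submoduleP: (hA.1) => _; apply; [exact: gu|exact: gv].
Qed.

Definition fg (R : pzRingType) (M : lmodType R) (A : set M) : Prop :=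
  exists2 V : set M, finite_set V & A = gen V.

(* The quotient M / <V>; for a submodule V this is M / V. *)

Definition gen_pred (R : pzRingType) (M : lmodType R) (V : set M) : M -> bool :=
  fun x => x \in gen V.

Lemma gen_pred_closed (R : pzRingType) (M : lmodType R) (V : set M) :
  GRing.submod_closed (gen_pred V).
Proof. exact: gen_submodule. Qed.

HB.instance Definition _ (R : pzRingType) (M : lmodType R) (V : set M) :=
  GRing.isSubmodClosed.Build R M (gen_pred V)
    (GRing.submod_closed_semi (gen_pred_closed V)).

Definition gen_closed (R : pzRingType) (M : lmodType R) (V : set M)
  : zmodClosed M := GRing.SubmodClosed.clone R M (gen_pred V) _.

Definition quotm (R : pzRingType) (M : lmodType R) (V : set M) : Type :=
  Quotient.quot (gen_closed V).

HB.instance Definition _ (R : pzRingType) (M : lmodType R) (V : set M) :=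
  GRing.Zmodule.on (quotm V).

Definition quotm_pi (R : pzRingType) (M : lmodType R) (V : set M) (x : M) :
  quotm V := \pi_(Quotient.quot (gen_closed V))%qT x.

Definition quotm_scale (R : pzRingType) (M : lmodType R) (V : set M)
  (a : R) (x : quotm V) : quotm V :=
  quotm_pi V (a *: repr (x : Quotient.quot (gen_closed V))).

Lemma quotm_piE (R : pzRingType) (M : lmodType R) (V : set M) (x y : M) :
  quotm_pi V x = quotm_pi V y <-> gen V (x - y).
Proof.
split=> [/eqP|gxy].
  by rewrite /quotm_pi -Quotient.idealrBE => /set_mem.
by apply/eqP; rewrite /quotm_pi -Quotient.idealrBE; apply/mem_set.
Qed.

Lemma quotm_piD (R : pzRingType) (M : lmodType R) (V : set M) :
  {morph quotm_pi V : x y / x + y}.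
Proof. exact: (@Quotient.pi_add _ (gen_closed V)). Qed.

Lemma quotm_reprK (R : pzRingType) (M : lmodType R) (V : set M) (x : quotm V) :
  quotm_pi V (repr (x : Quotient.quot (gen_closed V))) = x.
Proof. exact: reprK. Qed.

Lemma quotm_piZ (R : pzRingType) (M : lmodType R) (V : set M) (a : R) (x : M) :
  quotm_scale a (quotm_pi V x) = quotm_pi V (a *: x).
Proof.
apply/quotm_piE; rewrite -scalerBr.
have /submoduleP[g0 gD] := gen_submodule V.
rewrite -[_ *: _]addr0; apply: gD => //.
by apply/quotm_piE; rewrite quotm_reprK.
Qed.

Lemma quotm_scaleA (R : pzRingType) (M : lmodType R) (V : set M) (a b : R)
  (x : quotm V) : quotm_scale a (quotm_scale b x) = quotm_scale (a * b) x.
Proof. by rewrite -[x]quotm_reprK !quotm_piZ scalerA. Qed.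

Lemma quotm_scale1 (R : pzRingType) (M : lmodType R) (V : set M) :
  left_id 1 (@quotm_scale R M V).
Proof. by move=> x; rewrite -[x]quotm_reprK quotm_piZ scale1r. Qed.

Lemma quotm_scaleDr (R : pzRingType) (M : lmodType R) (V : set M) :
  right_distributive (@quotm_scale R M V) +%R.
Proof.
move=> a x y; rewrite -[x]quotm_reprK -[y]quotm_reprK.
by rewrite !quotm_piZ -!quotm_piD quotm_piZ scalerDr.
Qed.

Lemma quotm_scaleDl (R : pzRingType) (M : lmodType R) (V : set M)
  (x : quotm V) : {morph (@quotm_scale R M V)^~ x : a b / a + b}.
Proof.
by move=> a b; rewrite -[x]quotm_reprK !quotm_piZ -quotm_piD scalerDl.
Qed.

HB.instance Definition _ (R : pzRingType) (M : lmodType R) (V : set M) :=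
  GRing.Zmodule_isLmodule.Build R (quotm V) (@quotm_scaleA R M V)
    (@quotm_scale1 R M V) (@quotm_scaleDr R M V) (@quotm_scaleDl R M V).

Record sylvester_matrix_rank (K : realType) (R : pzRingType)
    (rk : forall n m, 'M[R]_(n, m) -> K) : Prop := {
  smr_ge0 : forall n m (A : 'M[R]_(n, m)), 0 <= rk n m A;
  smr_0 : forall n m, rk n m 0 = 0;
  smr_1 : rk 1%N 1%N 1%:M = 1;
  smr_mul : forall n m p (A : 'M[R]_(n, m)) (B : 'M[R]_(m, p)),
    rk n p (A *m B) <= Num.min (rk n m A) (rk m p B);
  smr_diag : forall n m p q (A : 'M[R]_(n, m)) (B : 'M[R]_(p, q)),
    rk (n + p)%N (m + q)%N (block_mx A 0 0 B) = rk n m A + rk p q B;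
  smr_trig : forall n m p q (A : 'M[R]_(n, m)) (B : 'M[R]_(p, q))
      (C : 'M[R]_(n, q)),
    rk n m A + rk p q B <= rk (n + p)%N (m + q)%N (block_mx A C 0 B) }.

Definition linear_on (R : pzRingType) (M M' : lmodType R) (B : set M)
    (f : M -> M') : Prop :=
  forall a u v, B u -> B v -> f (a *: u + v) = a *: f u + f v.

(* [dim M A B] is dim(A|B) for a pair of submodules A `<=` B of M. *)
Record bivariant_module_rank (K : realType) (R : pzRingType)
    (dim : forall M : lmodType R, set M -> set M -> \bar K) : Prop := {
  bmr_ge0 : forall (M : lmodType R) (A B : set M),
    subpair A B -> (0 <= dim M A B)%E;
  bmr_iso : forall (M M' : lmodType R) (A B : set M) (A' B' : set M')
      (f : M -> M'),
    subpair A B -> subpair A' B' -> linear_on B f ->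
    set_bij B B' f -> f @` A = A' -> dim M A B = dim M' A' B';
  bmr_0 : forall M : lmodType R, dim M [set 0] [set 0] = 0%E;
  bmr_1 : dim R^o setT setT = 1%E;
  bmr_sum : forall (M M' : lmodType R) (A B : set M) (A' B' : set M'),
    subpair A B -> subpair A' B' ->
    dim (M * M')%type (A `*` A') (B `*` B') = (dim M A B + dim M' A' B')%E;
  bmr_sup : forall (M : lmodType R) (A B : set M), subpair A B ->
    dim M A B = ereal_sup [set dim M A1 B | A1 in
      [set A1 | [/\ submodule A1, fg A1 & A1 `<=` A]]];
  bmr_inf : forall (M : lmodType R) (A B : set M), subpair A B -> fg A ->
    dim M A B = ereal_inf [set dim M A B1 | B1 in
      [set B1 | [/\ submodule B1, fg B1, A `<=` B1 & B1 `<=` B]]];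
  bmr_quot : forall (M : lmodType R) (A B : set M), subpair A B ->
    dim M B B =
    (dim M A B + dim (quotm A) (quotm_pi A @` B) (quotm_pi A @` B))%E }.

Definition rowspace (R : pzRingType) n m (A : 'M[R]_(n, m)) : set 'rV[R]_m :=
  [set v *m A | v in [set: 'rV[R]_n]].

Definition corresponding (K : realType) (R : pzRingType)
    (rk : forall n m, 'M[R]_(n, m) -> K)
    (dim : forall M : lmodType R, set M -> set M -> \bar K) : Prop :=
  forall n m (A : 'M[R]_(n, m)),
    ((rk n m A)%:E = dim 'rV[R]_m (rowspace A) setT)%E.

Definition IBN (R : pzRingType) : Prop :=
  forall n m (f : {linear 'rV[R]_n -> 'rV[R]_m}), bijective f -> n = m.

Definition is_basis (R : pzRingType) (M : lmodType R) (A : set M) n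
    (w : 'I_n -> M) : Prop :=
  (forall c : 'I_n -> R, \sum_i c i *: w i = 0 -> forall i, c i = 0) /\
  A = gen (range w).

Definition fg_free (R : pzRingType) (M : lmodType R) (A : set M) : Prop :=
  exists n (w : 'I_n -> M), is_basis A w.

(* The rank of a finitely generated free module over a ring with IBN. *)
Definition frank (R : pzRingType) (M : lmodType R) (A : set M) : nat :=
  xget 0%N [set n | exists w : 'I_n -> M, is_basis A w].

Definition addset (V : zmodType) (A B : set V) : set V :=
  [set x + y | x in A & y in B].

(* Restriction of scalars along f : R -> S. *)

Definition restr (R S : pzRingType) (f : {rmorphism R -> S}) (N : lmodType S)
  : Type := N.

HB.instance Definition _ (R S : pzRingType) (f : {rmorphism R -> S})
    (N : lmodType S) := GRing.Zmodule.copy (restr f N) N.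

Definition restr_scale (R S : pzRingType) (f : {rmorphism R -> S})
  (N : lmodType S) (a : R) (x : restr f N) : restr f N := f a *: (x : N).

Lemma restr_scaleA (R S : pzRingType) (f : {rmorphism R -> S})
  (N : lmodType S) (a b : R) (x : restr f N) :
  restr_scale a (restr_scale b x) = restr_scale (a * b) x.
Proof. by rewrite /restr_scale scalerA rmorphM. Qed.

Lemma restr_scale1 (R S : pzRingType) (f : {rmorphism R -> S})
  (N : lmodType S) : left_id 1 (@restr_scale R S f N).
Proof. by move=> x; rewrite /restr_scale rmorph1 scale1r. Qed.

Lemma restr_scaleDr (R S : pzRingType) (f : {rmorphism R -> S})
  (N : lmodType S) : right_distributive (@restr_scale R S f N) +%R.
Proof. by move=> a x y; rewrite /restr_scale [LHS]scalerDr. Qed.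

Lemma restr_scaleDl (R S : pzRingType) (f : {rmorphism R -> S})
  (N : lmodType S) (x : restr f N) :
  {morph (@restr_scale R S f N)^~ x : a b / a + b}.
Proof. by move=> a b; rewrite /restr_scale rmorphD [LHS]scalerDl. Qed.

HB.instance Definition _ (R S : pzRingType) (f : {rmorphism R -> S})
    (N : lmodType S) :=
  GRing.Zmodule_isLmodule.Build R (restr f N) (@restr_scaleA R S f N)
    (@restr_scale1 R S f N) (@restr_scaleDr R S f N) (@restr_scaleDl R S f N).

(* In what follows the inclusion of R in S is an (injective) ring morphism
   [iota]; left R-submodules of S are sets W : set S that are submodules of
   [restr iota S^o]. *)

Definition dimS (R S : pzRingType) (iota : {rmorphism R -> S}) (W : set S)
  : nat := frank (W : set (restr iota S^o)).

Definition mulset (S : pzRingType) (N : lmodType S) (W : set S) (V : set N)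
  : set N :=
  [set x | exists n (w : 'I_n -> S) (v : 'I_n -> N),
    [/\ forall i, W (w i), forall i, V (v i) & x = \sum_i w i *: v i]].

Definition mulsetS (S : pzRingType) (W V : set S) : set S :=
  mulset W (V : set S^o).

Definition Fhat (S : pzRingType) (F : set (set S)) : set (set S) :=
  [set W | F W /\ W != [set 0]].

Record finite_approx_system (R S : pzRingType) (iota : {rmorphism R -> S})
    (F : set (set S)) : Prop := {
  fas_IBN : IBN R;
  fas_free : forall W, F W -> fg_free (W : set (restr iota S^o));
  fas_cap : forall W V, F W -> F V -> F (W `&` V);
  fas_add : forall W V, F W -> F V -> F (addset W V);
  fas_compl : forall V W, F V -> F W -> V `<=` W ->
    exists V', [/\ F V', W = addset V V' & V `&` V' = [set 0]];
  fas_fg : forall A : set (restr iota S^o), submodule A -> fg A ->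
    exists2 W, F W & A `<=` W }.

(* (V, e)-invariance for a finite subset V of S. *)
Definition fin_invariant (K : realType) (R S : pzRingType)
    (iota : {rmorphism R -> S}) (F : set (set S)) (V : set S) (e : K)
    (W : set S) : Prop :=
  exists W', [/\ F W', addset W (mulsetS W V) `<=` W' &
    (dimS iota W')%:R <= (1 + e) * (dimS iota W)%:R].

(* (V, d)-invariance for a member V of F. *)
Definition F_invariant (K : realType) (R S : pzRingType)
    (iota : {rmorphism R -> S}) (V : set S) (d : K) (W : set S) : Prop :=
  (dimS iota (addset W (mulsetS W V)))%:R <= (1 + d) * (dimS iota W)%:R.

Record right_amenable (K : realType) (R S : pzRingType)
    (iota : {rmorphism R -> S}) (F : set (set S)) : Prop := {
  ra_fas : finite_approx_system iota F;
  ra_inv : forall (V : set S) (e : K), finite_set V -> 0 < e ->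
    exists2 W, Fhat F W & fin_invariant iota F V e W }.

Definition zero_divisor (S : pzRingType) (a : S) : Prop :=
  a != 0 /\ exists2 b : S, b != 0 & a * b = 0 \/ b * a = 0.

Definition multiplicative_set (S : pzRingType) (U : set S) : Prop :=
  U 1 /\ forall g h, U g -> U h -> U (g * h).

Definition Rmul (R S : pzRingType) (iota : {rmorphism R -> S}) (g : S)
  : set S := [set iota a * g | a in [set: R]].

(* N_S(R). *)
Definition normalizing (R S : pzRingType) (iota : {rmorphism R -> S})
  : set S :=
  [set g | [/\ g != 0, ~ zero_divisor g &
    [set g * iota a | a in [set: R]] = Rmul iota g]].

(* sigma_g, characterized by g a = sigma_g(a) g. *)
Definition sigma (R S : pzRingType) (iota : {rmorphism R -> S}) (g : S)
    (a : R) : R :=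
  xget 0 [set b | g * iota a = iota b * g].

Record normal_system (R S : pzRingType) (iota : {rmorphism R -> S})
    (F : set (set S)) (U : set S) : Prop := {
  ns_sub : U `<=` normalizing iota;
  ns_mul : multiplicative_set U;
  ns_basis : forall W, F W -> exists n (w : 'I_n -> S),
    (forall i, U (w i)) /\
    is_basis (W : set (restr iota S^o)) (w : 'I_n -> restr iota S^o);
  ns_Rg : forall g, U g -> F (Rmul iota g);
  ns_div : forall g W, U g -> F W -> W `<=` [set x * g | x in [set: S]] ->
    F [set x | W (x * g)] }.

Record amenable_normal_extension (K : realType) (R S : pzRingType)
    (iota : {rmorphism R -> S}) (F : set (set S)) (U : set S)
    (rk : forall n m, 'M[R]_(n, m) -> K) : Prop := {
  ane_inj : injective iota;
  ane_amenable : right_amenable K iota F;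
  ane_normal : normal_system iota F U;
  ane_rk : forall g n m (B : 'M[R]_(n, m)), U g ->
    rk n m (map_mx (sigma iota g) B) = rk n m B }.

(* The filter base of the sets of (V, d)-invariant nonzero members of F, so
   that lim_W psi(W) = L reads [psi @ inv_filter K iota F --> L]. *)
Definition inv_filter (K : realType) (R S : pzRingType)
    (iota : {rmorphism R -> S}) (F : set (set S)) : set_system (set S) :=
  [set P | exists V (d : K), [/\ F V, 0 < d &
    forall W, Fhat F W -> F_invariant iota V d W -> P W]].

(* W^n inside the row vectors S^n, seen as an R-module. *)
Definition rowset (R S : pzRingType) (iota : {rmorphism R -> S}) n
    (W : set S) : set (restr iota 'rV[S]_n) :=
  [set v | forall j, W ((v : 'rV[S]_n) 0 j)].

Arguments rowset {R S} iota n W.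

Definition rkW_spec (K : realType) (R S : pzRingType)
    (iota : {rmorphism R -> S}) (F : set (set S))
    (rk : forall n m, 'M[R]_(n, m) -> K) (W : set S) n m (A : 'M[S]_(n, m))
    (r : K) : Prop :=
  exists W' : set S,
    [/\ Fhat F W', forall i j x, W x -> W' (x * A i j) &
      exists l p (w : 'I_l -> restr iota 'rV[S]_n)
          (w' : 'I_p -> restr iota 'rV[S]_m) (B : 'M[R]_(l, p)),
        [/\ is_basis (rowset iota n W) w, is_basis (rowset iota m W') w',
            forall i, (w i : 'rV[S]_n) *m A = \sum_j B i j *: w' j &
            r = rk l p B]].

Definition rkW (K : realType) (R S : pzRingType)
    (iota : {rmorphism R -> S}) (F : set (set S))
    (rk : forall n m, 'M[R]_(n, m) -> K) (W : set S) n m (A : 'M[S]_(n, m))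
    : K :=
  xget 0 [set r | rkW_spec iota F rk W A r].

(* An ultrafilter on the nonzero members of F, as an ultrafilter on set S:
   the sets that it is required to contain consist of nonzero members. *)
Definition invariant_ultrafilter (K : realType) (R S : pzRingType)
    (iota : {rmorphism R -> S}) (F : set (set S)) (omega : set_system (set S))
    : Prop :=
  UltraFilter omega /\
  forall (V : set S) (e : K), finite_set V -> 0 < e ->
    omega [set W | Fhat F W /\ fin_invariant iota F V e W].

Definition rkF (K : realType) (R S : pzRingType)
    (iota : {rmorphism R -> S}) (F : set (set S))
    (rk : forall n m, 'M[R]_(n, m) -> K) (omega : set_system (set S))
    n m (A : 'M[S]_(n, m)) : K :=
  lim ((fun W => rkW iota F rk W A / (dimS iota W)%:R) @ omega).

(* dim_F(A|B) for finitely generated A: the common limit for all finitely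
   generated R-submodules A1 of A that generate A over S. *)
Definition dimF_fg (K : realType) (R S : pzRingType)
    (iota : {rmorphism R -> S}) (F : set (set S))
    (dim : forall M : lmodType R, set M -> set M -> \bar K)
    (N : lmodType S) (A B : set N) : \bar K :=
  xget 0%E [set L | forall A1 : set N,
    submodule (A1 : set (restr iota N)) -> fg (A1 : set (restr iota N)) ->
    gen A1 = A ->
    (fun W => dim (restr iota N) (mulset W A1) B *
              ((dimS iota W)%:R^-1)%:E)%E @ inv_filter K iota F --> L].

Definition dimF (K : realType) (R S : pzRingType)
    (iota : {rmorphism R -> S}) (F : set (set S))
    (dim : forall M : lmodType R, set M -> set M -> \bar K)
    (N : lmodType S) (A B : set N) : \bar K :=
  ereal_sup [set dimF_fg iota F dim A1 B | A1 in
    [set A1 | [/\ submodule A1, fg A1 & A1 `<=` A]]].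

(* A family (A i), indexed by the i in D, whose sum is direct. *)
Definition independent_sets (M : zmodType) (I : eqType) (D : set I)
    (A : I -> set M) : Prop :=
  forall (s : seq I) (x : I -> M), uniq s ->
    (forall i, i \in s -> D i /\ A i (x i)) ->
    \sum_(i <- s) x i = 0 -> forall i, i \in s -> x i = 0.

Definition lmulset (S : pzRingType) (c : S) (W : set S) : set S :=
  [set c * w | w in W].

Definition weak_quasitiling (K : realType) (R S : pzRingType)
    (iota : {rmorphism R -> S}) (F : set (set S)) (U : set S) : Prop :=
  forall (e : K) (V : set S), 0 < e < 1 -> Fhat F V ->
  exists n (T : 'I_n -> set S),
    (forall j, Fhat F (T j) /\ F_invariant iota V e (T j)) /\
    forall (d : K) (V' : set S), 0 < d -> Fhat F V' ->
    exists (W : set S) (C : 'I_n -> set S) (Tc : 'I_n -> S -> set S),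
      [/\ Fhat F W, F_invariant iota V' d W,
          forall j, C j `<=` U `&` W & forall j c, C j c -> F (Tc j c)] /\
      [/\ forall j c, C j c -> Tc j c `<=` T j /\
            (1 - e) * (dimS iota (T j))%:R <= (dimS iota (Tc j c))%:R,
          independent_sets [set i : 'I_n * S | C i.1 i.2]
            (fun i => lmulset i.2 (Tc i.1 i.2)) &
          let Sum : set (restr iota S^o) :=
            gen (M := restr iota S^o) (\bigcup_j \bigcup_(c in C j) lmulset c (T j)) in
          Sum `<=` W /\
          (1 - e) * (dimS iota W)%:R <= (dimS iota Sum)%:R].

(* Main.v *)
(* Write phi(W) = dim(W M | N) for a finitely generated R-submodule M of N.
   Left multiplication by an element of U is semilinear for an automorphism of
   R preserving rk, so it cannot increase dim, and phi satisfies
     phi(X + c V) + phi(Z) <= phi(X) + phi(V)   when Z <= V and c Z <= X.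
   This submodularity makes Petridis' proof of the Pluennecke inequality work:
   given V, take Z0 <= V having a translate g Z0 in F and almost minimizing
   phi(Z) / dim(Z), and add one by one the basis elements c of any W to get
   phi(W g Z0) <= (phi(V) / dim(V) + e) dim(W g Z0) + e dim(W).
   If W is sufficiently invariant then phi(W) is close to phi(W g Z0), so
   phi(W) / dim(W) converges to its infimum over F.  The same argument
   relative to a finitely generated R-submodule K0 of N1 bounds the growth of
   W M modulo W g K0 by that of V M modulo K0 for one single V; applied with
   dim(V M + K0 | N) - dim(K0 | N) close to dim(V M | N / N1), this is the
   nontrivial half of the additivity of dim_F.  Finally rk_W(A) is exactly
   dim(W M | S^m), where M is spanned by the rows of A. *)
Require Import Defs.
From HB Require Import structures.
From mathcomp Require Import all_boot all_order all_algebra.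
From mathcomp Require Import all_classical all_reals all_analysis.
From mathcomp Require Import lra ring.

Set Implicit Arguments.
Unset Strict Implicit.
Unset Printing Implicit Defensive.

Import Order.TTheory GRing.Theory Num.Theory.
Import numFieldNormedType.Exports.

Local Open Scope classical_set_scope.
Local Open Scope ring_scope.

(** * Submodules *)

(** Two obstacles shape the development. First, the axioms tie [dim] to [rk] but say nothing about
    semilinear maps. Twisting the scalars by [sigma g] gives a second bivariant rank function with
    the same matrix rank, so the invariance behind left multiplication comes from a uniqueness
    theorem, proved by presenting finitely generated modules as images of [R^m]. Second, the
    submodularity argument meets sets of those [z] in [Z0] with [h z] in [X], for [h] in [U]. A
    normal system allows division on the right only, so such a set need not be in [F]; its
    translate, the intersection of [h Z0] and [X], is. Hence the minimization runs over submodules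
    of [V] with some left translate in [F], and growth is measured against the rank of that
    translate. The price is that [K0] is replaced by [g K0], which costs nothing inside an
    [S]-submodule. Submodularity itself is right exactness of quotients: [dim(A|B)] is
    [dim(B) - dim(B/A)] when all is finite, and the sup and inf axioms carry the inequality to
    arbitrary ambient modules. *)

Section Submodules.
Context {R : pzRingType}.
Implicit Types (M : lmodType R).

Lemma submod0 M (A : set M) : submodule A -> A 0.
Proof. by case/submoduleP. Qed.

Lemma submodZ M (A : set M) a x : submodule A -> A x -> A (a *: x).
Proof.
by move=> /submoduleP[A0 AD] Ax; rewrite -[_ *: _]addr0; apply: AD.
Qed.

Lemma submodD M (A : set M) x y : submodule A -> A x -> A y -> A (x + y).
Proof. by move=> /submoduleP[_ AD] Ax Ay; rewrite -[x]scale1r; apply: AD. Qed.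

Lemma submodN M (A : set M) x : submodule A -> A x -> A (- x).
Proof. by move=> sA Ax; rewrite -scaleN1r; apply: submodZ. Qed.

Lemma submodB M (A : set M) x y : submodule A -> A x -> A y -> A (x - y).
Proof. by move=> sA Ax Ay; apply: submodD => //; apply: submodN. Qed.

Lemma submod_sum M (A : set M) (I : Type) (s : seq I) (P : pred I)
  (x : I -> M) :
  submodule A -> (forall i, P i -> A (x i)) -> A (\sum_(i <- s | P i) x i).
Proof.
move=> sA Ax; elim/big_ind: _ => //; first exact: submod0.
by move=> u v; apply: submodD.
Qed.

Lemma submodule_intro M (A : set M) : A 0 -> (forall x y, A x -> A y -> A
  (x + y)) ->
  (forall a x, A x -> A (a *: x)) -> submodule A.
Proof.
by move=> A0 AD AZ; apply/submoduleP; split=> // a u v Au Av; apply/AD/Av/AZ.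
Qed.

Lemma subpairxx M (A : set M) : submodule A -> subpair A A.
Proof. by split. Qed.

Lemma submoduleT M : submodule [set: M].
Proof. by apply: submodule_intro. Qed.

Lemma submodule_set0 M : submodule [set 0 : M].
Proof.
by apply: submodule_intro => //= [x y -> ->|a x ->]; rewrite ?addr0 ?scaler0.
Qed.

Lemma submoduleI M (A B : set M) : submodule A -> submodule B ->
  submodule (A `&` B).
Proof.
move=> sA sB; apply: submodule_intro => [|x y [Ax Bx] [Ay By]|a x [Ax Bx]].
- by split; apply: submod0.
- by split; apply: submodD.
- by split; apply: submodZ.
Qed.

Lemma submodule_addset M (A B : set M) :
  submodule A -> submodule B -> submodule (addset A B).
Proof.
move=> sA sB; apply: submodule_intro.
- by exists 0; [exact: submod0|exists 0; [exact: submod0|rewrite addr0]].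
- move=> _ _ [a Aa [b Bb <-]] [c Ac [d Bd <-]].
  exists (a + c); first exact: submodD.
  by exists (b + d); [exact: submodD|rewrite addrACA].
- move=> r _ [a Aa [b Bb <-]]; exists (r *: a); first exact: submodZ.
  by exists (r *: b); [exact: submodZ|rewrite scalerDr].
Qed.

Lemma submodule_setX M M' (A : set M) (A' : set M') :
  submodule A -> submodule A' -> submodule (A `*` A').
Proof.
move=> sA sA'; apply: submodule_intro.
- by split; apply: submod0.
- by move=> x y [? ?] [? ?]; split; apply: submodD.
- by move=> a x [? ?]; split; apply: submodZ.
Qed.

Lemma addset_subl M (A B : set M) : submodule B -> A `<=` addset A B.
Proof. by move=> sB x Ax; exists x => //; exists 0;
  [exact: submod0|rewrite addr0]. Qed.

Lemma addset_subr M (A B : set M) : submodule A -> B `<=` addset A B.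
Proof. by move=> sA x Bx; exists 0; [exact: submod0|exists x => //;
  rewrite add0r]. Qed.

Lemma addset_sub M (A B C : set M) : submodule C ->
  A `<=` C -> B `<=` C -> addset A B `<=` C.
Proof. by move=> sC hA hB _ [a Aa [b Bb <-]]; apply: submodD => //;
  [apply: hA|apply: hB]. Qed.

Lemma lin0 M M' (f : M -> M') : linear f -> f 0 = 0.
Proof.
move=> fl; have := fl 1 0 0; rewrite !scale1r addr0 => /eqP.
by rewrite -subr_eq subrr eq_sym => /eqP.
Qed.

Lemma linD M M' (f : M -> M') : linear f -> {morph f : x y / x + y}.
Proof. by move=> fl x y; rewrite -[in LHS](scale1r x) fl scale1r. Qed.

Lemma linZ M M' (f : M -> M') a : linear f -> {morph f : x / a *: x}.
Proof. by move=> fl x; rewrite -[in LHS](addr0 (a *: x)) fl lin0// addr0. Qed.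

Lemma linN M M' (f : M -> M') : linear f -> {morph f : x / - x}.
Proof. by move=> fl x; rewrite -scaleN1r linZ// scaleN1r. Qed.

Lemma linB M M' (f : M -> M') : linear f -> {morph f : x y / x - y}.
Proof. by move=> fl x y; rewrite linD// linN. Qed.

Lemma submodule_image M M' (f : M -> M') (A : set M) :
  linear f -> submodule A -> submodule (f @` A).
Proof.
move=> fl sA; apply: submodule_intro.
- by exists 0; [exact: submod0|exact: lin0].
- by move=> _ _ [x Ax <-] [y Ay <-]; exists (x + y);
    [exact: submodD|exact: linD].
- by move=> a _ [x Ax <-]; exists (a *: x); [exact: submodZ|exact: linZ].
Qed.

Lemma submodule_preimage M M' (f : M -> M') (A : set M') :
  linear f -> submodule A -> submodule (f @^-1` A).
Proof.
move=> fl sA; apply: submodule_intro => /= [|x y Ax Ay|a x Ax].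
- by rewrite lin0//; apply: submod0.
- by rewrite linD//; apply: submodD.
- by rewrite linZ//; apply: submodZ.
Qed.

Lemma sub_gen M (V : set M) : V `<=` gen V.
Proof. by move=> x Vx A [_]; apply. Qed.

Lemma gen_sub M (V A : set M) : submodule A -> V `<=` A -> gen V `<=` A.
Proof. by move=> sA VA x; apply; split. Qed.

Lemma gen_id M (A : set M) : submodule A -> gen A = A.
Proof. by move=> sA; apply/seteqP; split; [apply: gen_sub|apply: sub_gen]. Qed.

Lemma gen_mono M (V W : set M) : V `<=` W -> gen V `<=` gen W.
Proof. by move=> VW; apply: gen_sub;
  [exact: gen_submodule|apply: subset_trans VW (@sub_gen _ _)]. Qed.

Lemma image_gen M M' (f : M -> M') (V : set M) : linear f ->
  f @` gen V = gen (f @` V).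
Proof.
move=> fl; apply/seteqP; split.
  have : gen V `<=` f @^-1` gen (f @` V).
    apply: gen_sub; first exact/submodule_preimage/gen_submodule.
    by move=> x Vx; apply: sub_gen; exists x.
  by move=> h _ [x gx <-]; apply: h.
apply: gen_sub; first exact/submodule_image/gen_submodule.
by move=> _ [x Vx <-]; exists x => //; apply: sub_gen.
Qed.

Lemma gen_setU M (V W : set M) : gen (V `|` W) = addset (gen V) (gen W).
Proof.
have sV := gen_submodule V; have sW := gen_submodule W.
apply/seteqP; split.
  apply: gen_sub; first exact: submodule_addset.
  move=> x [/sub_gen|/sub_gen]; first exact: addset_subl.
  exact: addset_subr.
by apply: addset_sub; [exact: gen_submodule|apply: gen_mono => x; left
  |apply: gen_mono => x; right].
Qed.

Lemma fg_image M M' (f : M -> M') (A : set M) : linear f -> fg A -> fg (f @` A).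
Proof.
by move=> fl [V fV ->]; exists (f @` V); [exact: finite_image|exact: image_gen].
Qed.

Lemma fg_addset M (A B : set M) : fg A -> fg B -> fg (addset A B).
Proof.
move=> [V fV ->] [W fW ->]; exists (V `|` W); last by rewrite gen_setU.
by rewrite finite_setU.
Qed.

Lemma fg_submodule M (A : set M) : fg A -> submodule A.
Proof. by move=> [V _ ->]; exact: gen_submodule. Qed.

Lemma fg_set0 M : fg [set 0 : M].
Proof. by exists [set 0]; [exact: finite_set1|rewrite gen_id//;
  exact: submodule_set0]. Qed.

Definition lspan M n (w : 'I_n -> M) : set M :=
  [set x | exists c : 'I_n -> R, x = \sum_i c i *: w i].

Lemma lspan_submodule M n (w : 'I_n -> M) : submodule (lspan w).
Proof.
apply: submodule_intro.
- by exists (fun=> 0); rewrite big1// => i _; rewrite scale0r.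
- move=> _ _ [c ->] [d ->]; exists (fun i => c i + d i).
  by rewrite -big_split; apply: eq_bigr => i _; rewrite scalerDl.
- move=> a _ [c ->]; exists (fun i => a * c i).
  by rewrite scaler_sumr; apply: eq_bigr => i _; rewrite scalerA.
Qed.

Lemma gen_rangeE M n (w : 'I_n -> M) : gen (range w) = lspan w.
Proof.
apply/seteqP; split.
  apply: gen_sub; first exact: lspan_submodule.
  move=> _ [i _ <-]; exists (fun j => (j == i)%:R).
  rewrite (bigD1 i)//= eqxx scale1r big1 ?addr0// => j /negPf ->.
  by rewrite scale0r.
move=> _ [c ->]; apply: (submod_sum _ (gen_submodule _)) => i _.
by apply: (submodZ _ (gen_submodule _)); apply: sub_gen; exists i.
Qed.

Lemma finite_range n T (w : 'I_n -> T) : finite_set (range w).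
Proof. exact/finite_image/finite_finset. Qed.

Lemma fg_lspan M n (w : 'I_n -> M) : fg (lspan w).
Proof. by rewrite -gen_rangeE; exists (range w) => //; exact: finite_range. Qed.

Lemma fg_ex M (A : set M) : fg A -> exists n (w : 'I_n -> M), A = lspan w.
Proof.
move=> [V /finite_seqP[s ->] ->]; exists (size s), (fun i => nth 0 s i).
rewrite -gen_rangeE; congr gen; apply/seteqP; split=> x /=.
  by move=> /(nthP 0)[i ltis <-]; exists (Ordinal ltis).
by move=> [i _ <-]; rewrite mem_nth.
Qed.

Definition lincomb M n (w : 'I_n -> M)
  (v : 'rV[R]_n) : M := \sum_i v 0 i *: w i.

Lemma lincomb_lin M n (w : 'I_n -> M) : linear (lincomb w).
Proof.
move=> a u v; rewrite /lincomb scaler_sumr -big_split; apply: eq_bigr => i _.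
by rewrite !mxE scalerDl scalerA.
Qed.

Lemma lincomb_range M n (w : 'I_n -> M) : lincomb w @` setT = lspan w.
Proof.
apply/seteqP; split=> [_ [v _ <-]|_ [c ->]]; first by exists (v 0).
by exists (\row_i c i) => //; apply: eq_bigr => i _; rewrite mxE.
Qed.

Lemma quotm_pi_lin M (V : set M) : linear (quotm_pi V).
Proof. by move=> a u v; rewrite quotm_piD -quotm_piZ. Qed.

Lemma quotm_pi_eq0 M (V : set M) x : submodule V -> quotm_pi V x = 0 <-> V x.
Proof.
move=> sV; rewrite -(lin0 (@quotm_pi_lin M V)) quotm_piE subr0 gen_id//.
Qed.

Lemma quotm_pi_surj M (V : set M) (y : quotm V) : exists x, quotm_pi V x = y.
Proof. by eexists; exact: quotm_reprK. Qed.

Lemma quotm_lift M M' (V : set M) (h : M -> M') : submodule V -> linear h ->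
  (forall x, V x -> h x = 0) ->
  exists2 k : quotm V -> M', linear k & forall x, k (quotm_pi V x) = h x.
Proof.
move=> sV hl hV.
pose k (y : quotm V) := h (repr (y : Quotient.quot (gen_closed V))).
have kE x : k (quotm_pi V x) = h x.
  apply/eqP; rewrite /k -subr_eq0 -linB//; apply/eqP/hV/(gen_sub sV);
    first exact: subset_refl.
  by apply/quotm_piE; exact: quotm_reprK.
exists k; last exact: kE.
move=> a u v; have [x <-] := quotm_pi_surj u.
by have [y <-] := quotm_pi_surj v; rewrite -quotm_pi_lin !kE hl.
Qed.

End Submodules.

(** * Bivariant Sylvester module rank functions *)

Section BivariantRank.
Context {K : realType} {R : pzRingType}.
Variable dim : forall M : lmodType R, set M -> set M -> \bar K.
Hypothesis Hdim : bivariant_module_rank dim.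
Implicit Types (M : lmodType R).
Arguments dim {M}.

Lemma dim_le_l M (A A' B : set M) : subpair A B -> subpair A' B -> A `<=` A' ->
  (dim A B <= dim A' B)%E.
Proof.
move=> sA sA' AA'; rewrite (bmr_sup Hdim sA) (bmr_sup Hdim sA').
apply: le_ereal_sup => _ [A1 [s1 f1 h1] <-]; exists A1 => //.
by split=> //; apply: subset_trans AA'.
Qed.

(** The infimum axiom needs a finitely generated first argument, so the supremum axiom first reduces
    [A] to finitely generated [A1]; the larger [B'] then only offers more intermediate modules to
    the infimum. *)
Lemma dim_le_r M (A B B' : set M) : subpair A B -> submodule B' -> B `<=` B' ->
  (dim A B' <= dim A B)%E.
Proof.
move=> [sA sB AB] sB' BB'.
have sAB' : subpair A B' by split=> //; apply: subset_trans BB'.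
rewrite (bmr_sup Hdim sAB') (bmr_sup Hdim (And3 sA sB AB)).
apply: ge_ereal_sup => _ [A1 [s1 f1 h1] <-].
apply: (@le_trans _ _ (dim A1 B)); last by apply: ereal_sup_ubound; exists A1.
have A1B := subset_trans h1 AB; have A1B' := subset_trans A1B BB'.
rewrite (bmr_inf Hdim (And3 s1 sB' A1B') f1) (bmr_inf Hdim (And3 s1 sB A1B) f1).
apply: le_ereal_inf => _ [B1 [t1 g1 k1 l1] <-]; exists B1 => //; split=> //.
exact: subset_trans BB'.
Qed.

(** Rank-nullity: the quotient axiom for the kernel of [f] on [B], the quotient being identified
    with the image of [B] by the isomorphism axiom. *)
Lemma dim_ker M M' (f : M -> M') (B : set M) : linear f -> submodule B ->
  (dim B B = dim (B `&` f @^-1` [set 0%R]) B + dim (f @` B) (f @` B))%E.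
Proof.
move=> fl sB; set A := B `&` _.
have sA : submodule A.
  by apply: submoduleI => //; exact: submodule_preimage (@submodule_set0 _ _).
rewrite (@bmr_quot _ _ _ Hdim _ A B); last by split=> // x [].
congr (_ + _)%E.
have [k kl kE] : exists2 k : quotm A -> M', linear k &
    forall x, k (quotm_pi A x) = f x.
  by apply: quotm_lift => // x [].
have sBq := submodule_image (@quotm_pi_lin _ _ A) sB.
have sfB := submodule_image fl sB.
have kB : k @` (quotm_pi A @` B) = f @` B.
  apply/seteqP; split=> [_ [_ [x Bx <-] <-]|_ [x Bx <-]].
    by rewrite kE; exists x.
  by exists (quotm_pi A x); [exists x|rewrite kE].
apply: (bmr_iso Hdim (f := k)); [by split|by split| | |exact: kB].
  by move=> a u v _ _; exact: kl.
split; first by rewrite -kB; move=> x Bx; exists x.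
  move=> ? ? /set_mem[x Bx <-] /set_mem[y By <-]; rewrite !kE => fxy.
  apply/quotm_piE; apply: sub_gen; split; first exact: submodB.
  by rewrite /= linB// fxy subrr.
by rewrite -kB.
Qed.

Lemma dim_image_le M M' (f : M -> M') (B : set M) : linear f -> submodule B ->
  (dim (f @` B) (f @` B) <= dim B B)%E.
Proof.
move=> fl sB; rewrite (dim_ker fl sB) leeDr//; apply: (bmr_ge0 Hdim).
have sA : submodule (B `&` f @^-1` [set 0]).
  by apply: submoduleI => //; exact: submodule_preimage (@submodule_set0 _ _).
by split=> // x [].
Qed.

Definition qdim M (A B : set M) := dim (quotm_pi A @` B) (quotm_pi A @` B).

(** Dimension count in the right exact sequence from [B/A1] to the sum of [B'/A1'] and [B/A2], then
    to [B'/(f A2 + A1')] and 0. The kernel of the second map is the image of the first; its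
    dimension relative to the middle term is at most its own dimension, hence at most that of
    [B/A1]. *)
Lemma qdim_right_exact M M' (f : M -> M') (A1 A2 B : set M) (A1' B' : set M') :
  linear f -> submodule B -> submodule B' -> f @` B `<=` B' ->
  submodule A1 -> submodule A2 -> A1 `<=` A2 -> A2 `<=` B ->
  submodule A1' -> A1' `<=` B' -> f @` A1 `<=` A1' ->
  (qdim A1' B' + qdim A2 B <= qdim (addset (f @` A2) A1') B' + qdim A1 B)%E.
Proof.
move=> fl sB sB' fBB' sA1 sA2 A12 A2B sA1' A1B' fA1.
set T := addset _ _.
have sfA2 := submodule_image fl sA2.
have sT : submodule T by exact: submodule_addset.
have pl := fun (N : lmodType R) (V : set N) => @quotm_pi_lin R N V.
have [h hl hE] : exists2 h : quotm A1 -> (quotm A1' * quotm A2)%type, linear h &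
    forall x, h (quotm_pi A1 x) = (quotm_pi A1' (f x), quotm_pi A2 x).
  apply: quotm_lift => //.
    by move=> a u v; rewrite [f _]fl !pl.
  move=> x A1x; have -> : quotm_pi A2 x = 0 by apply/quotm_pi_eq0;
    [|exact: A12].
  suff -> : quotm_pi A1' (f x) = 0 by [].
  by apply/quotm_pi_eq0 => //; apply: fA1; exists x.
have [g1 g1l g1E] : exists2 g1 : quotm A1' -> quotm T, linear g1 &
    forall x, g1 (quotm_pi A1' x) = quotm_pi T x.
  apply: quotm_lift => //; first exact: pl.
  by move=> x A1x; apply/quotm_pi_eq0 => //; exact: addset_subr.
have [g2 g2l g2E] : exists2 g2 : quotm A2 -> quotm T, linear g2 &
    forall x, g2 (quotm_pi A2 x) = quotm_pi T (f x).
  apply: quotm_lift => //.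
    by move=> a u v; rewrite [f _]fl !pl.
  by move=> x A2x; apply/quotm_pi_eq0 => //; apply: addset_subl => //; exists x.
(* The second map of the sequence. With the difference, the two ways from [B] to [B'/T] cancel, so
   [g] vanishes on the image of the first map [h]. *)
pose g (z : (quotm A1' * quotm A2)%type) := g1 z.1 - g2 z.2.
have gl : linear g.
  move=> a u v; rewrite /g/= g1l g2l opprD scalerBr addrACA//.
pose X := (quotm_pi A1' @` B') `*` (quotm_pi A2 @` B).
have sp (N : lmodType R) (V W : set N) : submodule W ->
  submodule (quotm_pi V @` W).
  exact/submodule_image/pl.
have sX : submodule X by apply: submodule_setX; exact: sp.
rewrite /qdim -(bmr_sum Hdim); [|by split=> //; exact: sp|by split=> //;
  exact: sp].
rewrite -/X (dim_ker gl sX) addeC.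
have -> : g @` X = quotm_pi T @` B'.
  apply/seteqP; split=> [_ [[_ _] [/= [x B'x <-] [y By <-]] <-]|_ [x B'x <-]].
    rewrite /g/= g1E g2E; exists (x - f y); last by rewrite (linB (@pl _ T)).
    by apply: submodB => //; apply: fBB'; exists y.
  exists (quotm_pi A1' x, quotm_pi A2 0).
    by split; [exists x|exists 0 => //; exact: submod0].
  by rewrite /g/= g1E g2E (lin0 fl) (lin0 (@pl _ _)) subr0.
apply: leeD => //.
apply: le_trans (dim_image_le hl (sp _ A1 B sB)).
have -> : X `&` g @^-1` [set 0] = h @` (quotm_pi A1 @` B).
  apply/seteqP; split.
    move=> [_ _] /= [[[x B'x /= <-] [y By /= <-]]].
    rewrite /g/= g1E g2E -(linB (@pl _ T)) => /(quotm_pi_eq0 _ sT).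
    move=> [_ [a A2a <-] [b A1b xyE]].
    (* Exactness in the middle: if [x - f y = f a + b] with [a] in [A2] and [b] in [A1'], the
       classes of [x] and [y] are the image of the class of [y + a]. *)
    exists (quotm_pi A1 (y + a)).
      by exists (y + a) => //; apply: submodD => //; exact: A2B.
    rewrite hE; congr pair; apply/quotm_piE; apply: sub_gen.
      rewrite (linD fl) -[x](subrK (f y)) -xyE [f a + b]addrC -[b + _ + _]addrA.
      rewrite [f a + f y]addrC opprD addrCA subrr addr0.
      exact: submodN.
    by rewrite addrAC subrr add0r.
  move=> _ [_ [x Bx <-] <-]; rewrite hE; split=> /=.
    by split=> /=; [exists (f x) => //; apply: fBB'; exists x|exists x].
  by rewrite /g/= g1E g2E subrr.
apply: dim_le_r.
- by split=> //; apply: submodule_image => //; exact: sp.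
- exact: sX.
- move=> _ [_ [x Bx <-] <-]; rewrite hE.
  by split=> /=; [exists (f x) => //; apply: fBB'; exists x|exists x].
Qed.

End BivariantRank.

(** * Finiteness, submodularity and approximation for [dim] *)

Section MatrixRank.
Context {K : realType} {R : pzRingType}.
Variable rk : forall n m, 'M[R]_(n, m) -> K.
Variable dim : forall M : lmodType R, set M -> set M -> \bar K.
Hypothesis Hrk : sylvester_matrix_rank rk.
Hypothesis Hdim : bivariant_module_rank dim.
Hypothesis Hcor : corresponding rk dim.
Implicit Types (M : lmodType R).
Arguments dim {M}.
Arguments rk {n m}.

Lemma rk_scalar1 n : rk (1%:M : 'M[R]_n) = n%:R.
Proof.
elim: n => [|n IHn]; first by rewrite [1%:M]flatmx0 (smr_0 Hrk).
by rewrite -[n.+1]add1n scalar_mx_block (smr_diag Hrk) (smr_1 Hrk) IHn natrD.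
Qed.

Lemma dim_rV n : dim [set: 'rV[R]_n] setT = n%:R%:E.
Proof.
rewrite -rk_scalar1 Hcor; congr dim; apply/seteqP; split=> // v _.
by exists v => //; rewrite mulmx1.
Qed.

Lemma dim_lspan M n (w : 'I_n -> M) : (dim (lspan w) (lspan w) <= n%:R%:E)%E.
Proof.
rewrite -lincomb_range -dim_rV.
by apply: dim_image_le => //; [exact: lincomb_lin|exact: submoduleT].
Qed.

Lemma fg_dim_le M (A : set M) : fg A -> exists n, (dim A A <= n%:R%:E)%E.
Proof. by move=> /fg_ex[n [w ->]]; exists n; exact: dim_lspan. Qed.

Lemma dim_fin_num M (A A' B : set M) : subpair A B -> fg A' -> A' `<=` B ->
  A `<=` A' -> dim A B \is a fin_num.
Proof.
move=> sAB fA A'B AA'; have [n An] := fg_dim_le fA.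
have sA' := fg_submodule fA; have sB : submodule B by case: sAB.
have le1 : (dim A B <= n%:R%:E)%E.
  apply: le_trans An; apply: le_trans (dim_le_r Hdim (subpairxx sA') sB A'B).
  exact: (dim_le_l Hdim).
by rewrite (ge0_fin_numE (bmr_ge0 Hdim sAB)); exact: le_lt_trans le1 (ltry _).
Qed.

Lemma fg_fin_num M (A : set M) : fg A -> dim A A \is a fin_num.
Proof.
by move=> fA; apply: (dim_fin_num _ fA) => //; exact/subpairxx/fg_submodule.
Qed.

Lemma dim_add_quot M (A B : set M) : subpair A B -> dim B B \is a fin_num ->
  [/\ dim A B \is a fin_num, qdim (@dim) A B \is a fin_num &
      fine (dim B B) = fine (dim A B) + fine (qdim (@dim) A B)].
Proof.
move=> sAB Bfin; have [sA sB AB] := sAB.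
have BE := bmr_quot Hdim sAB.
have d0 := bmr_ge0 Hdim sAB.
have sq := submodule_image (@quotm_pi_lin _ _ A) sB.
have q0 : (0 <= qdim (@dim) A B)%E by apply: (bmr_ge0 Hdim); split.
have dfin : dim A B \is a fin_num.
  rewrite ge0_fin_numE//; apply: le_lt_trans (_ : dim B B < +oo)%E.
    by rewrite BE leeDl.
  by rewrite -ge0_fin_numE//; apply: (bmr_ge0 Hdim); split.
have qfin : qdim (@dim) A B \is a fin_num.
  rewrite ge0_fin_numE//; apply: le_lt_trans (_ : dim B B < +oo)%E.
    by rewrite BE leeDr.
  by rewrite -ge0_fin_numE//; apply: (bmr_ge0 Hdim); split.
by split=> //; rewrite BE fineD.
Qed.

(** By finiteness, [dim(A|B)] is [dim(B) - dim(B/A)]. The terms of [B] and of [B'] occur once on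
    each side of [qdim_right_exact] and cancel, which turns it into submodularity. *)
Lemma dim_submod_fin M M' (f : M -> M') (A1 A2 B : set M) (A1' B' : set M') :
  linear f -> submodule B -> submodule B' -> f @` B `<=` B' ->
  submodule A1 -> submodule A2 -> A1 `<=` A2 -> A2 `<=` B ->
  submodule A1' -> A1' `<=` B' -> f @` A1 `<=` A1' ->
  dim B B \is a fin_num -> dim B' B' \is a fin_num ->
  (dim (addset (f @` A2) A1') B' + dim A1 B <= dim A1' B' + dim A2 B)%E.
Proof.
move=> fl sB sB' fB sA1 sA2 A12 A2B sA1' A1B' fA1 Bfin B'fin.
have := qdim_right_exact Hdim fl sB sB' fB sA1 sA2 A12 A2B sA1' A1B' fA1.
have sT := submodule_addset (submodule_image fl sA2) sA1'.
have TB' : addset (f @` A2) A1' `<=` B'.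
  by apply: addset_sub => // _ [x A2x <-]; apply: fB; exists x => //;
    exact: A2B.
have A1B := subset_trans A12 A2B.
have [] := dim_add_quot (And3 sT sB' TB') B'fin.
have [] := dim_add_quot (And3 sA1' sB' A1B') B'fin.
have [] := dim_add_quot (And3 sA1 sB A1B) Bfin.
have [] := dim_add_quot (And3 sA2 sB A2B) Bfin.
move=> /fineK<- /fineK<- /= e1 /fineK<- /fineK<- /= e2.
move=> /fineK<- /fineK<- /= e3 /fineK<- /fineK<- /= e4.
by rewrite -!EFinD !lee_fin; lra.
Qed.

Lemma dim_inf_approx M (A B : set M) (e : K) : subpair A B -> fg A -> 0 < e ->
  exists B1, [/\ fg B1, A `<=` B1, B1 `<=` B & (dim A B1 <= dim A B + e%:E)%E].
Proof.
move=> sAB fA e0; have [sA sB AB] := sAB.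
have fin := dim_fin_num sAB fA AB (@subset_refl _ A).
rewrite (bmr_inf Hdim sAB fA) in fin *.
have [_ [B1 [s1 f1 h1 k1] <-] /ltW le1] := lb_ereal_inf_adherent e0 fin.
by exists B1.
Qed.

Lemma dim_sup_approx M (A B : set M) (e : K) : subpair A B ->
  dim A B \is a fin_num -> 0 < e ->
  exists A1, [/\ fg A1, A1 `<=` A & (dim A B - e%:E <= dim A1 B)%E].
Proof.
move=> sAB fin e0; have [sA sB AB] := sAB.
rewrite (bmr_sup Hdim sAB) in fin *.
have [_ [A1 [s1 f1 h1] <-] /ltW le1] := ub_ereal_sup_adherent e0 fin.
by exists A1.
Qed.

(** Finiteness of the ambient modules is removed by passing to finitely generated submodules of [B]
    and [B'] that nearly realise the right-hand side; shrinking the ambient module can only raise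
    the left-hand side. *)
Lemma dim_submod M M' (f : M -> M') (A1 A2 B : set M) (A1' B' : set M') :
  linear f -> submodule B -> submodule B' -> f @` B `<=` B' ->
  submodule A1 -> fg A2 -> A1 `<=` A2 -> A2 `<=` B ->
  fg A1' -> A1' `<=` B' -> f @` A1 `<=` A1' ->
  (dim (addset (f @` A2) A1') B' + dim A1 B <= dim A1' B' + dim A2 B)%E.
Proof.
move=> fl sB sB' fB sA1 fA2 A12 A2B fA1' A1B' fA1.
have [sA2 sA1'] := (fg_submodule fA2, fg_submodule fA1').
apply/lee_addgt0Pr => e e0.
have e20 : 0 < e / 2 by rewrite divr_gt0.
have [B0 [f0 A2B0 B0B le0]] := dim_inf_approx (And3 sA2 sB A2B) fA2 e20.
have [B0' [f0' A1B0' B0B' le0']] := dim_inf_approx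
  (And3 sA1' sB' A1B') fA1' e20.
(* The image of [B0] is added so that [f] still maps the small source into the small target. *)
pose B1' := addset (f @` B0) B0'.
have [s0 s0'] := (fg_submodule f0, fg_submodule f0').
have sf0 := submodule_image fl s0.
have f1' : fg B1' by apply: fg_addset => //; exact: fg_image.
have s1' := fg_submodule f1'.
have fB0 : f @` B0 `<=` B1' by exact: addset_subl.
have B01' : B0' `<=` B1' by exact: addset_subr.
have B1B' : B1' `<=` B'.
  by apply: addset_sub => // _ [x B0x <-]; apply: fB; exists x => //;
    exact: B0B.
have A1B1' := subset_trans A1B0' B01'.
have := dim_submod_fin fl s0 s1' fB0 sA1 sA2 A12 A2B0 sA1' A1B1' fA1
  (fg_fin_num f0)
  (fg_fin_num f1').
have sT := submodule_addset (submodule_image fl sA2) sA1'.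
have TB1 : addset (f @` A2) A1' `<=` B1'.
  by apply: addset_sub => // _ [x A2x <-]; apply: fB0; exists x => //;
    exact: A2B0.
have A1B0 := subset_trans A12 A2B0.
have i1 := dim_le_r Hdim (And3 sA1 s0 A1B0) sB B0B.
have i2 := dim_le_r Hdim (And3 sT s1' TB1) sB' B1B'.
have i3 := dim_le_r Hdim (And3 sA1' s0' A1B0') s1' B01'.
move=> h; apply: (le_trans (leeD i2 i1)); apply: (le_trans h).
apply: (le_trans (leeD i3 (lexx _))).
apply: (le_trans (leeD le0' le0)).
by rewrite addeACA -EFinD -splitr.
Qed.

(** A relative rank-nullity in which a finitely generated part of the kernel nearly suffices. It is
    computed inside a finitely generated [B0] whose image nearly realises [dim(f X|f B)]; the
    increments do not grow when [B0] is enlarged to [B]. *)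
Lemma dim_ker_approx M M' (f : M -> M') (B X : set M) (e : K) : linear f ->
  submodule B -> fg X -> X `<=` B -> 0 < e ->
  exists K0, [/\ fg K0, K0 `<=` B `&` f @^-1` [set 0] &
    (dim (addset X K0) B <= dim K0 B + dim (f @` X) (f @` B) + e%:E)%E].
Proof.
move=> fl sB fX XB e0; have e20 : 0 < e / 2 by rewrite divr_gt0.
have sX := fg_submodule fX; have sfB := submodule_image fl sB.
have ffX := fg_image fl fX; have sfX := fg_submodule ffX.
have fXB : f @` X `<=` f @` B by exact: image_subset.
have [B0' [f0' XB0' B0B' le0']] := dim_inf_approx (And3 sfX sfB fXB) ffX e20.
have [n [w' B0E]] := fg_ex f0'.
have /choice[w wE] : forall i, exists x, B x /\ f x = w' i.
  move=> i; have /B0B'[x Bx <-] : B0' (w' i); last by exists x.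
  by rewrite B0E -gen_rangeE; apply: sub_gen; exists i.
pose B0 := addset (lspan w) X.
have f0 : fg B0 by apply: fg_addset => //; exact: fg_lspan.
have s0 := fg_submodule f0; have s0' := fg_submodule f0'.
have XB0 : X `<=` B0 by apply: addset_subr; exact: lspan_submodule.
have B0B : B0 `<=` B.
  apply: addset_sub => //; rewrite -gen_rangeE; apply: gen_sub => // _ [i _ <-].
  by case: (wE i).
have fspan : f @` lspan w = B0'.
  rewrite -gen_rangeE (image_gen _ fl) B0E -gen_rangeE; congr gen.
  apply/seteqP; split=> [_ [_ [i _ <-] <-]|_ [i _ <-]].
    by exists i => //; case: (wE i).
  by exists (w i); [exists i|case: (wE i)].
have fB0 : f @` B0 = B0'.
  apply/seteqP; split.
    move=> _ [_ [x sx [y Xy <-]] <-]; rewrite linD//; apply: submodD => //.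
      by rewrite -fspan; exists x.
    by apply: XB0'; exists y.
  by rewrite -fspan; apply: image_subset; exact: addset_subl.
(* The kernel [T] of [p] on [B0] is the preimage of [f X]. With [T0] the kernel of [f] on [B0], two
   uses of rank-nullity give [dim(T|B0) - dim(T0|B0) = dim(f X|B0')]. *)
pose p y := quotm_pi (f @` X) (f y).
have pl : linear p by move=> a u v; rewrite /p fl quotm_pi_lin.
have := dim_ker Hdim pl s0; have := dim_ker Hdim fl s0; rewrite fB0.
set T0 := B0 `&` f @^-1` _; set T := B0 `&` p @^-1` _.
have -> : p @` B0 = quotm_pi (f @` X) @` B0' by rewrite -fB0 image_comp.
rewrite -/(qdim _ _ _).
have sT0 : submodule T0.
  by apply: submoduleI => //; exact: submodule_preimage (@submodule_set0 _ _).
have sT : submodule T.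
  by apply: submoduleI => //; exact: submodule_preimage (@submodule_set0 _ _).
have TB0 : T `<=` B0 by move=> ? [].
have T0B0 : T0 `<=` B0 by move=> ? [].
have Tfin := dim_fin_num (And3 sT s0 TB0) f0 (@subset_refl _ _) TB0.
have T0fin := dim_fin_num (And3 sT0 s0 T0B0) f0 (@subset_refl _ _) T0B0.
have [qa qb qc] := dim_add_quot (And3 sfX s0' XB0') (fg_fin_num f0').
move=> E1 E2; have {}E1 := f_equal fine E1; have {}E2 := f_equal fine E2.
rewrite fineD// in E2; rewrite fineD// ?fg_fin_num// in E1.
have [K0 [fK0 K0T0 leK0]] := dim_sup_approx (And3 sT0 s0 T0B0) T0fin e20.
exists K0; split=> //; first by move=> x /K0T0[B0x fx]; split=> //; exact: B0B.
have K0B0 := subset_trans K0T0 T0B0.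
have sK0 := fg_submodule fK0.
have fXK := fg_addset fX fK0; have sXK := fg_submodule fXK.
have XKB0 : addset X K0 `<=` B0 by exact: addset_sub.
have K0X : K0 `<=` addset X K0 by exact: addset_subr.
have idl : linear (@id M) by [].
have idB : id @` B0 `<=` B by rewrite image_id.
have idK : id @` K0 `<=` K0 by rewrite image_id.
(* Submodularity for the identity: adding [X] to [K0] raises the dimension relative to [B] by no
   more than relative to [B0]. *)
have := dim_submod idl s0 sB idB sK0 fXK K0X XKB0 fK0
  (subset_trans K0B0 B0B) idK.
rewrite image_id.
have -> : addset (addset X K0) K0 = addset X K0.
  apply/seteqP; split; last by apply: addset_subl.
  by apply: addset_sub.
have XKT : addset X K0 `<=` T.
  apply: addset_sub => //.
    move=> x Xx; split; first exact: XB0.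
    by apply/quotm_pi_eq0 => //; exists x.
  move=> x /K0T0[B0x fx]; split=> //; rewrite /= /p fx.
  by rewrite (lin0 (@quotm_pi_lin _ _ _)).
have i1 := dim_le_l Hdim (And3 sXK s0 XKB0) (And3 sT s0 TB0) XKT.
have K0B := subset_trans K0B0 B0B.
have XKB := subset_trans XKB0 B0B.
have g1 := dim_fin_num (And3 sK0 sB K0B) fK0 K0B (@subset_refl _ _).
have g2 := dim_fin_num (And3 sXK sB XKB) fXK XKB (@subset_refl _ _).
have g3 := dim_fin_num (And3 sK0 s0 K0B0) fK0 K0B0 (@subset_refl _ _).
have g4 := dim_fin_num (And3 sXK s0 XKB0) fXK XKB0 (@subset_refl _ _).
have g5 := dim_fin_num (And3 sfX sfB fXB) ffX fXB (@subset_refl _ _).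
move: le0' leK0 i1.
rewrite -(fineK g1) -(fineK g2) -(fineK g3) -(fineK g4) -(fineK g5) -(fineK qa)
  -(fineK Tfin) -(fineK T0fin) -?EFinN -!EFinD !lee_fin.
lra.
Qed.

End MatrixRank.

Lemma rowspace_submodule (R : pzRingType) n m (A : 'M[R]_(n, m)) :
  submodule (rowspace A).
Proof.
apply: submodule_intro.
- by exists 0 => //; rewrite mul0mx.
- by move=> _ _ [u _ <-] [v _ <-]; exists (u + v) => //; rewrite mulmxDl.
- by move=> a _ [u _ <-]; exists (a *: u) => //; rewrite -scalemxAl.
Qed.

Lemma lincomb_row (R : pzRingType) n m (w : 'I_n -> 'rV[R]_m) (v : 'rV[R]_n) :
  v *m (\matrix_i w i) = lincomb w v.
Proof.
apply/rowP => j; rewrite mxE summxE; apply: eq_bigr => i _.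
by rewrite !mxE.
Qed.

Lemma rowspace_lspan (R : pzRingType) n m (w : 'I_n -> 'rV[R]_m) :
  rowspace (\matrix_i w i) = lspan w.
Proof.
by rewrite -lincomb_range; congr image; apply/funext => v; rewrite lincomb_row.
Qed.

(** * Uniqueness of [dim] for a given [rk] *)

Section Uniqueness.
Context {K : realType} {R : pzRingType}.
Variable rk : forall n m, 'M[R]_(n, m) -> K.
Variables dim dim' : forall M : lmodType R, set M -> set M -> \bar K.
Hypotheses (Hrk : sylvester_matrix_rank rk) (Hdim : bivariant_module_rank dim)
  (Hdim' : bivariant_module_rank dim') (Hcor : corresponding rk dim)
  (Hcor' : corresponding rk dim').
Implicit Types (M : lmodType R).
Arguments dim {M}.
Arguments dim' {M}.

(** The supremum axiom leaves finitely generated submodules of [R^m]; each of them is a row space,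
    where [rk] fixes the value. *)
Lemma dim_unique_rV m (A : set 'rV[R]_m) : submodule A ->
  dim A setT = dim' A setT.
Proof.
move=> sA; have sAT : subpair A setT by split=> //; exact: submoduleT.
rewrite (bmr_sup Hdim sAT) (bmr_sup Hdim' sAT); congr ereal_sup.
apply/eq_imagel => B [sB /fg_ex[n [w ->]] BA].
by rewrite -rowspace_lspan -Hcor -Hcor'.
Qed.

(** Let [f] map [R^m] onto a finitely generated [B], and let [p] be its composite with the
    projection to [B/A]. Additivity gives [dim(A|B) = dim(ker p|R^m) - dim(ker f|R^m)], and
    dimensions relative to [R^m] are already known to agree. The sup and inf axioms reduce the
    general case to this one. *)
Lemma dim_unique M (A B : set M) : subpair A B -> dim A B = dim' A B.
Proof.
have main (A0 B0 : set M) : subpair A0 B0 -> fg B0 -> dim A0 B0 = dim' A0 B0.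
  move=> sAB fB; have [sA sB AB] := sAB.
  have [m [w BE]] := fg_ex fB.
  have fl := lincomb_lin w; set f := lincomb w in fl.
  have fT : f @` setT = B0 by rewrite BE lincomb_range.
  pose p v := quotm_pi A0 (f v).
  have pl : linear p by move=> a u v; rewrite /p fl quotm_pi_lin.
  have sT := submoduleT 'rV[R]_m.
  have pT : p @` setT = quotm_pi A0 @` B0 by rewrite -fT image_comp.
  have ker (g : lmodType R) (h : 'rV[R]_m -> g) : linear h ->
      subpair (setT `&` h @^-1` [set 0]) setT.
    move=> hl; split=> //; apply: submoduleI => //.
    exact: submodule_preimage (@submodule_set0 _ _).
  have calc (d : forall M : lmodType R, set M -> set M -> \bar K) :
      bivariant_module_rank d -> corresponding rk d ->
      d M A0 B0 = (fine (d _ (setT `&` p @^-1` [set 0]) setT)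
                   - fine (d _ (setT `&` f @^-1` [set 0]) setT))%:E.
    move=> bd cd.
    have dT := dim_rV Hrk cd m.
    have Tfin : d _ [set: 'rV[R]_m] setT \is a fin_num by rewrite dT.
    have [a1 _ _] := dim_add_quot bd (ker _ _ pl) Tfin.
    have [a2 _ _] := dim_add_quot bd (ker _ _ fl) Tfin.
    have E1 := dim_ker bd pl sT; have E2 := dim_ker bd fl sT.
    have [b1 b2 b3] := dim_add_quot bd sAB (fg_fin_num Hrk bd cd fB).
    rewrite fT in E2; rewrite pT -/(qdim d A0 B0) in E1.
    have := f_equal fine E1; have := f_equal fine E2.
    rewrite !fineD//; last exact: (fg_fin_num Hrk bd cd fB).
    move=> e2 e1; rewrite -(fineK b1); congr EFin; lra.
  rewrite (calc _ Hdim Hcor) (calc _ Hdim' Hcor').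
  by rewrite !dim_unique_rV//; [case: (ker _ _ fl)|case: (ker _ _ pl)].
move=> sAB; have [sA sB AB] := sAB.
rewrite (bmr_sup Hdim sAB) (bmr_sup Hdim' sAB); congr ereal_sup.
apply/eq_imagel => A1 [sA1 fA1 A1A].
have sA1B : subpair A1 B by split=> //; exact: subset_trans AB.
rewrite (bmr_inf Hdim sA1B fA1) (bmr_inf Hdim' sA1B fA1); congr ereal_inf.
by apply/eq_imagel => B1 [sB1 fB1 A1B1 B1B]; apply: main.
Qed.

End Uniqueness.

(** * Restriction of scalars *)

Section Restriction.
Context {R S : pzRingType} (iota : {rmorphism R -> S}).

Lemma submodule_restr (N : lmodType S) (A : set N) :
  submodule A -> submodule (A : set (restr iota N)).
Proof.
move=> sA; apply: submodule_intro; first exact: (submod0 sA).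
  by move=> x y; exact: (submodD sA).
by move=> a x; exact: (submodZ _ sA).
Qed.

Lemma linear_restr (N N' : lmodType S) (f : N -> N') :
  linear f -> linear (f : restr iota N -> restr iota N').
Proof. by move=> fl a u v; exact: fl. Qed.

Lemma gen_restr_sub (N : lmodType S) (V : set N) :
  gen (V : set (restr iota N)) `<=` gen V.
Proof.
by apply: gen_sub; [exact/submodule_restr/gen_submodule|exact:
  (@sub_gen S N V)].
Qed.

End Restriction.

(** * Twisting the scalars by an automorphism that preserves [rk] *)

Section Twist.
Context {K : realType} {R : pzRingType} (s : {rmorphism R -> R}).
Hypothesis s_bij : bijective s.
Variable rk : forall n m, 'M[R]_(n, m) -> K.
Variable dim : forall M : lmodType R, set M -> set M -> \bar K.
Hypotheses (Hrk : sylvester_matrix_rank rk) (Hdim : bivariant_module_rank dim)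
  (Hcor : corresponding rk dim)
  (rk_s : forall n m (A : 'M[R]_(n, m)), rk (map_mx s A) = rk A).
Arguments dim {M}.

Lemma submodule_twist (M : lmodType R) (A : set M) :
  submodule (A : set (restr s M)) = submodule A.
Proof.
apply/propext; split; last exact: submodule_restr.
move=> sA; apply: submodule_intro; first exact: (submod0 sA).
  by move=> x y; exact: (submodD sA).
move=> a x Ax; have [t _ ts] := s_bij.
by rewrite -[a]ts; exact: (submodZ (M := restr s M) (t a) sA).
Qed.

Lemma gen_twist (M : lmodType R) (V : set M) :
  gen (V : set (restr s M)) = gen V.
Proof.
apply/seteqP; split; first exact: gen_restr_sub.
apply: (@gen_sub R M V); last exact: (@sub_gen R (restr s M) V).
by rewrite -submodule_twist; exact: (@gen_submodule R (restr s M) V).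
Qed.

Lemma fg_twist (M : lmodType R) (A : set M) :
  fg (A : set (restr s M)) = fg A.
Proof.
by apply/propext; split=> -[V fV ->]; exists V => //; rewrite gen_twist.
Qed.

Lemma subpair_twist (M : lmodType R) (A B : set M) :
  subpair (A : set (restr s M)) (B : set (restr s M)) = subpair A B.
Proof.
rewrite propeqE; split=> -[sA sB AB]; split=> //; try exact: submodule_restr.
  by rewrite -submodule_twist.
by rewrite -submodule_twist.
Qed.

Definition twisted_dim (M : lmodType R) (A B : set M) : \bar K :=
  @dim (restr s M) A B.

Lemma twisted_bivariant : bivariant_module_rank twisted_dim.
Proof.
have sT (M : lmodType R) (A : set M) : submodule A ->
  submodule (A : set (restr s M)).
  by rewrite submodule_twist.
have spT (M : lmodType R) (A B : set M) : subpair A B ->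
    subpair (A : set (restr s M)) (B : set (restr s M)).
  by rewrite subpair_twist.
split.
- by move=> M A B sAB; apply: (bmr_ge0 Hdim); exact: spT.
- move=> M M' A B A' B' f sAB sAB' fl fb fA.
  apply: (bmr_iso Hdim (f := f : restr s M -> restr s M')) => //;
    try exact: spT.
  by move=> a u v; exact: fl.
- by move=> M; exact: (bmr_0 Hdim).
- rewrite -(bmr_1 Hdim); apply/esym.
  have [t st ts] := s_bij.
  (* The automorphism itself is an isomorphism from [R] to its twist. *)
  apply: (bmr_iso Hdim (f := s : R^o -> restr s R^o)).
  + exact/subpairxx/submoduleT.
  + exact/subpairxx/submoduleT.
  + move=> a u v _ _; rewrite [LHS](rmorphD s (a * u : R) (v : R)).
    by rewrite [X in X + _](rmorphM s a (u : R)).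
  + split=> //; first by move=> x y _ _; exact: (can_inj st).
    by move=> y _; exists (t y).
  + by apply/seteqP; split=> // y _; exists (t y).
- move=> M M' A B A' B' sAB sAB'; rewrite /twisted_dim.
  rewrite -(bmr_sum Hdim); [|exact: spT|exact: spT].
  case: sAB => sA sB AB; case: sAB' => sA' sB' AB'.
  apply: (bmr_iso Hdim
    (f := id : restr s (M * M')%type -> (restr s M * restr s M')%type)).
  + by apply: spT; split;
      [exact: submodule_setX|exact: submodule_setX|exact: setSX].
  + by split; [| |exact: setSX]; apply: submodule_setX; exact: sT.
  + by [].
  + by split=> //; move=> x Bx; exists x.
  + by rewrite image_id.
- move=> M A B sAB; rewrite /twisted_dim (bmr_sup Hdim (spT _ _ _ sAB)).
  congr ereal_sup; apply/seteqP; split=> _ [A1 [s1 f1 h1] <-];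
    exists A1 => //; split=> //.
  + by rewrite -submodule_twist.
  + by rewrite -fg_twist.
  + by rewrite submodule_twist.
  + by rewrite fg_twist.
- move=> M A B sAB fA; rewrite /twisted_dim (bmr_inf Hdim (spT _ _ _ sAB));
    last first.
    by rewrite fg_twist.
  congr ereal_inf; apply/seteqP; split=> _ [A1 [s1 f1 h1 k1] <-];
    exists A1 => //; split=> //.
  + by rewrite -submodule_twist.
  + by rewrite -fg_twist.
  + by rewrite submodule_twist.
  + by rewrite fg_twist.
- move=> M A B sAB; have [sA sB AB] := sAB; rewrite /twisted_dim.
  (* The quotient of the twist and the twist of the quotient are different types. Rank-nullity for
     the projection, seen between twisted modules, avoids comparing them. *)
  have pl : linear (quotm_pi A : restr s M -> restr s (quotm A)).
    exact/linear_restr/quotm_pi_lin.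
  rewrite (dim_ker Hdim pl (sT _ _ sB)); congr (dim _ _ + _)%E.
  apply/seteqP; split=> [x [Bx /= /(quotm_pi_eq0 _ sA)]|x Ax] //.
  by split; [exact: AB|exact/(quotm_pi_eq0 _ sA)].
Qed.

(** With [t] the inverse of [s], the entrywise map [s] is an isomorphism from [R^m] to its twist
    carrying the row space of [t(A)] to that of [A]; and [t(A)] has the rank of [A] by invariance of
    [rk]. *)
Lemma twisted_corresponding : corresponding rk twisted_dim.
Proof.
move=> n m A; rewrite /twisted_dim; have [t st ts] := s_bij.
have mts k l (B : 'M[R]_(k, l)) : map_mx s (map_mx t B) = B.
  by apply/matrixP => i j; rewrite !mxE ts.
have mst k l (B : 'M[R]_(k, l)) : map_mx t (map_mx s B) = B.
  by apply/matrixP => i j; rewrite !mxE st.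
rewrite -[A in LHS](mts _ _) rk_s Hcor.
apply: (bmr_iso Hdim (f := @map_mx _ _ s 1 m : 'rV[R]_m -> restr s 'rV[R]_m)).
- by split=> //; [exact: rowspace_submodule|exact: submoduleT].
- by rewrite subpair_twist; split=> //;
    [exact: rowspace_submodule|exact: submoduleT].
- by move=> a u v _ _; rewrite map_mxD map_mxZ.
- split=> //; first by move=> x y _ _; exact: (can_inj (mst _ _)).
  by move=> y _; exists (map_mx t y) => //; exact: mts.
apply/seteqP; split=> [_ [_ [v _ <-] <-]|_ [v _ <-]].
  by exists (map_mx s v) => //; rewrite map_mxM mts.
exists (map_mx t v *m map_mx t A); first by exists (map_mx t v).
by rewrite map_mxM !mts.
Qed.

(** Both sides are bivariant rank functions belonging to the same [rk], so uniqueness applies. *)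
Lemma dim_twist (M : lmodType R) (A B : set M) : subpair A B ->
  @dim (restr s M) A B = dim A B.
Proof.
move=> sAB.
by rewrite (dim_unique Hrk Hdim twisted_bivariant Hcor twisted_corresponding
  sAB).
Qed.

End Twist.

(** * Finite approximation systems *)

Section Rank.
Context {R : pzRingType}.
Hypothesis HR : IBN R.
Implicit Types M : lmodType R.

Lemma basis_inj M (A : set M) n (w : 'I_n -> M) : is_basis A w ->
  injective (lincomb w).
Proof.
move=> [indep _] u v uv; apply/rowP => i; apply/eqP; rewrite -subr_eq0;
  apply/eqP.
apply: (indep (fun i => u 0 i - v 0 i)).
transitivity (lincomb w u - lincomb w v); last by rewrite uv subrr.
rewrite /lincomb -sumrB; apply: eq_bigr => j _.
by rewrite scalerBl.
Qed.

(** The change of coordinates between the two bases is a linear bijection from [R^n] to [R^m], to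
    which IBN applies. *)
Lemma basis_size M (A : set M) n m (w : 'I_n -> M) (w' : 'I_m -> M) :
  is_basis A w -> is_basis A w' -> n = m.
Proof.
move=> bw bw'; have [iw iw'] := (basis_inj bw, basis_inj bw').
have E : lincomb w @` setT = lincomb w' @` setT.
  by rewrite !lincomb_range -!gen_rangeE -(proj2 bw) -(proj2 bw').
have /choice[f fE] : forall v, exists u, lincomb w' u = lincomb w v.
  move=> v; have : (lincomb w @` setT) (lincomb w v) by exists v.
  by rewrite E => -[u _ uE]; exists u.
have /choice[g gE] : forall v, exists u, lincomb w u = lincomb w' v.
  move=> v; have : (lincomb w' @` setT) (lincomb w' v) by exists v.
  by rewrite -E => -[u _ uE]; exists u.
have fl : linear f.
  by move=> a u v; apply: iw'; rewrite fE !lincomb_lin !fE.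
pose fL : {linear 'rV[R]_n -> 'rV[R]_m} := HB.pack f
  (GRing.isLinear.Build _ _ _ _ f fl).
apply: (HR (f := fL)); exists g => v; first by apply: iw; rewrite gE fE.
by apply: iw'; rewrite fE gE.
Qed.

Lemma frank_basis M (A : set M) n (w : 'I_n -> M) : is_basis A w -> frank A = n.
Proof.
move=> bw; rewrite /frank; case: xgetP => [m _ [w' bw']|/(_ n)[]].
  exact: basis_size bw' bw.
by exists w.
Qed.

Lemma is_basis_addset M (A A' : set M) n m (w : 'I_n -> M) (w' : 'I_m -> M) :
  A `&` A' = [set 0] -> is_basis A w -> is_basis A' w' ->
  is_basis (addset A A')
    (fun i : 'I_(n + m) => match fintype.split i with inl j => w j | inr k =>
      w' k end).
Proof.
move=> AA' [iw AE] [iw' AE']; set u := fun i => _.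
have sumE c : \sum_i c i *: u i = (\sum_i c (lshift m i) *: w i) +
    \sum_i c (rshift n i) *: w' i.
  rewrite big_split_ord; congr (_ + _); apply: eq_bigr => i _; rewrite /u.
    by rewrite (unsplitK (inl i)).
  by rewrite (unsplitK (inr i)).
have lA c : A (\sum_i c i *: w i) by rewrite AE gen_rangeE; exists c.
have lA' c : A' (\sum_i c i *: w' i) by rewrite AE' gen_rangeE; exists c.
have sA' : submodule A' by rewrite AE'; exact: gen_submodule.
split=> [c|].
  rewrite sumE => /eqP; rewrite addr_eq0 => /eqP E.
  have : (A `&` A') (\sum_i c (lshift m i) *: w i).
    by split=> //; rewrite E; exact: submodN.
  rewrite AA' /= => E0; have E0' : \sum_i c (rshift n i) *: w' i = 0.
    by apply/eqP; rewrite -oppr_eq0 -E E0.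
  move=> i; case: (fintype.split_ordP i) => j ->.
    exact: (iw (c \o @lshift n m)).
  exact: (iw' (c \o @rshift n m)).
rewrite gen_rangeE AE AE' !gen_rangeE; apply/seteqP; split.
  move=> _ [_ [c ->] [_ [d ->] <-]].
  exists (fun i => match fintype.split i with inl j => c j | inr k => d k end).
  rewrite sumE; congr (_ + _); apply: eq_bigr => i _.
    by rewrite (unsplitK (inl i)).
  by rewrite (unsplitK (inr i)).
move=> _ [c ->]; rewrite sumE; exists (\sum_i c (lshift m i) *: w i).
  by exists (c \o @lshift n m).
by exists (\sum_i c (rshift n i) *: w' i) => //; exists (c \o @rshift n m).
Qed.

End Rank.

(** * Products of submodules of [S] with subsets of [S]-modules *)

Section Mulset.
Context {R S : pzRingType} (iota : {rmorphism R -> S}).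
Implicit Types (N : lmodType S) (W : set S).
Local Notation rsub W := (submodule (W : set (restr iota S^o))).

Lemma mulset_in N W (M : set N) w m : W w -> M m -> mulset W M (w *: m).
Proof.
by move=> Ww Mm; exists 1%N, (fun=> w), (fun=> m); split=> //; rewrite big_ord1.
Qed.

Lemma mulset_sub N W (M : set N) (T : set N) :
  submodule (T : set (restr iota N)) ->
  (forall w m, W w -> M m -> T (w *: m)) -> mulset W M `<=` T.
Proof.
move=> sT h _ [n [w [m [hw hm ->]]]].
by apply: (submod_sum (M := restr iota N)) => // i _; exact: h.
Qed.

Lemma mulset_submodule N W (M : set N) : rsub W ->
  submodule (mulset W M : set (restr iota N)).
Proof.
move=> sW; apply: submodule_intro.
- by exists 0%N, (fun=> 0), (fun=> 0); split=> [[]|[]|] //; rewrite big_ord0.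
- move=> _ _ [n [w [m [hw hm ->]]]] [n' [w' [m' [hw' hm' ->]]]].
  exists (n + n')%N,
    (fun i => match fintype.split i with inl j => w j | inr k => w' k end),
    (fun i => match fintype.split i with inl j => m j | inr k => m' k end);
      split.
  + by move=> i; case: fintype.splitP.
  + by move=> i; case: fintype.splitP.
  rewrite big_split_ord; congr (_ + _); apply: eq_bigr => i _.
    by rewrite (unsplitK (inl i)).
  by rewrite (unsplitK (inr i)).
- move=> a _ [n [w [m [hw hm ->]]]]; exists n, (fun i => iota a * w i), m;
    split=> //.
    by move=> i; exact: (submodZ a sW (hw i)).
  rewrite [LHS]scaler_sumr; apply: eq_bigr => i _.
  exact: (scalerA (iota a) (w i) (m i)).
Qed.

Lemma mulset_mono N W W' (M M' : set N) : W `<=` W' -> M `<=` M' ->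
  mulset W M `<=` mulset W' M'.
Proof.
move=> WW' MM' _ [n [w [m [hw hm ->]]]].
by exists n, w, m; split=> // i; [exact: WW'|exact: MM'].
Qed.

Lemma mulset_addset N W W' (M : set N) : rsub W -> rsub W' ->
  mulset (addset W W') M = addset (mulset W M) (mulset W' M).
Proof.
move=> sW sW'; have sM := mulset_submodule M sW.
have sM' := mulset_submodule M sW'.
apply/seteqP; split.
  apply: mulset_sub; first exact: (@submodule_addset _ (restr iota N)).
  move=> _ m [w Ww [w' Ww' <-]] Mm; rewrite scalerDl.
  exists (w *: m); first exact: mulset_in.
  by exists (w' *: m) => //; exact: mulset_in.
have h : submodule (mulset (addset W W') M : set (restr iota N)).
  apply: mulset_submodule; exact: (@submodule_addset _ (restr iota S^o)).
apply: (@addset_sub _ (restr iota N)) => //; apply: mulset_mono => //.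
  exact: (@addset_subl _ (restr iota S^o)).
exact: (@addset_subr _ (restr iota S^o)).
Qed.

Lemma mulset_smul N W (M : set N) c :
  mulset (lmulset c W) M = (fun x => c *: x) @` mulset W M.
Proof.
apply/seteqP; split.
  move=> _ [n [w [m [hw hm ->]]]].
  have /choice[v vE] : forall i, exists v, W v /\ c * v = w i.
    by move=> i; have [v ? ?] := hw i; exists v.
  exists (\sum_i v i *: m i).
    by exists n, v, m; split=> // i; case: (vE i).
  rewrite scaler_sumr; apply: eq_bigr => i _.
  by rewrite scalerA (proj2 (vE i)).
move=> _ [_ [n [w [m [hw hm ->]]]] <-]; exists n, (fun i => c * w i), m;
  split=> //.
  by move=> i; exists (w i).
by rewrite scaler_sumr; apply: eq_bigr => i _; rewrite scalerA.
Qed.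

Lemma gen_mulset N (M : set N) : gen M = mulset setT M.
Proof.
apply/seteqP; split.
  apply: gen_sub; last by move=> m Mm; rewrite -[m]scale1r; exact: mulset_in.
  have sT := @mulset_submodule N setT M (@submoduleT _ _).
  apply: submodule_intro; first exact: (submod0 sT).
    by move=> x y; exact: (submodD sT).
  move=> a _ [n [w [m [hw hm ->]]]]; exists n, (fun i => a * w i), m;
    split=> //.
  by rewrite scaler_sumr; apply: eq_bigr => i _; rewrite scalerA.
move=> _ [n [w [m [hw hm ->]]]]; apply: (submod_sum _ (gen_submodule _)) => i _.
by apply: (submodZ _ (gen_submodule _)); exact: sub_gen.
Qed.

Lemma mulset_sub_submodule N W (M T : set N) : submodule T -> M `<=` T ->
  mulset W M `<=` T.
Proof.
move=> sT MT _ [n [w [m [_ hm ->]]]]; apply: (submod_sum _ sT) => i _.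
by apply: (submodZ _ sT); exact: MT.
Qed.

Lemma mulsetA N W V (M : set N) : rsub W -> 
  mulset (mulsetS W V) M = mulset W (mulset V M).
Proof.
move=> sW; apply/seteqP; split.
  apply: mulset_sub; first exact: mulset_submodule.
  move=> _ m [n [w [v [hw hv ->]]]] Mm; rewrite scaler_suml.
  apply: (submod_sum (M := restr iota N)); first exact: mulset_submodule.
  move=> i _; rewrite -[_ *: v i]/(w i * v i) -scalerA; apply: mulset_in => //.
  exact: mulset_in.
have sWV : rsub (mulsetS W V) by exact: mulset_submodule.
apply: mulset_sub; first exact: mulset_submodule.
move=> w _ Ww [n [v [m [hv hm ->]]]]; rewrite scaler_sumr.
apply: (submod_sum (M := restr iota N)); first exact: mulset_submodule.
move=> i _; rewrite scalerA; apply: mulset_in => //.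
exact: (@mulset_in S^o).
Qed.

End Mulset.

(** * Relative dimension in direct summands *)

Section Summand.
Context {K : realType} {R : pzRingType}.
Variable dim : forall M : lmodType R, set M -> set M -> \bar K.
Hypothesis Hdim : bivariant_module_rank dim.
Implicit Types (M : lmodType R).
Arguments dim {M}.

(** The pair is isomorphic to the direct sum of [X] in [A] and [0] in [C]; the second summand
    contributes 0, since [dim(0|C) <= dim(0|0)]. *)
Lemma dim_addset M (X A C : set M) : submodule X -> submodule A ->
  submodule C ->
  X `<=` A -> A `&` C = [set 0] -> dim X (addset A C) = dim X A.
Proof.
move=> sX sA sC XA cap.
have s0 := @submodule_set0 _ M.
have z0C : [set 0] `<=` C by move=> _ ->; exact: submod0.
have : dim (X `*` [set 0]) (A `*` C) = dim X (addset A C).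
  apply: (bmr_iso Hdim (f := fun z : (M * M)%type => z.1 + z.2)).
  - by split; [exact: submodule_setX|exact: submodule_setX|exact: setSX].
  - split=> //; first exact: submodule_addset.
    by apply: subset_trans XA _; exact: addset_subl.
  - by move=> a u v _ _; rewrite /= scalerDr addrACA.
  - split; first by move=> [x y] [Ax Cy]; exists x => //; exists y.
      move=> [x y] [x' y'] /set_mem[/= Ax Cy] /set_mem[/= Ax' Cy'] E.
      have E' : x - x' = y' - y.
        by apply/eqP; rewrite subr_eq addrAC [y' + _]addrC -E addrK.
      have : (A `&` C) (x - x').
        by split; [exact: submodB|rewrite E'; exact: submodB].
      rewrite cap /= => /eqP; rewrite subr_eq0 => /eqP xx'.
      by move: E; rewrite xx' => /addrI ->.
    by move=> _ [x Ax [y Cy <-]]; exists (x, y).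
  - apply/seteqP; split=> [_ [[x y] [/= Xx ->] <-]|x Xx];
      first by rewrite addr0.
    by exists (x, 0); rewrite /= ?addr0.
rewrite (bmr_sum Hdim); [|by split|by split] => <-.
suff -> : dim [set 0] C = 0%E by rewrite adde0.
apply/le_anti; rewrite (bmr_ge0 Hdim) ?andbT; last by split.
by rewrite -(bmr_0 Hdim M); apply: (dim_le_r Hdim) => //; exact: subpairxx.
Qed.

(** Here [A] is only locally a direct summand of [B]: every finitely generated [B1] sits in some
    [A + C] as in [dim_addset], so no term of the infimum axiom falls below [dim(X|A)]. It serves to
    cut [S] and [S^m] down to members of [F] and their powers. *)
Lemma dim_summand M (X A B : set M) : fg X -> submodule A -> submodule B ->
  X `<=` A -> A `<=` B ->
  (forall B1, fg B1 -> B1 `<=` B -> exists C, [/\ submodule C, A `&` C = [set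
    0],
     B1 `<=` addset A C & addset A C `<=` B]) ->
  dim X B = dim X A.
Proof.
move=> fX sA sB XA AB h; have sX := fg_submodule fX;
  have XB := subset_trans XA AB.
apply/le_anti; rewrite (dim_le_r Hdim)//=.
rewrite (bmr_inf Hdim (And3 sX sB XB) fX).
apply: le_ereal_inf_tmp => _ [B1 [sB1 fB1 XB1 B1B] <-].
have [C [sC cap B1C CB]] := h _ fB1 B1B.
rewrite -(dim_addset sX sA sC XA cap).
by apply: (dim_le_r Hdim) => //; exact: submodule_addset.
Qed.

End Summand.

Lemma dim_basis (K : realType) (R : pzRingType)
  (rk : forall n m, 'M[R]_(n, m) -> K)
  (dim : forall M : lmodType R, set M -> set M -> \bar K) (M : lmodType R)
  (A : set M) n (w : 'I_n -> M) :
  sylvester_matrix_rank rk -> bivariant_module_rank dim ->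
    corresponding rk dim ->
  is_basis A w -> dim M A A = n%:R%:E.
Proof.
move=> Hrk Hdim Hcor bw; rewrite -(dim_rV Hrk Hcor); apply/esym.
have AE : A = lincomb w @` setT by rewrite lincomb_range -gen_rangeE;
  exact: bw.2.
apply: (bmr_iso Hdim (f := lincomb w)).
- exact/subpairxx/submoduleT.
- by apply: subpairxx; rewrite AE; apply: submodule_image (submoduleT _);
    exact: lincomb_lin.
- by move=> a u v _ _; exact: lincomb_lin.
- split; first by move=> v _; rewrite AE; exists v.
    by move=> u v _ _; exact: (basis_inj bw).
  by rewrite AE.
- by rewrite -AE.
Qed.

(** * Maps that are linear on a submodule only *)

Section LinearOn.
Context {R : pzRingType} (M M' : lmodType R) (B : set M) (f : M -> M').
Hypotheses (sB : submodule B) (fl : linear_on B f).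

Lemma linear_on_comb n (c : 'I_n -> R) (x : 'I_n -> M) : (forall i, B (x i)) ->
  f (\sum_i c i *: x i) = \sum_i c i *: f (x i).
Proof.
have f0 : f 0 = 0.
  have := fl 1 (submod0 sB) (submod0 sB); rewrite !scale1r addr0 => /eqP.
  by rewrite -subr_eq subrr eq_sym => /eqP.
elim: n c x => [|n IHn] c x Bx; first by rewrite !big_ord0.
rewrite !big_ord_recl fl//; last first.
  by apply: (submod_sum _ sB) => i _; exact: (submodZ _ sB).
by rewrite IHn.
Qed.

Lemma image_lspan_on n (w : 'I_n -> M) : (forall i, B (w i)) ->
  f @` lspan w = lspan (f \o w).
Proof.
move=> Bw; apply/seteqP; split=> [_ [_ [c ->] <-]|_ [c ->]].
  by exists c; rewrite linear_on_comb.
exists (\sum_i c i *: w i); first by exists c.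
by rewrite linear_on_comb.
Qed.

Lemma image_mulset_on (W : set R) (A : set M) : A `<=` B ->
  f @` mulset W A = mulset W (f @` A).
Proof.
move=> AB; apply/seteqP;
  split=> [_ [_ [n [w [x [hw hx ->]]]] <-]|_ [n [w [y [hw hy ->]]]]].
  exists n, w, (f \o x); split=> //; first by move=> i; exists (x i).
  by rewrite linear_on_comb// => i; exact/AB.
have /choice[x xE] : forall i, exists x, A x /\ f x = y i.
  by move=> i; have [x ? ?] := hy i; exists x.
exists (\sum_i w i *: x i).
  by exists n, w, x; split=> // i; case: (xE i).
rewrite linear_on_comb; last by move=> i; apply: AB; case: (xE i).
by apply: eq_bigr => i _; rewrite (proj2 (xE i)).
Qed.

End LinearOn.

Section GenRestr.
Context {R S : pzRingType} (iota : {rmorphism R -> S}).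

Lemma gen_gen_restr (N : lmodType S) (V : set N) :
  gen (gen (V : set (restr iota N)) : set N) = gen V.
Proof.
apply/seteqP; split.
  by apply: gen_sub; [exact: gen_submodule|exact: gen_restr_sub].
by apply: gen_mono; exact: (@sub_gen _ (restr iota N)).
Qed.

Lemma fg_gen_restr (N : lmodType S) (A : set N) : fg A ->
  exists M : set N, fg (M : set (restr iota N)) /\ A = gen M.
Proof.
move=> [V fV ->]; exists (gen (V : set (restr iota N))); split;
  first by exists V.
by rewrite gen_gen_restr.
Qed.

Lemma fg_gen (N : lmodType S) (M : set N) : fg (M : set (restr iota N)) ->
  fg (gen M).
Proof. by move=> [V fV ->]; exists V => //; rewrite gen_gen_restr. Qed.

End GenRestr.

Lemma basis_reindex (R : pzRingType) (M : lmodType R) (I : finType) (w : I -> M)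
  (A : set M) :
  (forall c : I -> R, \sum_i c i *: w i = 0 -> forall i, c i = 0) ->
  (forall x, A x <-> exists c : I -> R, x = \sum_i c i *: w i) ->
  is_basis A (w \o (@enum_val I predT)).
Proof.
move=> indep AE.
have sumE (c : 'I_#|I| -> R) :
    \sum_t c t *: (w \o (@enum_val I predT)) t = \sum_i c (enum_rank i) *: w i.
  rewrite (reindex enum_rank) /=; last exact/onW_bij/enum_rank_bij.
  by apply: eq_bigr => i _; rewrite enum_rankK.
split=> [c|].
  rewrite sumE => /indep h t; rewrite -[t]enum_valK; exact: h.
rewrite gen_rangeE; apply/seteqP; split=> [x /AE[c ->]|_ [c ->]].
  exists (c \o enum_val); rewrite sumE; apply: eq_bigr => i _.
  by rewrite /= enum_rankK.
by apply/AE; exists (fun i => c (enum_rank i)); rewrite sumE.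
Qed.

(** * Members of [F] and their translates by elements of [U] *)

Section NormalSystem.
Context {R S : pzRingType} (iota : {rmorphism R -> S}) (F : set (set S))
  (U : set S).
Hypotheses (iota_inj : injective iota) (HF : finite_approx_system iota F)
  (HN : normal_system iota F U).
Implicit Types (N : lmodType S) (W V : set S).
Local Notation rsub W := (submodule (W : set (restr iota S^o))).
Local Notation rgen w := (gen (range (w : 'I__ -> restr iota S^o)) : set S).

Lemma U_mulI g : U g -> injective ( *%R g).
Proof.
move=> /(ns_sub HN)[g0 ngz _] x y gxy; apply/eqP; rewrite -subr_eq0; apply/eqP.
apply: contrapT => /eqP xy0; apply: ngz; split=> //; exists (x - y) => //; left.
by rewrite mulrBr gxy subrr.
Qed.

Lemma U_mulIr g : U g -> injective ( *%R^~ g).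
Proof.
move=> /(ns_sub HN)[g0 ngz _] x y gxy; apply/eqP; rewrite -subr_eq0; apply/eqP.
apply: contrapT => /eqP xy0; apply: ngz; split=> //; exists (x - y) => //;
  right.
by rewrite mulrBl gxy subrr.
Qed.

Lemma U_mul g h : U g -> U h -> U (g * h).
Proof. exact: (ns_mul HN).2. Qed.

(** The scalar chosen by [sigma] exists because [gR = Rg] and is unique because [g] is not a
    zero-divisor and [iota] is injective; uniqueness turns the defining identity into the laws of a
    ring automorphism. *)
Lemma sigma_rmorphism g : U g -> exists s : {rmorphism R -> R},
  [/\ bijective s, forall a, g * iota a = iota (s a) * g & s = sigma iota g :>
    (R -> R)].
Proof.
move=> Ug; have [_ _ gR] := ns_sub HN Ug.
have inj a b : iota a * g = iota b * g ->
  a = b by move=> /(U_mulIr Ug)/iota_inj.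
have sE a : g * iota a = iota (sigma iota g a) * g.
  rewrite /sigma; case: xgetP => [b _ //|/=].
  have : Rmul iota g (g * iota a) by rewrite -gR; exists a.
  by move=> [b _ E] /(_ b); rewrite E.
have s_zmod : zmod_morphism (sigma iota g).
  by move=> a b; apply: inj; rewrite -sE !rmorphB mulrBr !sE mulrBl.
have s_monoid : monoid_morphism (sigma iota g).
  split; first by apply: inj; rewrite -sE !rmorph1 mulr1 mul1r.
  by move=> a b; apply: inj; rewrite -sE !rmorphM mulrA sE -mulrA sE mulrA.
pose s : {rmorphism R -> R} := HB.pack (sigma iota g)
  (GRing.isZmodMorphism.Build _ _ _ s_zmod)
  (GRing.isMonoidMorphism.Build _ _ _ s_monoid).
have sfE a : s a = sigma iota g a by [].
exists s; split=> //.
have /choice[t tE] : forall b, exists a, g * iota a = iota b * g.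
  move=> b; have : Rmul iota g (iota b * g) by exists b.
  by rewrite -gR => -[a _ E]; exists a.
exists t => a; last by apply: inj; rewrite sfE -sE tE.
by apply/iota_inj/(U_mulI Ug); rewrite tE sfE sE.
Qed.

(** Left multiplication by [g] becomes [R]-linear once its target carries the scalars twisted by
    [s]. *)
Lemma smul_linear N g (s : {rmorphism R -> R}) :
  (forall a, g * iota a = iota (s a) * g) ->
  linear ((fun x => g *: x) : restr iota N -> restr s (restr iota N)).
Proof.
move=> gs a u v.
rewrite [LHS](scalerDr g (iota a *: (u : N)) (v : N)).
by rewrite scalerA gs -scalerA.
Qed.

Lemma smul_submodule N g (A : set N) : U g ->
  submodule (A : set (restr iota N)) ->
  submodule ((fun x => g *: x) @` A : set (restr iota N)).
Proof.
move=> Ug sA; have [s [sb gs _]] := sigma_rmorphism Ug.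
by rewrite -(submodule_twist sb); exact: submodule_image (smul_linear gs) sA.
Qed.

Lemma smul_fg N g (A : set N) : U g -> fg (A : set (restr iota N)) ->
  fg ((fun x => g *: x) @` A : set (restr iota N)).
Proof.
move=> Ug fA; have [s [sb gs _]] := sigma_rmorphism Ug.
by rewrite -(fg_twist sb); exact: fg_image (smul_linear gs) fA.
Qed.

Lemma F_basis W : F W -> exists n (w : 'I_n -> S),
  (forall i, U (w i)) /\ is_basis (W : set (restr iota S^o))
    (w : 'I_n -> restr iota S^o).
Proof. exact: (ns_basis HN). Qed.

Lemma F_submodule W : F W -> rsub W.
Proof. by move=> /F_basis[n [w [_ [_ ->]]]]; exact: gen_submodule. Qed.

Lemma F_gen_basis W : F W -> exists n (w : 'I_n -> S),
  [/\ forall i, U (w i), W = rgen w & n = dimS iota W].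
Proof.
move=> /F_basis[n [w [Uw bw]]]; exists n, w; split=> //; first exact: bw.2.
by rewrite /dimS (frank_basis (fas_IBN HF) bw).
Qed.

(** A complement of [W] in itself is zero. *)
Lemma F_set0 : F [set 0].
Proof.
have [W FW _] := fas_fg HF (@submodule_set0 _ _) (@fg_set0 _ _).
have [V [FV WV cap]] := fas_compl HF FW FW (@subset_refl _ _).
suff -> : [set 0] = V by [].
rewrite -cap; apply/seteqP; split=> [x []|x Vx] //; split=> //.
by rewrite WV; apply: (@addset_subr _ (restr iota S^o)) => //;
  exact: F_submodule.
Qed.

Lemma dimS_set0 : dimS iota [set 0 : S] = 0%N.
Proof.
rewrite /dimS; apply: (frank_basis (fas_IBN HF)
  (w := fun i : 'I_0 => 0 : restr iota S^o)); split=> [c _ []//|].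
rewrite gen_rangeE; apply/seteqP; split=> [x ->|x [c ->]].
  by exists (fun=> 0); rewrite big_ord0.
by rewrite big_ord0.
Qed.

Lemma dimS_direct W V : F W -> F V -> W `&` V = [set 0] ->
  dimS iota (addset W V) = (dimS iota W + dimS iota V)%N.
Proof.
move=> /F_basis[n [w [_ bw]]] /F_basis[m [v [_ bv]]] WV; rewrite /dimS.
rewrite (frank_basis (fas_IBN HF) bw) (frank_basis (fas_IBN HF) bv).
exact (frank_basis (fas_IBN HF) (@is_basis_addset R
  (restr iota S^o) W V n m w v WV bw bv)).
Qed.

Lemma dimS_compl V W : F V -> F W -> V `<=` W -> exists V',
  [/\ F V', W = addset V V', V `&` V' = [set 0] &
      dimS iota W = (dimS iota V + dimS iota V')%N].
Proof.
move=> FV FW /(fas_compl HF FV FW)[V' [FV' WE VV']]; exists V'; split=> //.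
by rewrite WE dimS_direct.
Qed.

Lemma dimS_mono V W : F V -> F W -> V `<=` W -> (dimS iota V <= dimS iota W)%N.
Proof. by move=> FV FW /(dimS_compl FV FW)[V' [_ _ _ ->]]; exact: leq_addr. Qed.

(** A complement of the intersection in [W] is also a complement of [V] in [V + W]. *)
Lemma dimS_modular V W : F V -> F W ->
  (dimS iota (addset V W) + dimS iota (V `&` W) = dimS iota V + dimS iota W)%N.
Proof.
move=> FV FW; have FI := fas_cap HF FV FW.
have [sV sW] := (F_submodule FV, F_submodule FW).
have [V' [FV' WE VV' ->]] := dimS_compl FI FW (@subIsetr _ V W).
have sV' := F_submodule FV'.
have V'W : V' `<=` W.
  rewrite WE; apply: (@addset_subr _ (restr iota S^o)); exact: F_submodule.
have -> : addset V W = addset V V'.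
  apply/seteqP; split; apply: (@addset_sub _ (restr iota S^o)).
  - exact: (@submodule_addset _ (restr iota S^o)).
  - exact: (@addset_subl _ (restr iota S^o)).
  - rewrite {1}WE; apply: (@addset_sub _ (restr iota S^o)).
    + exact: (@submodule_addset _ (restr iota S^o)).
    + apply: subset_trans (@subIsetl _ _ _) _;
        exact: (@addset_subl _ (restr iota S^o)).
    + exact: (@addset_subr _ (restr iota S^o)).
  - exact: (@submodule_addset _ (restr iota S^o)).
  - exact: (@addset_subl _ (restr iota S^o)).
  - apply: subset_trans V'W _; exact: (@addset_subr _ (restr iota S^o)).
rewrite dimS_direct//; last first.
  apply/seteqP; split=> [x [Vx V'x]|x ->].
    by rewrite -VV'; split=> //; split=> //; exact: V'W.
  by split; [exact: (submod0 sV)|exact: (submod0 sV')].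
by rewrite -addnA [(dimS iota V' + _)%N]addnC.
Qed.

Lemma dimS_gt0 W : Fhat F W -> (0 < dimS iota W)%N.
Proof.
move=> [FW /eqP W0]; have [n [w [_ WE <-]]] := F_gen_basis FW.
case: n w WE => // w WE; case: W0; rewrite WE gen_rangeE.
apply/seteqP; split=> [x [c ->]|x ->]; first by rewrite big_ord0.
by exists (fun=> 0); rewrite big_ord0.
Qed.

Lemma F_neq0 W : Fhat F W -> exists2 u, U u & W u.
Proof.
move=> hW; have := dimS_gt0 hW; have [n [w [Uw WE <-]]] := F_gen_basis hW.1.
case: n w Uw WE => // n w Uw WE _; exists (w ord0) => //.
by rewrite WE; apply: sub_gen; exists ord0.
Qed.

Lemma Rmul_submodule g : rsub (Rmul iota g).
Proof.
apply: submodule_intro; first by exists 0 => //; rewrite rmorph0 mul0r.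
  by move=> _ _ [a _ <-] [b _ <-]; exists (a + b) => //; rewrite rmorphD mulrDl.
by move=> a _ [b _ <-]; exists (a * b) => //; rewrite rmorphM -mulrA.
Qed.

Lemma gen_range_recl n (w : 'I_n.+1 -> S) :
  rgen w = addset (Rmul iota (w ord0)) (rgen (fun i => w (lift ord0 i))).
Proof.
have sR := Rmul_submodule (w ord0).
apply/seteqP; split.
  apply: (@gen_sub _ (restr iota S^o)).
    apply: (@submodule_addset _ (restr iota S^o)) => //; exact: gen_submodule.
  move=> _ [i _ <-]; case: (unliftP ord0 i) => [j ->|->].
    by apply: (@addset_subr _ (restr iota S^o)) => //; apply: sub_gen; exists j.
  apply: (@addset_subl _ (restr iota S^o)); first exact: gen_submodule.
  by exists 1 => //; rewrite rmorph1 mul1r.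
apply: (@addset_sub _ (restr iota S^o)); first exact: gen_submodule.
  move=> _ [a _ <-].
  apply: (submodZ (M := restr iota S^o) a (gen_submodule _)).
  by apply: sub_gen; exists ord0.
by apply: gen_mono => _ [i _ <-]; exists (lift ord0 i).
Qed.

Lemma rgen0 (w : 'I_0 -> S) : rgen w = [set 0].
Proof.
rewrite gen_rangeE; apply/seteqP; split=> [x [c ->]|x ->];
  first by rewrite big_ord0.
by exists (fun=> 0); rewrite big_ord0.
Qed.

Lemma F_gen n (w : 'I_n -> S) : (forall i, U (w i)) -> F (rgen w).
Proof.
elim: n w => [|n IHn] w Uw; first by rewrite rgen0; exact: F_set0.
by rewrite gen_range_recl; apply: (fas_add HF); [exact: (ns_Rg HN)|exact: IHn].
Qed.

Lemma lmulset_rgen g n (w : 'I_n -> S) : U g ->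
  lmulset g (rgen w) = rgen (fun i => g * w i).
Proof.
move=> Ug; have [s [sb gs _]] := sigma_rmorphism Ug.
have := image_gen (range (w : 'I_n -> restr iota S^o)) (smul_linear
  (N := S^o) gs).
by rewrite (gen_twist sb) image_comp => E; exact E.
Qed.

(** Closure under left translation comes from bases: [g] sends a basis in [U] to a family in [U],
    and independence survives because coefficients pass through [g] by the inverse of [sigma g]. *)
Lemma F_lmulset g W : U g -> F W ->
  F (lmulset g W) /\ dimS iota (lmulset g W) = dimS iota W.
Proof.
move=> Ug FW; have [n [w [Uw bw]]] := F_basis FW.
have gE : lmulset g W = rgen (fun i => g * w i).
  by rewrite bw.2 lmulset_rgen.
split; first by rewrite gE; apply: F_gen => i; exact: U_mul.
rewrite /dimS (frank_basis (fas_IBN HF) bw).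
apply: (frank_basis (fas_IBN HF) (w := fun i => g * w i : restr iota S^o));
  split; last exact: gE.
have [s [sb gs _]] := sigma_rmorphism Ug; have [t st ts] := sb.
move=> c c0 i; rewrite -[c i]ts.
suff -> : t (c i) = 0 by rewrite rmorph0.
apply: (bw.1 (t \o c)); apply: (U_mulI Ug); rewrite mulr0 -[RHS]c0 mulr_sumr.
apply: eq_bigr => j _.
by rewrite [LHS]mulrA gs /= ts -mulrA.
Qed.

Lemma mulset_Rmul N g (M : set N) : U g -> submodule (M : set (restr iota N)) ->
  mulset (Rmul iota g) M = (fun x => g *: x) @` M.
Proof.
move=> Ug sM; apply/seteqP; split.
  apply: (@mulset_sub _ _ iota); first exact: smul_submodule.
  move=> _ m [a _ <-] Mm.
  have [s [[t st ts] gs _]] := sigma_rmorphism Ug.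
  exists (iota (t a) *: m); last by rewrite scalerA gs ts.
  exact: (submodZ (t a) sM).
move=> _ [m Mm <-]; apply: mulset_in => //.
by exists 1 => //; rewrite rmorph1 mul1r.
Qed.

(** Peels one element off a basis, for inductions on the rank. It rests on [R w M = w M], which
    holds since [R w = w R]. *)
Lemma mulset_rgen_recl N n (w : 'I_n.+1 -> S) (M : set N) : U (w ord0) ->
  submodule (M : set (restr iota N)) ->
  mulset (rgen w) M = addset ((fun x => w ord0 *: x) @` M)
    (mulset (rgen (fun i => w (lift ord0 i))) M).
Proof.
move=> Uw sM; rewrite gen_range_recl (mulset_addset (iota := iota)).
- by rewrite mulset_Rmul.
- exact: Rmul_submodule.
- exact: gen_submodule.
Qed.

Lemma mulset0 N (M : set N) : mulset [set 0] M = [set 0].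
Proof.
apply/seteqP; split=> [_ [n [w [m [hw _ ->]]]]|_ ->].
  by apply: big1 => i _; rewrite (hw i) scale0r.
by exists 0%N, (fun=> 0), (fun=> 0); split=> [[]|[]|] //; rewrite big_ord0.
Qed.

Lemma mulset_set0 N W : mulset W [set 0 : N] = [set 0].
Proof.
apply/seteqP; split=> [_ [n [w [m [_ hm ->]]]]|_ ->].
  by apply: big1 => i _; rewrite (hm i) scaler0.
by exists 0%N, (fun=> 0), (fun=> 0); split=> [[]|[]|] //; rewrite big_ord0.
Qed.

Lemma mulset_rgen_fg N n (w : 'I_n -> S) (M : set N) :
  (forall i b, exists b', w i * iota b = iota b' * w i) ->
  fg (M : set (restr iota N)) -> fg (mulset (rgen w) M : set (restr iota N)).
Proof.
move=> wR /fg_ex[k [m ->]].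
exists (range (fun ij : 'I_n * 'I_k => w ij.1 *: (m ij.2 : N))).
  exact/finite_image/finite_finset.
have sW : rsub (rgen w) by exact: gen_submodule.
apply/seteqP; split; last first.
  apply: gen_sub; first exact: mulset_submodule.
  move=> _ [[i j] _ <-]; apply: mulset_in; first by apply: sub_gen; exists i.
  by rewrite -gen_rangeE; apply: sub_gen; exists j.
apply: (@mulset_sub _ _ iota); first exact: gen_submodule.
move=> x y; rewrite gen_rangeE => -[a ->] [b ->].
rewrite scaler_suml; apply: (submod_sum (M := restr iota N)) => [|i _].
  exact: gen_submodule.
rewrite scaler_sumr; apply: (submod_sum (M := restr iota N)) => [|j _].
  exact: gen_submodule.
have [b' bE] := wR i (b j).
rewrite [X in gen _ X](_ : _ = (a i * b') *: (w i *: (m j : N) : restr iota N)).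
  by apply: (submodZ _ (gen_submodule _)); apply: sub_gen; exists (i, j).
transitivity ((iota (a i) * w i) *: (iota (b j) *: (m j : N))); first by [].
rewrite scalerA -mulrA bE mulrA -rmorphM -scalerA.
by [].
Qed.

(* [Z] has a basis that normalizes [R], although it need not belong to [F] *)
Lemma mulset_fg_smul N g Z (M : set N) : U g -> F (lmulset g Z) -> rsub Z ->
  fg (M : set (restr iota N)) -> fg (mulset Z M : set (restr iota N)).
Proof.
move=> Ug FgZ sZ fM; have [n [u [Uu gZE _]]] := F_gen_basis FgZ.
have [s [[t st ts] gs _]] := sigma_rmorphism Ug.
have /choice[z zE] : forall i, exists z, Z z /\ g * z = u i.
  move=> i; have [z Zz zE] : lmulset g Z (u i); last by exists z.
  by rewrite gZE; apply: sub_gen; exists i.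
have gt a x : g * (iota (t a) * x) = iota a *
  (g * x) by rewrite mulrA gs ts mulrA.
have -> : Z = rgen z.
  apply/seteqP; split=> [x Zx|]; last first.
    by apply: (@gen_sub _ (restr iota S^o)) => // _ [i _ <-]; case: (zE i).
  have : lmulset g Z (g * x) by exists x.
  rewrite gZE !gen_rangeE => -[c cE]; exists (t \o c); apply: (U_mulI Ug).
  rewrite cE mulr_sumr; apply: eq_bigr => i _.
  rewrite [RHS](gt (c i) (z i)) (proj2 (zE i)).
  by [].
apply: mulset_rgen_fg => // i b.
have [s' [_ us _]] := sigma_rmorphism (Uu i).
exists (t (s' b)); apply: (U_mulI Ug).
by rewrite /= gt mulrA (proj2 (zE i)) us.
Qed.

Lemma lmulset1 W : lmulset 1 W = W.
Proof.
apply/seteqP; split=> [_ [x Wx <-]|x Wx]; first by rewrite mul1r.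
by exists x => //; rewrite mul1r.
Qed.

Lemma mulset_fg N W (M : set N) : F W -> fg (M : set (restr iota N)) ->
  fg (mulset W M : set (restr iota N)).
Proof.
move=> FW fM; apply: (mulset_fg_smul (g := 1)) => //;
  first exact: (ns_mul HN).1.
  by rewrite lmulset1.
exact: F_submodule.
Qed.

Lemma F_mulset W V : F W -> F V -> F (mulsetS W V).
Proof.
move=> /F_gen_basis[n [w [Uw -> _]]] FV; elim: n w Uw => [|n IHn] w Uw.
  by rewrite rgen0 /mulsetS mulset0; exact: F_set0.
rewrite /mulsetS mulset_rgen_recl//; last exact: F_submodule.
by apply: (fas_add HF); [exact: (F_lmulset (Uw ord0) FV).1|exact: IHn].
Qed.

(** Some [u] in [U] lies in [V]. Right multiplication by [u] is injective and sends a basis of [W]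
    in [U] to one of [W u], a member of [F] inside [W V]. *)
Lemma dimS_mulset_ge W V : F W -> Fhat F V ->
  (dimS iota W <= dimS iota (mulsetS W V))%N.
Proof.
move=> FW hV; have FV := hV.1; have [u Uu Vu] := F_neq0 hV.
have FWV := F_mulset FW FV.
have [n [w [Uw bw]]] := F_basis FW.
have FWu : F (rgen (fun i => w i * u)) by apply: F_gen => i; exact: U_mul.
have sWV := F_submodule FWV.
apply: leq_trans (dimS_mono FWu FWV _); last first.
  apply: (@gen_sub _ (restr iota S^o)) => // _ [i _ <-].
  by apply: (@mulset_in _ S^o) => //; rewrite bw.2; apply: sub_gen; exists i.
rewrite /dimS (frank_basis (fas_IBN HF) bw).
rewrite (frank_basis (fas_IBN HF) (w := fun i => w i * u : restr iota S^o))//;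
  split=> // c c0.
apply: bw.1; apply: (U_mulIr Uu); rewrite mul0r -[RHS]c0 mulr_suml.
by apply: eq_bigr => i _; rewrite -[LHS]mulrA.
Qed.

Lemma F_finite (V : set S) : finite_set V -> exists2 W, F W & V `<=` W.
Proof.
move=> fV; have [||W FW gW] := fas_fg HF (A := gen (V : set (restr iota S^o))).
- exact: gen_submodule.
- by exists V.
by exists W => //; apply: subset_trans gW; exact: sub_gen.
Qed.

End NormalSystem.

(** * The filter of sufficiently invariant members of [F] *)

Section InvariantFilter.
Context {K : realType} {R S : pzRingType} (iota : {rmorphism R -> S}).
Variables (F : set (set S)) (U : set S).
Hypotheses (iota_inj : injective iota) (Hra : right_amenable K iota F)
  (HN : normal_system iota F U).
Let HF := ra_fas Hra.
Local Notation rgen w := (gen (range (w : 'I__ -> restr iota S^o)) : set S).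

(** Members of [F] are right [R]-submodules too, since their basis elements normalize [R]. *)
Lemma F_mulr W a x : F W -> W x -> W (x * iota a).
Proof.
move=> FW; have [n [w [Uw WE _]]] := F_gen_basis HF HN FW.
have sW := F_submodule HN FW.
rewrite {1}WE gen_rangeE => -[c ->]; rewrite mulr_suml.
apply: (submod_sum (M := restr iota S^o)) => // i _.
have [s [_ ws _]] := sigma_rmorphism iota_inj HN (Uw i).
rewrite [X in W X](_ : _ = (c i * s a) *: (w i : restr iota S^o)).
  by apply: (submodZ (M := restr iota S^o)) => //; rewrite WE; apply: sub_gen;
    exists i.
transitivity (iota (c i) * w i * iota a); first by [].
by rewrite -mulrA ws mulrA -rmorphM.
Qed.

(** It is enough to test invariance on a finite spanning family of [V]: in a product [w c v] the
    scalar [c] is absorbed by [w], by [F_mulr]. *)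
Lemma fin_F_invariant V W (d : K) n (v : 'I_n -> S) : F W -> F V ->
  V = rgen v ->
  fin_invariant iota F (range v) d W -> F_invariant iota V d W.
Proof.
move=> FW FV VE [W' [FW' WW' dW']].
have FWV : F (addset W (mulsetS W V)).
  by apply: (fas_add HF) => //; exact: (F_mulset iota_inj HF HN).
have sW' := F_submodule HN FW'; have sW := F_submodule HN FW.
apply: le_trans dW'; rewrite ler_nat; apply: (dimS_mono HF HN) => //.
have sWv : submodule (mulsetS W (range v) : set (restr iota S^o)).
  exact: (@mulset_submodule _ _ iota S^o).
apply: (@addset_sub _ (restr iota S^o)) => //.
  by move=> x Wx; apply: WW'; exact: (@addset_subl _ (restr iota S^o)).
apply: (@mulset_sub _ _ iota S^o) => // w m Ww;
  rewrite VE gen_rangeE => -[c ->].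
rewrite scaler_sumr.
apply: (submod_sum (M := restr iota S^o)) => // i _.
apply: WW'; apply: (@addset_subr _ (restr iota S^o)) => //.
rewrite [X in mulsetS _ _ X](_ : _ = (w * iota (c i)) * v i).
  apply: (@mulset_in S S^o); first exact: F_mulr.
  by exists i.
by rewrite -mulrA.
Qed.

Lemma F_invariant_mono V V' (d d' : K) W : F W -> F V -> F V' -> V `<=` V' ->
  d' <= d ->
  F_invariant iota V' d' W -> F_invariant iota V d W.
Proof.
move=> FW FV FV' VV' dd' inv;
  have FM := fun V => @F_mulset _ _ _ _ _ iota_inj HF HN W V FW.
apply: (@le_trans _ _ (dimS iota (addset W (mulsetS W V')))%:R).
  rewrite ler_nat; apply: (dimS_mono HF HN).
  - by apply: (fas_add HF) => //; exact: FM.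
  - by apply: (fas_add HF) => //; exact: FM.
  - move=> _ [x Wx [y WVy <-]]; exists x => //; exists y => //.
    exact: mulset_mono WVy.
apply: (le_trans inv); apply: ler_wpM2r => //; lra.
Qed.

Lemma Fhat_ex V (d : K) : F V -> 0 < d ->
  exists2 W, Fhat F W & F_invariant iota V d W.
Proof.
move=> FV d0; have [n [v [_ VE _]]] := F_gen_basis HF HN FV.
have [W hW inv] := ra_inv Hra (finite_range v) d0.
by exists W => //; apply: fin_F_invariant VE inv => //; exact: hW.1.
Qed.

Lemma inv_filter_proper : ProperFilter (inv_filter K iota F).
Proof.
split; first last.
  split.
  - by exists [set 0], 1; split=> //; exact: F_set0 HF HN.
  - move=> P Q [V [d [FV d0 VP]]] [V' [d' [FV' d'0 VQ]]].
    have FVV' : F (addset V V') by exact: (fas_add HF).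
    have [sV sV'] := (F_submodule HN FV, F_submodule HN FV').
    exists (addset V V'), (Num.min d d'); split=> //;
      first by rewrite lt_min d0.
    move=> W hW inv; split.
      apply: VP => //; apply: F_invariant_mono inv => //; first exact: hW.1.
        exact: (@addset_subl _ (restr iota S^o)).
      by rewrite ge_min lexx.
    apply: VQ => //; apply: F_invariant_mono inv => //; first exact: hW.1.
      exact: (@addset_subr _ (restr iota S^o)).
    by rewrite ge_min lexx orbT.
  - by move=> P Q PQ [V [d [FV d0 VP]]]; exists V, d;
      split=> // W hW /(VP _ hW)/PQ.
move=> [V [d [FV d0 VP]]]; have [W hW inv] := Fhat_ex FV d0.
exact: (VP W).
Qed.

Lemma inv_filter_Fhat : inv_filter K iota F (Fhat F).
Proof. by exists [set 0], 1; split=> //; exact: F_set0 HF HN. Qed.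

End InvariantFilter.

(** Values of [dim_F] may be infinite, so only the members of the two sets, not their suprema, are
    taken finite. *)
Lemma ereal_sup_add_le (K : realType) (X Y : set (\bar K)) (z : \bar K) :
  X !=set0 -> Y !=set0 -> (forall x, X x -> x \is a fin_num) ->
    (forall y, Y y -> y \is a fin_num) ->
  (forall x y, X x -> Y y -> (x + y <= z)%E) ->
  (ereal_sup X + ereal_sup Y <= z)%E.
Proof.
move=> [x0 Xx0] [y0 Yy0] Xfin Yfin XYz.
have X0 : (x0 <= ereal_sup X)%E by exact: ereal_sup_ubound.
have h y : Y y -> (ereal_sup X + y <= z)%E.
  move=> Yy; rewrite -leeBrDr; last exact: Yfin.
  by apply: ge_ereal_sup => x Xx; rewrite leeBrDr; [exact: XYz|exact: Yfin].
have [Xoo|Xoo] := eqVneq (ereal_sup X) +oo%E.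
  have := h _ Yy0; rewrite Xoo addye; last by case/fin_numP: (Yfin _ Yy0).
  by rewrite leye_eq => /eqP ->; rewrite leey.
have Xf : ereal_sup X \is a fin_num.
  apply/fin_numP; split=> //; apply/eqP => Xoo'; move: X0.
  by rewrite Xoo' leeNy_eq; case/fin_numP: (Xfin _ Xx0) => /negPf ->.
rewrite -leeBrDl//; apply: ge_ereal_sup => y Yy.
by rewrite leeBrDl//; exact: h.
Qed.

(** * Mean dimension *)

Section AmenableExtension.
Context {K : realType} {R S : pzRingType} (iota : {rmorphism R -> S}).
Variable rk : forall n m, 'M[R]_(n, m) -> K.
Variable dim : forall M : lmodType R, set M -> set M -> \bar K.
Variables (F : set (set S)) (U : set S).
Hypotheses (Hrk : sylvester_matrix_rank rk) (Hdim : bivariant_module_rank dim)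
  (Hcor : corresponding rk dim) (Hext : amenable_normal_extension iota F U rk).

Let iota_inj := ane_inj Hext.
Let Hra := ane_amenable Hext.
Let HF := ra_fas Hra.
Let HN := ane_normal Hext.
Local Notation rsub W := (submodule (W : set (restr iota S^o))).
Local Notation rgen w := (gen (range (w : 'I__ -> restr iota S^o)) : set S).

(** * The growth estimate inside a fixed [S]-module *)

Section FixedModule.
Context (N : lmodType S) (B : set N).
Hypothesis sBS : submodule B.
Let sB := submodule_restr iota sBS.
Let RN : lmodType R := restr iota N.
Local Notation p A := (fine (dim (A : set RN) (B : set RN))).

Lemma rdim_fin (A A' : set RN) : submodule A -> A `<=` A' -> fg A' ->
  A' `<=` B ->
  dim A B \is a fin_num.
Proof.
move=> sA AA' fA' A'B; apply: (dim_fin_num Hrk Hdim Hcor _ fA') => //.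
by split=> //; exact: subset_trans A'B.
Qed.

Lemma rdim_ge0 (A : set RN) : submodule A -> A `<=` B -> 0 <= p A.
Proof. by move=> sA AB; apply: fine_ge0; exact: (bmr_ge0 Hdim). Qed.

Lemma rdim_mono (A A' : set RN) : submodule A -> A `<=` A' -> fg A' ->
  A' `<=` B ->
  p A <= p A'.
Proof.
move=> sA AA' fA' A'B; have sA' := fg_submodule fA'.
apply: fine_le.
- exact: rdim_fin AA' fA' A'B.
- exact: rdim_fin (@subset_refl _ _) fA' A'B.
- apply: (dim_le_l Hdim) => //; split=> //; exact: subset_trans A'B.
Qed.

Lemma rdim_set0 : p [set 0] = 0.
Proof.
apply/le_anti; rewrite rdim_ge0; [|exact: submodule_set0|]; last first.
  by move=> _ ->; exact: (submod0 sB).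
rewrite andbT -[leRHS]/(fine 0%E); apply: fine_le => //.
  apply: (@rdim_fin _ [set 0]) => //; [exact: submodule_set0|exact: fg_set0|].
  by move=> _ ->; exact: (submod0 sB).
rewrite -(bmr_0 Hdim RN); apply: (dim_le_r Hdim) => //.
  exact/subpairxx/submodule_set0.
by move=> _ ->; exact: (submod0 sB).
Qed.

(** Submodularity for the map [x] to [c x], linear into the twisted module; [dim_twist] then removes
    the twist from both terms of the target. As [B] is an [S]-submodule, [c B] stays inside it. *)
Lemma rdim_smul c (A1 A2 A1' : set RN) : U c -> submodule A1 -> fg A2 ->
  A1 `<=` A2 -> A2 `<=` B -> fg A1' -> A1' `<=` B ->
  ((fun x : N => c *: x) @` A1 : set N) `<=` A1' ->
  p (addset ((fun x : N => c *: x) @` A2 : set RN) A1') + p A1 <= p A1' + p A2.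
Proof.
move=> Uc sA1 fA2 A12 A2B fA1' A1'B cA1.
have [s [sb cs sE]] := sigma_rmorphism iota_inj HN Uc.
have rks n m (M : 'M[R]_(n, m)) : rk (map_mx s M) = rk M.
  rewrite -(ane_rk Hext M Uc); congr (rk _); apply/matrixP => i j.
  by rewrite !mxE sE.
have cl := smul_linear (N := N) cs.
have sBs : submodule (B : set (restr s RN)) by rewrite submodule_twist.
have fA1s : fg (A1' : set (restr s RN)) by rewrite fg_twist.
have cB : ((fun x : N => c *: x) @` B) `<=` B.
  by move=> _ [x Bx <-]; exact: submodZ.
have := dim_submod Hrk Hdim Hcor cl sB sBs cB sA1 fA2 A12 A2B fA1s A1'B cA1.
have sA2 := fg_submodule fA2.
have scA2 := smul_submodule iota_inj HN Uc sA2.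
have fcA2 := smul_fg iota_inj HN Uc fA2.
have fT := fg_addset fcA2 fA1'.
have TB : addset ((fun x : N => c *: x) @` A2 : set RN) A1' `<=` B.
  apply: (@addset_sub _ RN) => // _ [x A2x <-].
  by apply: submodZ => //; exact: A2B.
have sA1' := fg_submodule fA1'.
have sT := fg_submodule fT.
rewrite [X in (X + _ <= _)%E](dim_twist sb Hrk Hdim Hcor rks) //.
rewrite [X in (_ <= X + _)%E](dim_twist sb Hrk Hdim Hcor rks) //.
rewrite -(fineK (rdim_fin sA1 A12 fA2 A2B)) -(fineK (rdim_fin sA2
  (@subset_refl _ _) fA2 A2B)).
rewrite -(fineK (rdim_fin sA1' (@subset_refl _ _) fA1' A1'B)).
rewrite -(fineK (rdim_fin sT (@subset_refl _ _) fT TB)).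
by rewrite -!EFinD lee_fin.
Qed.

(** Each basis element of [W] adds at most [p M], by [rdim_smul] with [A1] zero. *)
Lemma rdim_mulset_le W (M Y : set RN) : F W -> fg M -> M `<=` B -> fg Y ->
  Y `<=` B ->
  p (addset (mulset W (M : set N) : set RN) Y) <= p Y + (dimS iota W)%:R * p M.
Proof.
move=> FW fM MB fY YB; have [n [w [Uw -> <-]]] := F_gen_basis HF HN FW.
have sY := fg_submodule fY; have sM := fg_submodule fM.
have sMB V : (mulset V (M : set N) : set RN) `<=` B.
  exact: (mulset_sub_submodule sBS).
elim: n w Uw => [|n IHn] w Uw.
  rewrite rgen0 mulset0 mul0r addr0; apply: rdim_mono => //.
    by apply: submodule_addset => //; exact: submodule_set0.
  by apply: addset_sub => // _ ->; exact: (submod0 sY).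
rewrite (mulset_rgen_recl iota_inj HN)//.
pose w' i := w (lift ord0 i); set X := mulset _ _.
have fX : fg (X : set RN).
  by apply: (mulset_fg iota_inj HF HN) => //; apply: (F_gen HF HN) => i;
    exact: Uw.
have fXY := fg_addset fX fY.
have XYB : addset (X : set RN) Y `<=` B by apply: addset_sub => //; exact: sMB.
have c0 : (fun x : N => w ord0 *: x) @` [set 0] `<=` addset (X : set RN) Y.
  move=> _ [_ -> <-]; rewrite scaler0; exact: (submod0 (fg_submodule fXY)).
have s0 := @submodule_set0 _ RN.
have z0 : [set 0] `<=` M by move=> _ ->; exact: (submod0 sM).
have := rdim_smul (Uw ord0) s0 fM z0 MB fXY XYB c0.
rewrite rdim_set0 addr0 => h.
have -> : addset (addset ((fun x : N => w ord0 *: x) @` M : set RN) X) Y =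
   addset ((fun x : N => w ord0 *: x) @` M : set RN) (addset (X : set RN) Y).
  apply/seteqP; split.
    move=> _ [_ [a Ma [b Xb <-]] [y Yy <-]]; exists a => //; exists (b + y).
      by exists b => //; exists y.
    by rewrite addrA.
  move=> _ [a Ma [_ [b Xb [y Yy <-]] <-]]; exists (a + b).
    by exists a => //; exists b.
  by exists y => //; rewrite addrA.
apply: (le_trans h); have := IHn w' (fun i => Uw _).
by rewrite -/X -[n.+1%:R]natr1 mulrDl mul1r; lra.
Qed.

(** A Lipschitz bound: only a complement of [V] in [W] contributes. *)
Lemma rdim_mulset_sub V W (M : set RN) : F V -> F W -> V `<=` W -> fg M ->
  M `<=` B ->
  p (mulset W (M : set N)) <=
  p (mulset V (M : set N)) + ((dimS iota W)%:R - (dimS iota V)%:R) * p M.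
Proof.
move=> FV FW VW fM MB; have [V' [FV' -> _ ->]] := dimS_compl HF HN FV FW VW.
rewrite (mulset_addset (iota := iota));
  [|exact: (F_submodule HN)|exact: (F_submodule HN)].
rewrite natrD addrAC subrr add0r.
have -> : addset (mulset V (M : set N)) (mulset V' (M : set N)) =
    addset (mulset V' (M : set N)) (mulset V (M : set N)).
  by apply/seteqP; split=> _ [a ? [b ? <-]]; exists b => //; exists a => //;
    rewrite addrC.
apply: rdim_mulset_le => //; first exact: (mulset_fg iota_inj HF HN).
exact: (mulset_sub_submodule sBS).
Qed.

(* In the proof, [k] is the infimum of the growth of [K0] under the [Z] that
   have a translate in [F]; the submodules [Z] met in the induction [step] are
   only known to be of that kind. *)
Lemma rdim_growth (M K0 : set RN) (V : set S) (e : K) :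
  fg M -> M `<=` B -> fg K0 -> K0 `<=` B -> Fhat F V -> 0 < e ->
  exists g (V1 : set S) (d : K), [/\ U g, F V1, 0 < d &
    forall C, Fhat F C -> F_invariant iota V1 d C ->
    p (mulset C (M : set N)) <=
    p (mulset C ((fun x : N => g *: x) @` (K0 : set N))) +
    ((p (addset (mulset V (M : set N) : set RN) K0) - p K0) /
      (dimS iota V)%:R + e)
      * (dimS iota C)%:R].
Proof.
move=> fM MB fK0 K0B hV e0;
  have [sM sK0] := (fg_submodule fM, fg_submodule fK0).
have FV := hV.1; have sV := F_submodule HN FV.
pose q (Z : set S) := p (addset (mulset Z (M : set N) : set RN) K0) - p K0.
pose v : K := (dimS iota V)%:R.
have v_gt0 : 0 < v by rewrite ltr0n; exact: (dimS_gt0 HF HN).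
have sMB (Z : set S) : (mulset Z (M : set N) : set RN) `<=` B by exact:
  (mulset_sub_submodule sBS).
have sq (Z : set S) : rsub Z ->
  submodule (addset (mulset Z (M : set N) : set RN) K0).
  by move=> sZ; apply: submodule_addset => //; exact: mulset_submodule.
have qB (Z : set S) : addset (mulset Z
  (M : set N) : set RN) K0 `<=` B by exact: addset_sub.
have fqV : fg (addset (mulset V (M : set N) : set RN) K0).
  by apply: fg_addset => //; exact: (mulset_fg iota_inj HF HN).
have q_ge0 (Z : set S) : rsub Z -> Z `<=` V -> 0 <= q Z.
  move=> sZ ZV; rewrite subr_ge0.
  have fin : addset (mulset Z (M : set N) : set RN) K0 `<=`
      addset (mulset V (M : set N) : set RN) K0.
    apply: addset_sub; first exact: sq.
      move=> x Zx; apply: addset_subl => //; exact: mulset_mono Zx.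
    by apply: addset_subr; exact: mulset_submodule.
  apply: fine_le.
  - exact: rdim_fin (@subset_refl _ _) fK0 K0B.
  - exact: rdim_fin (sq _ sZ) fin fqV (qB _).
  - apply: (dim_le_l Hdim).
    + by split.
    + by split=> //; exact: sq.
    + by apply: addset_subr; exact: mulset_submodule.
pose E := [set r : K | exists (Z : set S)
  (g : S), [/\ rsub Z, Z `<=` V, U g, Fhat F (lmulset g Z) &
  r = q Z / (dimS iota (lmulset g Z))%:R]].
have E_lb : lbound E 0.
  by move=> _ [Z [g [sZ ZV _ _ ->]]]; rewrite divr_ge0// q_ge0.
have EV : E (q V / v).
  by exists V, 1; split=> //; rewrite ?lmulset1//; exact: (ns_mul HN).1.
have E_inf : has_inf E by split; [exists (q V / v)|exists 0].
pose k := inf E.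
have k_lb r : E r -> k <= r by move=> Er; apply: ge_inf => //; exists 0.
have k_ge0 : 0 <= k by apply: lb_le_inf => //; exists (q V / v).
have kV : k <= q V / v by exact: k_lb.
(* This error is paid once per basis element of [C], multiplied by the rank of [V1], which is at
   most [v]; the total is at most [e / 2] times the rank of [C]. *)
pose eta := e / 2 / v.
have eta_gt0 : 0 < eta by rewrite !divr_gt0.
have [_ [Z0 [g0 [sZ0 Z0V Ug0 hZ0 ->]]] ltZ0] := inf_adherent eta_gt0 E_inf.
rewrite -/k in ltZ0.
set V1 := lmulset g0 Z0 in hZ0 ltZ0; have FV1 := hZ0.1.
have V1_gt0 : 0 < (dimS iota V1)%:R :> K by rewrite ltr0n;
  exact: (dimS_gt0 HF HN).
have qZ0 : q Z0 <= (k + eta) * (dimS iota V1)%:R.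
  by rewrite -ler_pdivrMr// ltW.
have V1v : (dimS iota V1)%:R <= v.
  have [Fg0V g0V] := F_lmulset iota_inj HF HN Ug0 FV.
  rewrite /v -g0V ler_nat; apply: (dimS_mono HF HN) => //.
  by move=> _ [z Z0z <-]; exists z => //; exact: Z0V.
have pM0 : 0 <= p M by exact: rdim_ge0.
(* Per unit of rank of [C], invariance up to [d] costs [d * k] through the rank of [C V1] and
   [d * p M] through the part of [C + C V1] outside [C V1]. The 1 keeps the denominator positive. *)
pose d := e / 2 / (k + p M + 1).
have kM : 0 < k + p M + 1 by lra.
have d_gt0 : 0 < d by rewrite !divr_gt0.
exists g0, V1, d; split=> // C hC invC.
have FC := hC.1.
pose Y := mulset C ((fun x : N => g0 *: x) @` (K0 : set N)).
have fg0K0 := smul_fg iota_inj HN Ug0 fK0.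
have g0K0B : ((fun x : N => g0 *: x) @` (K0 : set N)) `<=` B.
  by move=> _ [x K0x <-]; apply: submodZ => //; exact: K0B.
have fY : fg (Y : set RN) by exact: (mulset_fg iota_inj HF HN).
have YB : Y `<=` B by exact: (mulset_sub_submodule sBS).
have sY := fg_submodule fY.
have fZ0M : fg (mulset Z0 (M : set N) : set RN).
  by apply: (mulset_fg_smul iota_inj HF HN Ug0 FV1).
(* The core of the Petridis argument: the translates [c V1] are added one at a time, on top of [Y],
   which contains every [c g0 K0] with [c] in [C]. *)
have step n (c : 'I_n -> S) : (forall i, U (c i)) -> (forall i, C (c i)) ->
    p (addset (mulset (mulsetS (rgen c) V1) (M : set N) : set RN) Y) <=
    p Y + k * (dimS iota (mulsetS (rgen c) V1))%:R
      + eta * (dimS iota V1)%:R * n%:R.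
  elim: n c => [|n IHn] c Uc Cc.
    rewrite rgen0 /mulsetS !mulset0 (dimS_set0 HF) !mulr0 !addr0.
    apply: rdim_mono => //; first by apply: submodule_addset => //;
      exact: submodule_set0.
    by apply: addset_sub => // _ ->; exact: (submod0 sY).
  pose c' i := c (lift ord0 i).
  have sV1 := F_submodule HN FV1.
  have XE : mulsetS (rgen c) V1 = addset (lmulset (c ord0) V1) (mulsetS
    (rgen c') V1).
    by rewrite /mulsetS (mulset_rgen_recl iota_inj HN).
  rewrite XE.
  have IH := IHn c' (fun i => Uc _) (fun i => Cc _).
  set X' := mulsetS _ V1 in IH XE *.
  have FX' : F X'.
    by apply: (F_mulset iota_inj HF HN) => //; apply: (F_gen HF HN) => i;
      exact: Uc.
  have sX' := F_submodule HN FX'.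
  pose h := c ord0 * g0; have Uh : U h by exact: (U_mul HN).
  have hZ0E : lmulset (c ord0) V1 = lmulset h Z0.
    apply/seteqP; split=> [_ [_ [z Z0z <-] <-]|_ [z Z0z <-]].
      by exists z => //; rewrite mulrA.
    by exists (g0 * z); [exists z|rewrite mulrA].
  have [FcV1 cV1] := F_lmulset iota_inj HF HN (Uc ord0) FV1.
  (* Here [h Z] is the overlap of the new translate with what is already built. The modular law
     subtracts its rank, and the definition of [k] supplies the matching lower bound for [q Z]. *)
  pose Z := [set z | Z0 z /\ X' (h * z)].
  have sZ : rsub Z.
    have [s [_ hs _]] := sigma_rmorphism iota_inj HN Uh.
    apply: submodule_intro.
    - by split; [exact: (submod0 sZ0)|rewrite mulr0; exact: (submod0 sX')].
    - move=> x y [Zx Xx] [Zy Xy]; split; first exact: (submodD sZ0).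
      by rewrite mulrDr; exact: (submodD sX').
    - move=> a x [Zx Xx]; split; first exact: (submodZ a sZ0).
      have -> : h * (a *: (x : restr iota S^o)) = iota (s a) * (h * x).
        by rewrite -[a *: _]/(iota a * x) mulrA hs mulrA.
      exact: (submodZ (s a) sX').
  have hZE : lmulset h Z = lmulset h Z0 `&` X'.
    apply/seteqP; split=> [_ [z [Z0z Xz] <-]|_ [[z Z0z <-] Xz]].
      by split=> //; exists z.
    by exists z.
  have FhZ : F (lmulset h Z).
    by rewrite hZE -hZ0E; apply: (fas_cap HF).
  have kZ : k * (dimS iota (lmulset h Z))%:R <= q Z.
    have ZV : Z `<=` V by move=> z [/Z0V].
    (* A zero translate gives no element of [E], but then the bound is just [q Z >= 0]. *)
    have [hZ0'|hZn0] := eqVneq (lmulset h Z) [set 0].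
      by rewrite hZ0' (dimS_set0 HF) mulr0; exact: q_ge0.
    rewrite -ler_pdivlMr ?ltr0n ?(dimS_gt0 HF HN)//.
    by apply: k_lb; exists Z, h.
  have fX'M : fg (mulset X' (M : set N) : set RN) by exact:
    (mulset_fg iota_inj HF HN).
  have fA1' := fg_addset fX'M fY.
  have fA2 := fg_addset fZ0M fK0.
  have A1'B : addset (mulset X'
    (M : set N) : set RN) Y `<=` B by exact: addset_sub.
  have A12 : addset (mulset Z (M : set N) : set RN) K0 `<=`
      addset (mulset Z0 (M : set N) : set RN) K0.
    apply: addset_sub; first exact: sq.
      move=> x Zx; apply: addset_subl => //; apply: mulset_mono Zx => //.
      by move=> z [].
    by apply: addset_subr; exact: mulset_submodule.
  (* The part [h Z M] falls into [X' M] by the choice of [Z], and [h K0 = c g0 K0] into [Y] because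
     [c] lies in [C]. *)
  have hA1 : ((fun x : N => h *: x) @` (addset (mulset Z
    (M : set N) : set RN) K0))
      `<=` addset (mulset X' (M : set N) : set RN) Y.
    move=> _ [_ [x Zx [y K0y <-]] <-]; rewrite [h *: _]scalerDr;
      exists (h *: x).
      have : ((fun x : N => h *: x) @` mulset Z (M : set N)) (h *:
        (x : N)) by exists x.
      rewrite -mulset_smul; apply: mulset_mono => //.
      by rewrite hZE => ? [].
    exists (h *: (y : N)) => //; rewrite /h -scalerA; apply: mulset_in => //.
    by exists y.
  have := rdim_smul Uh (sq _ sZ) fA2 A12 (qB _) fA1' A1'B hA1.
  set T := addset (_ @` _) _ => leT.
  have fT : fg T.
    by apply: fg_addset => //; exact: (smul_fg iota_inj HN).
  have TB : T `<=` B.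
    apply: addset_sub => // _ [x xA2 <-]; apply: submodZ => //; exact: qB xA2.
  have sT := fg_submodule fT.
  have leXT : p (addset (mulset (addset (lmulset (c ord0) V1) X')
    (M : set N) : set RN) Y)
      <= p T.
    have sA1' := fg_submodule fA1'.
    have sub1 : addset (mulset X' (M : set N) : set RN) Y `<=` T.
      apply: addset_subr.
      apply: (smul_submodule iota_inj HN Uh); exact: fg_submodule fA2.
    have sXX : rsub (addset (lmulset (c ord0) V1) X').
      by apply: (@submodule_addset _ (restr iota S^o)) => //;
        exact: (F_submodule HN).
    apply: rdim_mono => //.
      by apply: submodule_addset => //; exact: mulset_submodule.
    apply: addset_sub => //; last first.
      by apply: subset_trans sub1; apply: addset_subr; exact: fg_submodule fX'M.
    rewrite (mulset_addset (iota := iota))//; last exact: (F_submodule HN).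
    apply: addset_sub => //; last first.
      by apply: subset_trans sub1; apply: addset_subl.
    rewrite hZ0E mulset_smul => x hx.
    apply: addset_subl => //; case: hx => z Z0z <-; exists z => //.
    exact: addset_subl.
  have dimX : (dimS iota (addset (lmulset (c ord0) V1) X'))%:R =
      (dimS iota V1)%:R + (dimS iota X')%:R - (dimS iota (lmulset h Z))%:R :> K.
    have := dimS_modular HF HN FcV1 FX'.
    rewrite cV1 hZ0E -hZE => /(congr1 (fun n => n%:R : K)); rewrite !natrD.
    by move=> E1; rewrite -E1 addrK.
  rewrite dimX -natr1.
  have k1 : k * ((dimS iota V1)%:R + (dimS iota X')%:R - (dimS iota
    (lmulset h Z))%:R)
    = k * (dimS iota V1)%:R + k * (dimS iota X')%:R - k * (dimS iota
      (lmulset h Z))%:R.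
    by rewrite mulrBr mulrDr.
  rewrite k1 mulrDr mulr1; move: qZ0 kZ leT leXT IH; rewrite /q mulrDl; lra.
have [n [c [Uc CE nE]]] := F_gen_basis HF HN FC.
have Cc i : C (c i) by rewrite CE; apply: sub_gen; exists i.
have := step n c Uc Cc; rewrite -CE nE.
set X := mulsetS C V1.
have FX : F X by exact: (F_mulset iota_inj HF HN).
have FCX : F (addset C X) by exact: (fas_add HF).
have [sX sC] := (F_submodule HN FX, F_submodule HN FC).
have sCX := F_submodule HN FCX.
have subC : C `<=` addset C X by exact: (@addset_subl _ (restr iota S^o)).
have subX : X `<=` addset C X by exact: (@addset_subr _ (restr iota S^o)).
(* [V1] need not contain 1, so [C] need not lie in [X = C V1] and the comparison goes through
   [C + X]. As [X] has at least the rank of [C], invariance leaves at most [d] times the rank of [C]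
   outside [X]. *)
have CX : (dimS iota C)%:R <= (dimS iota X)%:R :> K.
  by rewrite ler_nat; exact: (dimS_mulset_ge iota_inj HF HN).
have XCX : (dimS iota X)%:R <= (dimS iota (addset C X))%:R :> K.
  by rewrite ler_nat; exact: (dimS_mono HF HN).
have invC' : (dimS iota (addset C X))%:R <= (1 + d) *
  (dimS iota C)%:R :> K by exact: invC.
have i1 := rdim_mulset_sub FX FCX subX fM MB.
have fXM : fg (mulset X (M : set N) : set RN) by exact:
  (mulset_fg iota_inj HF HN).
have fCXM : fg (mulset (addset C X) (M : set N) : set RN).
  exact: (mulset_fg iota_inj HF HN).
have i2 : p (mulset C (M : set N)) <= p (mulset (addset C X) (M : set N)).
  apply: rdim_mono => //; first exact: mulset_submodule.
  exact: (@mulset_mono S N C _ M M subC (@subset_refl _ _)).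
have i3 : p (mulset X (M : set N)) <= p (addset (mulset X
  (M : set N) : set RN) Y).
  apply: rdim_mono => //; first exact: mulset_submodule.
  - exact: addset_subl.
  - exact: fg_addset.
  - exact: addset_sub.
move=> i4; rewrite -/(q V) -/v.
have i5 : eta * (dimS iota V1)%:R <= e / 2.
  by rewrite /eta mulrAC -mulrA ler_piMr ?ler_pdivrMr ?mul1r// divr_ge0// ltW.
have C0 : 0 <= (dimS iota C)%:R :> K by [].
have i6 : d * (k + p M + 1) = e / 2 by rewrite /d divfK// gt_eqF.
set dC : K := (dimS iota C)%:R in CX invC' i1 i4 C0 *.
set dX : K := (dimS iota X)%:R in CX XCX i1 i4 *.
set dCX : K := (dimS iota (addset C X))%:R in XCX invC' i1 *.
have i7 : k * dX <= k * ((1 + d) * dC) by apply: ler_wpM2l => //;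
  exact: le_trans invC'.
have i8 : (dCX - dX) * p M <= d * dC * p M by apply: ler_wpM2r => //; lra.
have i9 : eta * (dimS iota V1)%:R * dC <= e / 2 * dC by exact: ler_wpM2r.
have i10 : k * dC <= q V / v * dC by exact: ler_wpM2r.
have i11 : d * (k + p M) * dC <= e / 2 * dC by apply: ler_wpM2r => //;
  rewrite -i6; lra.
have i12 : k * ((1 + d) * dC) = k * dC + d * k * dC by ring.
have i13 : d * (k + p M) * dC = d * k * dC + d * dC * p M by ring.
have i14 : (q V / v + e) * dC = q V / v * dC + e / 2 * dC + e / 2 * dC.
  by rewrite [X in (_ + X) * _]splitr !mulrDl addrA.
rewrite i14; lra.
Qed.

End FixedModule.

#[local] Instance inv_filterP : ProperFilter (inv_filter K iota F) :=
  inv_filter_proper iota_inj Hra HN.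

(** Real-valued through [fine], which loses nothing when [A] is a finitely generated [R]-submodule
    of an [S]-submodule [B] and [W] is in [F], as the numerator is then finite. *)
Definition mean_dim (N : lmodType S) (A B : set N) (W : set S) : K :=
  fine (dim (mulset W A : set (restr iota N)) (B : set (restr iota N))) /
    (dimS iota W)%:R.

(** The limit is introduced as an infimum, so that any single [W] bounds it from above; convergence
    is [mean_dim_cvg]. *)
Definition lim_dim (N : lmodType S) (A B : set N) : K :=
  inf [set mean_dim A B W | W in Fhat F].

Lemma dimS_gt0K W : Fhat F W -> 0 < (dimS iota W)%:R :> K.
Proof. by move=> hW; rewrite ltr0n (dimS_gt0 HF HN). Qed.

Lemma Fhat_nonempty : Fhat F !=set0.
Proof. by have [W hW _] := Fhat_ex iota_inj Hra HN (F_set0 HF HN) ltr01;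
  exists W. Qed.

(** * Convergence of mean dimensions *)

Section FixedModule.
Context (N : lmodType S) (B : set N).
Hypothesis sBS : submodule B.
Let sB := submodule_restr iota sBS.
Let RN : lmodType R := restr iota N.
Implicit Types (A : set RN).

Lemma mulset_fgB A W : fg A -> A `<=` B -> F W ->
  [/\ fg (mulset W (A : set N) : set RN), mulset W (A : set N) `<=` B &
      subpair (mulset W (A : set N) : set RN) B].
Proof.
move=> fA AB FW; have fW := mulset_fg iota_inj HF HN FW fA.
have WB : mulset W (A : set N) `<=` B by exact: (mulset_sub_submodule sBS).
by split=> //; split=> //; exact: fg_submodule fW.
Qed.

Lemma mean_dim_ge0 A W : fg A -> A `<=` B -> F W ->
  0 <= mean_dim (A : set N) B W.
Proof.
move=> fA AB FW; have [_ _ sWB] := mulset_fgB fA AB FW.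
by rewrite divr_ge0//; apply: fine_ge0; exact: (bmr_ge0 Hdim).
Qed.

Lemma lim_dim_le A W : fg A -> A `<=` B -> Fhat F W ->
  lim_dim (A : set N) B <= mean_dim (A : set N) B W.
Proof.
move=> fA AB hW; apply: ge_inf; last by exists W.
by exists 0 => _ [V hV <-]; apply: mean_dim_ge0 => //; exact: hV.1.
Qed.

Lemma lim_dim_ge0 A : fg A -> A `<=` B -> 0 <= lim_dim (A : set N) B.
Proof.
move=> fA AB; apply: lb_le_inf.
  by have [W hW] := Fhat_nonempty; exists (mean_dim (A : set N) B W), W.
by move=> _ [V hV <-]; apply: mean_dim_ge0 => //; exact: hV.1.
Qed.

Lemma rdim_growth_near (M K0 : set RN) (V : set S) (e : K) :
  fg M -> M `<=` B -> fg K0 -> K0 `<=` B -> Fhat F V -> 0 < e ->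
  exists2 g, U g &
    \forall C \near inv_filter K iota F,
    mean_dim (M : set N) B C <= mean_dim ((fun x : N => g *: x) @`
      (K0 : set N)) B C +
    ((fine (dim (addset (mulset V (M : set N) : set RN) K0) B) - fine
      (dim K0 B))
      / (dimS iota V)%:R + e).
Proof.
move=> fM MB fK0 K0B hV e0.
have [g [V1 [d [Ug FV1 d0 h]]]] :=
  rdim_growth sBS fM MB fK0 K0B hV e0.
exists g => //; exists V1, d; split=> // C hC inv.
have C0 := dimS_gt0K hC.
by rewrite /mean_dim ler_pdivrMr// mulrDl divfK ?gt_eqF//; exact: h.
Qed.

(** The growth estimate with [K0] zero, applied to a [V] whose mean dimension is within [e / 2] of
    the infimum. *)
Lemma lim_dim_near A e : fg A -> A `<=` B -> 0 < e ->
  \forall W \near inv_filter K iota F, mean_dim (A : set N) B W <= lim_dim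
    (A : set N) B + e.
Proof.
move=> fA AB e0; have e20 : 0 < e / 2 by rewrite divr_gt0.
have inf_psi : has_inf [set mean_dim (A : set N) B W | W in Fhat F].
  split; first by have [W hW] := Fhat_nonempty;
    exists (mean_dim (A : set N) B W), W.
  by exists 0 => _ [V hV <-]; apply: mean_dim_ge0 => //; exact: hV.1.
have [_ [V hV <-] ltV] := inf_adherent e20 inf_psi.
have z0B : [set 0 : RN] `<=` B by move=> _ ->; exact: (submod0 sB).
have [g Ug gnear] := rdim_growth_near fA AB (@fg_set0 _ RN) z0B hV e20.
apply: filterS gnear => C; rewrite -/(lim_dim _ _) in ltV.
have -> : (fun x : N => g *: x) @` [set 0] = [set 0 : N].
  by rewrite image_set1 scaler0.
rewrite {2}/mean_dim mulset_set0 (rdim_set0 sBS) mul0r add0r subr0.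
have -> : addset (mulset V (A : set N) : set RN) [set 0] = mulset V (A : set N).
  apply/seteqP; split=> [_ [x Vx [_ -> <-]]|x Vx]; first by rewrite addr0.
  by exists x => //; exists 0 => //; rewrite addr0.
move=> h; apply: (le_trans h); rewrite [in leRHS](splitr e) addrA lerD2r ltW//.
Qed.

(** A single [V] in [F] has [A] inside [V A'], so [W A] lies in [(W + W V) A'], and for invariant
    [W] the Lipschitz bound makes the excess over [W A'] small. Used in both directions, this gives
    independence of the generators. *)
Lemma lim_dim_mono A A' : fg A -> fg A' -> A' `<=` B ->
  A `<=` gen (A' : set N) ->
  lim_dim (A : set N) B <= lim_dim (A' : set N) B.
Proof.
move=> fA fA' A'B AA'.
have AB : A `<=` B by exact: subset_trans AA' (gen_sub sBS A'B).
have [n [w AE]] := fg_ex fA.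
have [V FV wV] : exists2 V, F V & forall i, mulset V (A' : set N) (w i).
  have h i : exists2 V, F V & mulset V (A' : set N) (w i).
    have : gen (A' : set N) (w i).
      by apply: AA'; rewrite AE -gen_rangeE; apply: sub_gen; exists i.
    rewrite (gen_mulset iota) => -[k [a [x [_ hx xE]]]].
    have [V FV aV] := F_finite HF (finite_range a).
    by exists V => //; exists k, a, x; split=> // j; apply: aV; exists j.
  elim: n w {AE} h => [|n IHn] w h; first by exists [set 0];
    [exact: F_set0 HF HN|case].
  have [V FV hV] := IHn (w \o lift ord0) (fun i => h _).
  have [V' FV' hV'] := h ord0.
  have [sV sV'] := (F_submodule HN FV, F_submodule HN FV').
  exists (addset V V'); first exact: (fas_add HF).
  move=> i; case: (unliftP ord0 i) => [j ->|->].
    apply: (mulset_mono _ (@subset_refl _ (A' : set N))) (hV j).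
    exact: (@addset_subl _ (restr iota S^o)).
  apply: (mulset_mono _ (@subset_refl _ (A' : set N))) hV'.
  exact: (@addset_subr _ (restr iota S^o)).
have sV := F_submodule HN FV.
have AV : A `<=` mulset V (A' : set N).
  rewrite AE -gen_rangeE; apply: gen_sub; first exact: mulset_submodule.
  by move=> _ [i _ <-].
set q := fine (dim A' B).
have q0 : 0 <= q.
  by apply: fine_ge0; apply: (bmr_ge0 Hdim); split=> //; exact: fg_submodule.
apply/ler_addgt0Pr => e e0.
have e20 : 0 < e / 2 by rewrite divr_gt0.
have q1 : 0 < q + 1 by lra.
(* The excess rank is at most [d] times that of [W], each unit costing at most [q]; the 1 allows for
   [q = 0]. *)
pose d := e / 2 / (q + 1); have d0 : 0 < d by rewrite divr_gt0.
have Vnear : \forall W \near inv_filter K iota F, F_invariant iota V d W.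
  by exists V, d; split.
have [W [[hW invW] psiW]] := filter_ex (filterI
  (filterI (inv_filter_Fhat Hra HN) Vnear) (lim_dim_near fA' A'B e20)).
have FW := hW.1; have sW := F_submodule HN FW.
have W0 := dimS_gt0K hW.
apply: (le_trans (lim_dim_le fA AB hW)).
have FWV : F (mulsetS W V) by exact: (F_mulset iota_inj HF HN).
have FX : F (addset W (mulsetS W V)) by exact: (fas_add HF).
set X := addset _ _ in FX; have sX := F_submodule HN FX.
have WX : W `<=` X.
  by apply: (@addset_subl _ (restr iota S^o)); exact: (F_submodule HN).
have i1 := rdim_mulset_sub sBS FW FX WX fA' A'B.
have [fXA XAB sXA] := mulset_fgB fA' A'B FX.
have [fWA WAB sWA] := mulset_fgB fA AB FW.
have WAX : mulset W (A : set N) `<=` mulset X (A' : set N).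
  apply: subset_trans (mulset_mono (@subset_refl _ W) AV) _.
  rewrite -(mulsetA (iota := iota))//; apply: mulset_mono => //.
  exact: (@addset_subr _ (restr iota S^o)).
have sWA' : submodule (mulset W (A : set N) : set RN) by case: sWA.
have i2 := rdim_mono sBS sWA' WAX fXA XAB.
have i3 : (dimS iota X)%:R <= (1 + d) * (dimS iota W)%:R :> K by exact: invW.
rewrite [in leRHS](splitr e) addrA; apply: le_trans (lerD psiW (lexx _)).
rewrite /mean_dim ler_pdivrMr// mulrDl divfK ?gt_eqF//; apply: (le_trans i2).
apply: (le_trans i1); rewrite lerD2l.
have i4 : ((dimS iota X)%:R - (dimS iota W)%:R) * q <= d * (dimS iota W)%:R * q.
  by apply: ler_wpM2r => //; lra.
apply: (le_trans i4).
have -> : e / 2 = d * (q + 1) by rewrite divfK// gt_eqF.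
rewrite mulrAC ler_pM2r// ler_pM2l//; lra.
Qed.

Lemma mean_dim_cvg A : fg A -> A `<=` B ->
  mean_dim (A : set N) B @ inv_filter K iota F --> lim_dim (A : set N) B.
Proof.
move=> fA AB; apply/cvgrPdist_le => e e0.
near=> W; have hW : Fhat F W by near: W; exact: (inv_filter_Fhat Hra HN).
rewrite ler0_norm; last by rewrite subr_le0; exact: lim_dim_le.
rewrite opprB lerBlDl; near: W; exact: lim_dim_near.
Unshelve. all: by end_near. Qed.

Lemma lim_dim_cvg A : fg A -> A `<=` B ->
  (fun W => dim (mulset W (A : set N) : set RN) B * ((dimS iota W)%:R^-1)%:E)%E
    @ inv_filter K iota F --> (lim_dim (A : set N) B)%:E.
Proof.
move=> fA AB; have psi_cvg := mean_dim_cvg fA AB.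
have fin W : Fhat F W -> dim (mulset W (A : set N) : set RN) B \is a fin_num.
  move=> hW; have [fW WB sWB] := mulset_fgB fA AB hW.1.
  by apply: (rdim_fin sBS (A' := mulset W (A : set N))) => //; case: sWB.
apply: cvg_EFin.
  near=> W; have hW : Fhat F W by near: W; exact: (inv_filter_Fhat Hra HN).
  by rewrite fin_numM// fin.
apply: cvg_trans psi_cvg; apply: near_eq_cvg; near=> W.
have hW : Fhat F W by near: W; exact: (inv_filter_Fhat Hra HN).
by rewrite /= /mean_dim fineM// fin.
Unshelve. all: by end_near. Qed.

(** [dimF_fg] chooses a common limit for all generating submodules, with default 0. By
    [lim_dim_mono] one number serves for all of them, so the choice succeeds; uniqueness of limits
    identifies the chosen value. *)
Lemma dimF_fgE A : fg A -> A `<=` B ->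
  dimF_fg iota F dim (gen (A : set N)) B = (lim_dim (A : set N) B)%:E.
Proof.
move=> fA AB; apply/esym; rewrite /dimF_fg;
  case: xgetP => [L _ /=|/(_ (lim_dim (A : set N) B)%:E)/=[]].
  move=> /(_ A (fg_submodule fA) fA erefl) hL.
  exact: (cvg_unique _ (lim_dim_cvg fA AB) hL).
move=> A' sA' fA' A'E.
have A'B : A' `<=` B.
  apply: subset_trans (_ : gen (A' : set N) `<=` _);
    first exact: (@sub_gen S N A').
  by rewrite A'E; exact: (gen_sub sBS AB).
suff -> : lim_dim (A : set N) B = lim_dim (A' : set N) B by exact: lim_dim_cvg.
apply/le_anti/andP; split; apply: lim_dim_mono => //.
  by rewrite A'E; exact: (@sub_gen S N A).
by rewrite -A'E; exact: (@sub_gen S N A').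
Qed.

End FixedModule.

(** * The axioms of a bivariant rank function for [dimF] *)

Local Notation dimF := (dimF iota F dim).
Local Notation dimF_fg := (dimF_fg iota F dim).
Local Notation rfg N A := (fg (A : set (restr iota N))).

Section FixedModule.
Context (N : lmodType S) (B : set N).
Hypothesis sB : submodule B.
Implicit Types (A M : set N).

Lemma lim_dim_fg M : rfg N M -> M `<=` B ->
  dimF_fg (gen M) B = (lim_dim M B)%:E.
Proof. exact: (dimF_fgE sB). Qed.

Lemma dimF_ge A M : rfg N M -> M `<=` A -> submodule A -> A `<=` B ->
  ((lim_dim M B)%:E <= dimF A B)%E.
Proof.
move=> fM MA sA AB; rewrite -lim_dim_fg//; last exact: subset_trans AB.
apply: ereal_sup_ubound; exists (gen M) => //; split.
- exact: gen_submodule.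
- exact: fg_gen fM.
- exact: gen_sub.
Qed.

Lemma dimF_le A z : submodule A -> A `<=` B ->
  (forall M, rfg N M -> M `<=` A -> ((lim_dim M B)%:E <= z)%E) ->
    (dimF A B <= z)%E.
Proof.
move=> sA AB h; apply: ge_ereal_sup => _ [A1 [sA1 /(fg_gen_restr iota)[M [fM
  A1E]] A1A] <-].
have MA : M `<=` A by apply: subset_trans A1A; rewrite A1E; exact: sub_gen.
by rewrite A1E lim_dim_fg//; [exact: h|exact: subset_trans AB].
Qed.

Lemma dimF_gen M : rfg N M -> M `<=` B -> dimF (gen M) B = (lim_dim M B)%:E.
Proof.
move=> fM MB; have gB : gen M `<=` B by exact: gen_sub.
apply/le_anti/andP; split; last first.
  by apply: dimF_ge => //; [exact: sub_gen|exact: gen_submodule].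
apply: dimF_le => //; first exact: gen_submodule.
by move=> M' fM' M'M; rewrite lee_fin; apply: (lim_dim_mono sB).
Qed.

Lemma dimF_fg_eq A : fg A -> A `<=` B -> dimF A B = dimF_fg A B.
Proof.
move=> /(fg_gen_restr iota)[M [fM ->]] MB.
have MB' : M `<=` B by apply: subset_trans MB; exact: sub_gen.
by rewrite dimF_gen// lim_dim_fg.
Qed.

End FixedModule.

Lemma mulset_dim_fin (N : lmodType S) (B M : set N) W : submodule B ->
  rfg N M ->
  M `<=` B -> Fhat F W ->
  [/\ rfg N (mulset W M), mulset W M `<=` B,
     subpair (mulset W M : set (restr iota N)) (B : set (restr iota N)) &
     dim (mulset W M : set (restr iota N)) (B : set
       (restr iota N)) \is a fin_num].
Proof.
move=> sB fM MB hW; have [fW WB sWB] := mulset_fgB sB fM MB hW.1.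
split=> //; apply: (rdim_fin sB (A' := mulset W M)) => //.
by case: sWB.
Qed.

Lemma lim_dim_eq (N N' : lmodType S) (M B : set N) (M' B' : set N') :
  (forall W, Fhat F W -> mean_dim M B W = mean_dim M' B' W) ->
    lim_dim M B = lim_dim M' B'.
Proof. by move=> h; congr inf; apply/eq_imagel. Qed.

Lemma dimF_bmr_ge0 (N : lmodType S) (A B : set N) : subpair A B ->
  (0 <= dimF A B)%E.
Proof.
move=> [sA sB AB].
have z : [set 0] `<=` A by move=> _ ->; exact: submod0.
apply: le_trans (dimF_ge sB (@fg_set0 _ _) z sA AB).
rewrite lee_fin; apply: (lim_dim_ge0 sB) => //; first exact: fg_set0.
exact: subset_trans AB.
Qed.

Lemma dimF_iso_le (N N' : lmodType S) (A B : set N) (A' B' : set N')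
  (f : N -> N') :
  subpair A B -> subpair A' B' -> linear_on B f ->
  set_bij B B' f -> f @` A = A' -> (dimF A B <= dimF A' B')%E.
Proof.
move=> [sA sB AB] [sA' sB' AB'] fl fb fA.
apply: dimF_le => // M fM MA; have MB := subset_trans MA AB.
have flR : linear_on (B : set (restr iota N))
  (f : restr iota N -> restr iota N').
  by move=> a u v Bu Bv; exact: fl.
have ffM : rfg N' (f @` M).
  have [n [w ME]] := fg_ex fM;
    rewrite ME (image_lspan_on (submodule_restr iota sB) flR).
    exact: fg_lspan.
  by move=> i; apply: MB; rewrite ME -gen_rangeE; apply: sub_gen; exists i.
have fMA : f @` M `<=` A' by rewrite -fA; exact: image_subset.
suff -> : lim_dim M B = lim_dim (f @` M) B' by exact: dimF_ge.
apply: lim_dim_eq => W hW; congr (fine _ / _).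
have [_ _ s1 _] := mulset_dim_fin sB fM MB hW.
have [_ _ s2 _] := mulset_dim_fin sB' ffM (subset_trans fMA AB') hW.
apply: (bmr_iso Hdim s1 s2 flR fb).
exact: (image_mulset_on sB fl W MB).
Qed.

Lemma dimF_bmr_iso (N N' : lmodType S) (A B : set N) (A' B' : set N')
  (f : N -> N') :
  subpair A B -> subpair A' B' -> linear_on B f ->
  set_bij B B' f -> f @` A = A' -> dimF A B = dimF A' B'.
Proof.
move=> sAB sAB' fl fb fA; have [[sA sB AB] [sA' sB' AB']] := (sAB, sAB').
apply/le_anti/andP; split; first exact: dimF_iso_le fl fb fA.
have [fB fi fs] := fb.
have fB' x : B x -> B' (f x) by exact: fB.
(* The inverse of [f] on [B']; outside [B'] the condition is vacuous. *)
have /choice[g gE] : forall y, exists x, B' y -> B x /\ f x = y.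
  move=> y; have [B'y|nB'y] := pselect (B' y); last by exists 0.
  by have [x Bx xE] := fs _ B'y; exists x.
have inj x y : B x -> B y -> f x = f y -> x = y.
  by move=> Bx By; apply: fi; exact/mem_set.
have gK x : B x -> g (f x) = x.
  by move=> Bx; have [Bg fg] := gE _ (fB' _ Bx); apply: inj.
apply: (dimF_iso_le (f := g) sAB' sAB).
- move=> a u v B'u B'v.
  have [[Bu fu] [Bv fv]] := (gE _ B'u, gE _ B'v).
  have B'w : B' (a *: u + v) by apply: submodD => //; exact: submodZ.
  have [Bw fw] := gE _ B'w; apply: inj => //.
    by apply: submodD => //; exact: submodZ.
  by rewrite fw fl// fu fv.
- split.
  + by move=> y /gE[].
  + move=> x y /set_mem B'x /set_mem B'y gxy.
    by rewrite -(proj2 (gE _ B'x)) gxy (proj2 (gE _ B'y)).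
  + by move=> x Bx; exists (f x); [exact: fB'|exact: gK].
- rewrite -fA; apply/seteqP; split=> [_ [_ [x Ax <-] <-]|x Ax].
    by rewrite gK//; exact: AB.
  by exists (f x); [exists x|rewrite gK//; exact: AB].
Qed.

Lemma lim_dim_set0 (N : lmodType S) (B : set N) : submodule B ->
  lim_dim [set 0] B = 0.
Proof.
move=> sB; have [W hW] := Fhat_nonempty.
have z : [set 0] `<=` B by move=> _ ->; exact: submod0.
apply/le_anti; rewrite (lim_dim_ge0 sB (@fg_set0 _ _) z) andbT.
apply: le_trans (lim_dim_le sB (@fg_set0 _ _) z hW) _.
by rewrite /mean_dim mulset_set0 (rdim_set0 sB) mul0r.
Qed.

Lemma dimF_bmr_0 (N : lmodType S) : dimF [set 0 : N] [set 0] = 0%E.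
Proof.
have s0 := @submodule_set0 _ N.
rewrite -[in LHS](gen_id s0) {2}gen_id// dimF_gen//; last exact: fg_set0.
by rewrite lim_dim_set0.
Qed.

(** Any finitely generated submodule of [S] lies in some [W + V] in [F], where [W] has a complement;
    so [W] is locally a summand of [S]. *)
Lemma dim_F_setT W : F W ->
  dim (W : set (restr iota S^o)) setT = (dimS iota W)%:R%:E.
Proof.
move=> FW; have sW := F_submodule HN FW.
have [n [w [_ bw]]] := F_basis HN FW.
have fW : rfg S^o W by rewrite bw.2 gen_rangeE; exact: fg_lspan.
rewrite /dimS (frank_basis (fas_IBN HF) bw) -(dim_basis Hrk Hdim Hcor bw).
apply: (dim_summand Hdim) => //; first exact: submoduleT.
move=> B1 fB1 _; have [V FV B1V] := fas_fg HF (fg_submodule fB1) fB1.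
have FWV := fas_add HF FW FV; have sV := F_submodule HN FV.
have WWV : W `<=` addset W V by exact: (@addset_subl _ (restr iota S^o)).
have [C [FC WVE cap]] := fas_compl HF FW FWV WWV.
exists C; split=> //; first exact: (F_submodule HN).
apply: subset_trans B1V _; rewrite [addset _ _](_ : _ = addset W V).
  exact: (@addset_subr _ (restr iota S^o)).
by rewrite WVE.
Qed.

(** [R] generates [S] over [S], and [W R = W] has dimension its rank, so the mean dimension is
    constantly 1. *)
Lemma dimF_bmr_1 : dimF [set: S^o] setT = 1%E.
Proof.
have sT := submoduleT S^o.
have TE : setT = gen (Rmul iota 1 : set S^o).
  apply/seteqP; split=> // x _; rewrite -[x]mulr1.
  apply: (submodZ x (gen_submodule _)); apply: sub_gen.
  by exists 1 => //; rewrite rmorph1 mul1r.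
have fR : rfg S^o (Rmul iota 1).
  have FR := ns_Rg HN (ns_mul HN).1.
  by have [n [w [_ bw]]] := F_basis HN FR; rewrite bw.2 gen_rangeE;
    exact: fg_lspan.
rewrite {1}TE dimF_gen//; congr EFin.
have psi1 W : Fhat F W -> mean_dim (Rmul iota 1 : set S^o) setT W = 1.
  move=> hW; rewrite /mean_dim.
  have -> : mulset W (Rmul iota 1 : set S^o) = W.
    have sW := F_submodule HN hW.1.
    apply/seteqP; split=> [|w Ww].
      apply: (@mulset_sub _ _ iota S^o) => // w _ Ww [a _ <-].
      have -> : w *: (iota a * 1 : S^o) = w * iota a by rewrite mulr1.
      by apply: (F_mulr iota_inj Hra HN) => //; exact: hW.1.
    rewrite -[w]mulr1; apply: (@mulset_in S S^o) => //.
    by exists 1 => //; rewrite rmorph1 mul1r.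
  by rewrite dim_F_setT ?divff//; [rewrite gt_eqF//;
    exact: (dimS_gt0K)|exact: hW.1].
rewrite /lim_dim [X in inf X](_ : _ = [set 1]) ?inf1//.
apply/seteqP; split=> [_ [W hW <-]|_ ->]; first exact: psi1.
by have [W hW] := Fhat_nonempty; exists W => //; exact: psi1.
Qed.

Lemma dimF_sup (N : lmodType S) (A B : set N) : submodule A -> submodule B ->
  A `<=` B ->
  dimF A B = ereal_sup [set r | exists M, [/\ rfg N M, M `<=` A & r =
    (lim_dim M B)%:E]].
Proof.
move=> sA sB AB; apply/le_anti/andP; split.
  apply: (dimF_le sB) => // M fM MA.
  by apply: ereal_sup_ubound; exists M.
apply: ge_ereal_sup => _ [M [fM MA ->]].
exact: (dimF_ge sB).
Qed.

Lemma dimF_add_le (N N' : lmodType S) (A B : set N) (A' B' : set N')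
  (z : \bar K) :
  subpair A B -> subpair A' B' ->
  (forall M M', rfg N M -> M `<=` A -> rfg N' M' -> M' `<=` A' ->
    ((lim_dim M B + lim_dim M' B')%:E <= z)%E) ->
  (dimF A B + dimF A' B' <= z)%E.
Proof.
move=> [sA sB AB] [sA' sB' AB'] h; rewrite !dimF_sup//; apply: ereal_sup_add_le.
- exists (lim_dim [set 0] B)%:E, [set 0]; split=> //; first exact: fg_set0.
  by move=> _ ->; exact: (submod0 sA).
- exists (lim_dim [set 0] B')%:E, [set 0]; split=> //; first exact: fg_set0.
  by move=> _ ->; exact: (submod0 sA').
- by move=> _ [M [_ _ ->]].
- by move=> _ [M [_ _ ->]].
- by move=> _ _ [M [fM MA ->]] [M' [fM' MA' ->]]; exact: h.
Qed.

Lemma fg_setX (N N' : lmodType S) (M : set N) (M' : set N') : rfg N M ->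
  rfg N' M' ->
  fg (M `*` M' : set (restr iota (N * N')%type)).
Proof.
move=> fM fM'.
pose i1 (x : restr iota N) : restr iota (N * N')%type := (x, 0).
pose i2 (x : restr iota N') : restr iota (N * N')%type := (0, x).
have l1 : linear i1.
  by move=> a u v; rewrite [RHS]surjective_pairing; congr pair;
    rewrite /= ?scaler0 ?addr0.
have l2 : linear i2.
  by move=> a u v; rewrite [RHS]surjective_pairing; congr pair;
    rewrite /= ?scaler0 ?addr0.
have := fg_addset (fg_image l1 fM) (fg_image l2 fM').
congr fg; apply/seteqP;
  split=> [_ [_ [x Mx <-] [_ [y My <-] <-]]|[x y] [/= Mx My]].
  by split; rewrite /= ?addr0 ?add0r.
exists (i1 x); first by exists x.
by exists (i2 y); [exists y|congr pair; rewrite /= ?addr0 ?add0r].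
Qed.

(** Zero must lie in both factors: two sums of different lengths are joined through the pairs
    [(v, 0)] and [(0, v')]. *)
Lemma mulset_setX (N N' : lmodType S) (W : set S) (M : set N) (M' : set N') :
  submodule (W : set (restr iota S^o)) -> M 0 -> M' 0 ->
  mulset W (M `*` M') = mulset W M `*` mulset W M'.
Proof.
move=> sW M0 M'0; apply/seteqP; split.
  move=> _ [n [w [v [hw hv ->]]]]; split.
    exists n, w, (fun i => (v i).1); split=> //; first by move=> i;
      case: (hv i).
    exact: (raddf_sum fst).
  exists n, w, (fun i => (v i).2); split=> //; first by move=> i; case: (hv i).
  exact: (raddf_sum snd).
have sWX := mulset_submodule (M `*` M') sW.
move=> [_ _] [/= [n [w [v [hw hv ->]]]] [n' [w' [v' [hw' hv' ->]]]]].
rewrite [X in mulset _ _ X](_ : _ = (\sum_i w i *: (v i, 0 : N')) +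
    (\sum_i w' i *: (0 : N, v' i))).
  apply: (submodD sWX).
    by exists n, w, (fun i => (v i, 0)); split=> // i; split=> //=.
  by exists n', w', (fun i => (0, v' i)); split=> // i; split=> //=.
rewrite [LHS]surjective_pairing; congr pair => /=.
  rewrite (raddf_sum fst) (raddf_sum fst)/= [X in _ = _ + X]big1 ?addr0//.
  by move=> i _; rewrite scaler0.
rewrite (raddf_sum snd) (raddf_sum snd)/= [X in _ = X + _]big1 ?add0r//.
by move=> i _; rewrite scaler0.
Qed.

Lemma dim_restr_setX (N N' : lmodType S) (A B : set N) (A' B' : set N') :
  subpair (A : set (restr iota N)) (B : set (restr iota N)) ->
  subpair (A' : set (restr iota N')) (B' : set (restr iota N')) ->
  dim (A `*` A' : set (restr iota (N * N')%type)) (B `*` B' : set (restr iota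
    (N * N')%type))
  = (dim (A : set (restr iota N)) (B : set (restr iota N)) +
     dim (A' : set (restr iota N')) (B' : set (restr iota N')))%E.
Proof.
move=> [sA sB AB] [sA' sB' AB']; rewrite -(bmr_sum Hdim) //.
have sX (C : set (restr iota N)) (C' : set (restr iota N')) : submodule C ->
  submodule C' ->
    submodule (C `*` C' : set (restr iota (N * N')%type)).
  move=> sC sC'; apply: submodule_intro.
  - by split; [exact: (submod0 sC)|exact: (submod0 sC')].
  - by move=> x y [? ?] [? ?]; split;
      [exact: (submodD sC)|exact: (submodD sC')].
  - by move=> a x [? ?]; split; [exact: (submodZ a sC)|exact: (submodZ a sC')].
apply: (bmr_iso Hdim
  (f := id : restr iota (N * N')%type -> (restr iota N * restr iota N')%type)).
- by split; [exact: sX|exact: sX|exact: setSX].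
- by split; [exact: submodule_setX|exact: submodule_setX|exact: setSX].
- by [].
- by split=> //; move=> x Bx; exists x.
- by rewrite image_id.
Qed.

(** Mean dimensions add exactly for each [W]; the infima add because a sufficiently invariant [W]
    nearly realises both at once. *)
Lemma lim_dim_setX (N N' : lmodType S) (M B : set N) (M' B' : set N') :
  submodule B -> submodule B' -> rfg N M -> M `<=` B -> rfg N' M' ->
    M' `<=` B' ->
  lim_dim (M `*` M') (B `*` B') = lim_dim M B + lim_dim M' B'.
Proof.
move=> sB sB' fM MB fM' MB'.
have sX := submodule_setX sB sB'.
have fX := fg_setX fM fM'.
have XB : M `*` M' `<=` B `*` B' by exact: setSX.
have psiE W : Fhat F W ->
  mean_dim (M `*` M') (B `*` B') W = mean_dim M B W + mean_dim M' B' W.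
  move=> hW; have [_ _ s1 f1] := mulset_dim_fin sB fM MB hW.
  have [_ _ s2 f2] := mulset_dim_fin sB' fM' MB' hW.
  rewrite /mean_dim (mulset_setX (F_submodule HN hW.1)); last 2 first.
  - exact: (submod0 (fg_submodule fM)).
  - exact: (submod0 (fg_submodule fM')).
  by rewrite dim_restr_setX// fineD// mulrDl.
apply/le_anti/andP; split; apply/ler_addgt0Pr => e e0; last first.
  have [W [hW W1]] := filter_ex (filterI (inv_filter_Fhat Hra HN)
    (lim_dim_near sX fX XB e0)).
  apply: le_trans W1; rewrite psiE//; apply: lerD.
    exact: (lim_dim_le sB).
  exact: (lim_dim_le sB').
have e20 : 0 < e / 2 by rewrite divr_gt0.
have [W [[hW W1] W2]] := filter_ex (filterI (filterI (inv_filter_Fhat Hra HN)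
    (lim_dim_near sB fM MB e20))
    (lim_dim_near sB' fM' MB' e20)).
apply: (le_trans (lim_dim_le sX fX XB hW)).
by rewrite psiE// [in leRHS](splitr e) addrACA lerD.
Qed.

Lemma dimF_bmr_sum (N N' : lmodType S) (A B : set N) (A' B' : set N') :
  subpair A B -> subpair A' B' ->
  dimF (A `*` A') (B `*` B') = (dimF A B + dimF A' B')%E.
Proof.
move=> sAB sAB'; have [[sA sB AB] [sA' sB' AB']] := (sAB, sAB').
have sX := submodule_setX sB sB'.
have sXA := submodule_setX sA sA'.
have XAB : A `*` A' `<=` B `*` B' by exact: setSX.
apply/le_anti/andP; split; last first.
  apply: dimF_add_le => // M M' fM MA fM' MA'.
  rewrite -lim_dim_setX//; try exact: subset_trans AB;
    try exact: subset_trans AB'.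
  apply: (dimF_ge sX) => //; first exact: fg_setX.
  exact: setSX.
apply: (dimF_le sX) => // M fM MA.
(* [M] need not be a product, but it sits in the product of its projections. *)
pose M1 : set N := fst @` M; pose M2 : set N' := snd @` M.
have f1 : rfg N M1.
  exact: (@fg_image _ _ _ (fst : restr iota
    (N * N')%type -> restr iota N) _ _ fM).
have f2 : rfg N' M2.
  exact: (@fg_image _ _ _ (snd : restr iota
    (N * N')%type -> restr iota N') _ _ fM).
have M1A : M1 `<=` A by move=> _ [x Mx <-]; case: (MA _ Mx).
have M2A : M2 `<=` A' by move=> _ [x Mx <-]; case: (MA _ Mx).
have M1B := subset_trans M1A AB; have M2B := subset_trans M2A AB'.
have MX : M `<=` M1 `*` M2 by move=> x Mx; split; exists x.
apply: (@le_trans _ _ (lim_dim (M1 `*` M2) (B `*` B'))%:E).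
  rewrite lee_fin; apply: (lim_dim_mono sX) => //.
  - exact: fg_setX.
  - exact: setSX.
  - by apply: subset_trans MX _; exact: sub_gen.
rewrite lim_dim_setX// EFinD; apply: leeD.
  exact: (dimF_ge sB).
exact: (dimF_ge sB').
Qed.

Lemma dimF_bmr_sup (N : lmodType S) (A B : set N) : subpair A B ->
  dimF A B = ereal_sup [set dimF A1 B | A1 in
      [set A1 | [/\ submodule A1, fg A1 & A1 `<=` A]]].
Proof.
move=> [sA sB AB]; rewrite {1}/Defs.dimF; congr ereal_sup.
apply/eq_imagel => A1 [sA1 fA1 A1A].
by rewrite (dimF_fg_eq sB)//; exact: subset_trans AB.
Qed.

(** As [lim_dim] is an infimum over [W], one good [W] gives the upper bound: [dim(W M|B)] is nearly
    realised in a finitely generated [B0], and the [S]-module generated by [B0] and [M] serves as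
    [B1]. *)
Lemma dimF_bmr_inf (N : lmodType S) (A B : set N) : subpair A B -> fg A ->
  dimF A B = ereal_inf [set dimF A B1 | B1 in
      [set B1 | [/\ submodule B1, fg B1, A `<=` B1 & B1 `<=` B]]].
Proof.
move=> [sA sB AB] fA; have [M [fM AE]] := fg_gen_restr iota fA.
have MA : M `<=` A by rewrite AE; exact: sub_gen.
have MB := subset_trans MA AB.
have dE B1 : submodule B1 -> A `<=` B1 -> dimF A B1 = (lim_dim M B1)%:E.
  move=> s1 AB1; rewrite AE (dimF_gen s1)//.
  exact: subset_trans AB1.
have sBr := submodule_restr iota sB.
rewrite dE//; apply/le_anti/andP; split.
  apply: le_ereal_inf_tmp => _ [B1 [sB1 fB1 AB1 B1B] <-].
  rewrite dE// lee_fin; have MB1 := subset_trans MA AB1.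
  apply: lb_le_inf; first by have [W hW] := Fhat_nonempty;
    exists (mean_dim M B1 W), W.
  move=> _ [W hW <-]; apply: (le_trans (lim_dim_le sB fM MB hW)).
  have [_ _ s1 f1] := mulset_dim_fin sB fM MB hW;
    have [_ _ s2 f2] := mulset_dim_fin sB1 fM MB1 hW.
  rewrite ler_pM2r ?invr_gt0 ?(dimS_gt0K hW)//.
  by apply: fine_le => //; apply: (dim_le_r Hdim).
apply/lee_addgt0Pr => e e0.
have e20 : 0 < e / 2 by rewrite divr_gt0.
have [W [hW W1]] := filter_ex (filterI (inv_filter_Fhat Hra HN)
    (lim_dim_near sB fM MB e20)).
have [fW WB sWB f1] := mulset_dim_fin sB fM MB hW.
have [B0 [fB0 WB0 B0B leB0]] := dim_inf_approx Hrk Hdim Hcor sWB fW e20.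
pose B1r := addset (B0 : set (restr iota N)) (M : set (restr iota N)).
have fB1r : rfg N B1r by exact: fg_addset.
have sB0 := fg_submodule fB0; have sM := fg_submodule fM.
have B1rB : B1r `<=` B by exact: addset_sub.
pose B1 := gen (B1r : set N).
have B1B : B1 `<=` B by exact: gen_sub.
have sB1 : submodule B1 by exact: gen_submodule.
have MB1r : M `<=` B1r by exact: (@addset_subr _ (restr iota N) B0 M sB0).
have AB1 : A `<=` B1 by rewrite AE; exact: gen_mono.
have MB1 := subset_trans MA AB1.
apply: (@le_trans _ _ (dimF A B1)).
  by apply: ereal_inf_lbound; exists B1 => //; split=> //; exact: fg_gen fB1r.
rewrite dE// -EFinD lee_fin.
apply: (le_trans (lim_dim_le sB1 fM MB1 hW)).
rewrite [in leRHS](splitr e) addrA -lerBlDr; apply: le_trans W1.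
have W0 := dimS_gt0K hW.
have [_ _ s2 f2] := mulset_dim_fin sB1 fM MB1 hW.
rewrite lerBlDr /mean_dim ler_pdivrMr// mulrDl divfK ?gt_eqF//.
have B0B1 : B0 `<=` B1.
  apply: subset_trans (_ : B1r `<=` _); last exact: (@sub_gen S N B1r).
  exact: (@addset_subl _ (restr iota N) B0 M sM).
have s0 : subpair (mulset W M : set (restr iota N)) B0.
  by split=> //; exact: fg_submodule fW.
have i1 := dim_le_r Hdim s0 (submodule_restr iota sB1) B0B1.
have := le_trans i1 leB0.
rewrite -(fineK f1) -(fineK f2) -EFinD lee_fin => /le_trans; apply.
(* The error [e / 2] may be multiplied by the rank of [W], which is at least 1. *)
rewrite lerD2l ler_peMr ?(ltW e20)// ler1n.
exact: (dimS_gt0 HF HN).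
Qed.

(** * Additivity for quotients *)

Section Quotient.
Context (N : lmodType S) (A B : set N).
Hypotheses (sA : submodule A) (sB : submodule B) (AB : A `<=` B).
Let q : N -> quotm A := quotm_pi A.
Let ql : linear q := @quotm_pi_lin _ _ A.
Let qR : restr iota N -> restr iota (quotm A) := q.
Let qRl : linear qR := linear_restr ql.
Let qB : set (quotm A) := q @` B.
Let sqB : submodule qB := submodule_image ql sB.

Lemma quotm_mulset W (M : set N) : q @` mulset W M = mulset W (q @` M).
Proof.
apply: (@image_mulset_on _ _ _ setT) => //; first exact: submoduleT.
by move=> a u v _ _; exact: ql.
Qed.

(** Generators of [M'] are lifted to [B] and joined to [M] in [T]. The projection kills [W M], so
    for every [W] submodularity bounds [dim(W M|B) + dim(W q(T)|qB)] by [dim(W T|B)]. *)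
Lemma dimF_quot_ge : (dimF A B + dimF qB qB <= dimF B B)%E.
Proof.
apply: (dimF_add_le (And3 sA sB AB) (subpairxx sqB)).
move=> M M' fM MA fM' M'B.
have MB := subset_trans MA AB.
have [n [c M'E]] := fg_ex fM'.
have /choice[b bE] : forall i, exists x, B x /\ q x = c i.
  move=> i; have /M'B[x Bx <-] : M' (c i); last by exists x.
  by rewrite M'E -gen_rangeE; apply: sub_gen; exists i.
pose L := lspan (b : 'I_n -> restr iota N).
pose T := addset (M : set (restr iota N)) L.
have fT : rfg N T by apply: fg_addset => //; exact: fg_lspan.
have sBr := submodule_restr iota sB; have sqBr := submodule_restr iota sqB.
have sM := fg_submodule fM.
have sL : submodule L by exact: lspan_submodule.
have LB : L `<=` B.
  rewrite /L -gen_rangeE; apply: gen_sub => // _ [i _ <-].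
  by case: (bE i).
have TB : T `<=` B by exact: addset_sub.
have fqT : rfg (quotm A) (q @` T) by exact: (fg_image qRl fT).
have qTB : q @` T `<=` qB by exact: image_subset.
have M'T : M' `<=` q @` T.
  rewrite M'E -gen_rangeE; apply: gen_sub; first exact: fg_submodule fqT.
  move=> _ [i _ <-]; exists (b i); last by case: (bE i).
  apply: (@addset_subr _ (restr iota N) M) => //.
  by rewrite /L -gen_rangeE; apply: sub_gen; exists i.
have i0 : lim_dim M' qB <= lim_dim (q @` T) qB.
  apply: (lim_dim_mono sqB) => //.
  by apply: subset_trans M'T _; exact: (@sub_gen S (quotm A) (q @` T)).
apply: (@le_trans _ _ (lim_dim T B)%:E); last exact: (dimF_ge sB).
rewrite lee_fin; apply/ler_addgt0Pr => e e0.
have [W [hW W1]] := filter_ex (filterI (inv_filter_Fhat Hra HN)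
    (lim_dim_near sB fT TB e0)).
apply: le_trans W1.
apply: (le_trans (lerD (lim_dim_le sB fM MB hW)
  (le_trans i0 (lim_dim_le sqB fqT qTB hW)))).
have [fWM WMB sWM f1] := mulset_dim_fin sB fM MB hW.
have [fWT WTB sWT f2] := mulset_dim_fin sB fT TB hW.
have [fWq WqB sWq f3] := mulset_dim_fin sqB fqT qTB hW.
rewrite /mean_dim -mulrDl ler_pM2r ?invr_gt0 ?(dimS_gt0K hW)//.
have s0 := @submodule_set0 _ (restr iota (quotm A)).
have z0 : [set 0 : restr iota (quotm A)] `<=` qB.
  by move=> _ ->; exact: (submod0 sqBr).
have qWM : qR @` mulset W M `<=` [set 0].
  move=> _ [x Wx <-]; apply/quotm_pi_eq0 => //; move: x Wx.
  exact: mulset_sub_submodule.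
have MT : mulset W M `<=` mulset W T.
  by apply: mulset_mono => //; exact: (@addset_subl _ (restr iota N)).
have sWM' : submodule (mulset W M : set
  (restr iota N)) by exact: fg_submodule fWM.
have qBB : qR @` B `<=` qB by [].
have := dim_submod Hrk Hdim Hcor qRl sBr sqBr qBB sWM' fWT MT WTB
  (@fg_set0 _ _) z0 qWM.
have -> : addset (qR @` mulset W T) [set 0] = mulset W (q @` T).
  rewrite -quotm_mulset; apply/seteqP; split=> [_ [x qx [_ -> <-]]|x qx].
    by rewrite addr0.
  by exists x => //; exists 0 => //; rewrite addr0.
have f0 : dim [set 0 : restr iota (quotm A)] qB \is a fin_num.
  exact: (rdim_fin sqB s0 (@subset_refl _ _) (@fg_set0 _ _)).
rewrite -(fineK f0) -(fineK f1) -(fineK f2) -(fineK f3).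
rewrite (rdim_set0 sqB) -!EFinD lee_fin /=; lra.
Qed.

Lemma dimF_quot_le : (dimF B B <= dimF A B + dimF qB qB)%E.
Proof.
apply: (dimF_le sB) => // M fM MB.
apply/lee_addgt0Pr => e e0.
(* Four errors: the choice of [V], the finitely generated part [K0] of the kernel, the growth
   estimate, and the choice of [C]. *)
have e40 : 0 < e / 4 by rewrite divr_gt0.
have sBr := submodule_restr iota sB; have sqBr := submodule_restr iota sqB.
have fqM : rfg (quotm A) (q @` M) by exact: (fg_image qRl fM).
have qMB : q @` M `<=` qB by exact: image_subset.
have [V [hV psiV]] := filter_ex (filterI (inv_filter_Fhat Hra HN)
    (lim_dim_near sqB fqM qMB e40)).
have [fX XB sX f1] := mulset_dim_fin sB fM MB hV.
have [fqX qXB sqX f2] := mulset_dim_fin sqB fqM qMB hV.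
have [K0 [fK0 K0B leK0]] := dim_ker_approx Hrk Hdim Hcor qRl sBr fX XB e40.
have K0A : K0 `<=` A by move=> x /K0B[_ /(quotm_pi_eq0 _ sA)].
have K0B' := subset_trans K0A AB.
have [g Ug gnear] := rdim_growth_near sB fM MB fK0 K0B' hV e40.
have fgK0 : rfg N ((fun x : N => g *: x) @` K0).
  exact: (smul_fg iota_inj HN).
(* [A] is stable under [S], so the translate [g K0] forced by the growth estimate still counts
   towards [dimF A B]. *)
have gK0A : (fun x : N => g *: x) @` K0 `<=` A.
  by move=> _ [x /K0A Ax <-]; exact: submodZ.
have gK0B := subset_trans gK0A AB.
have [C [[hC C1] C2]] := filter_ex (filterI (filterI
  (inv_filter_Fhat Hra HN) gnear)
    (lim_dim_near sB fgK0 gK0B e40)).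
have i1 := dimF_ge sB fgK0 gK0A sA AB.
have i2 := dimF_ge sqB fqM qMB sqB (@subset_refl _ _).
apply: le_trans (leeD (leeD i1 i2) (lexx _)).
rewrite -!EFinD lee_fin; apply: (le_trans (lim_dim_le sB fM MB hC)).
apply: (le_trans C1).
have V0 := dimS_gt0K hV.
have V1 : 1 <= (dimS iota V)%:R :> K by rewrite ler1n; exact: (dimS_gt0 HF HN).
have XKB : addset (mulset V M : set
  (restr iota N)) K0 `<=` B by exact: addset_sub.
have fXK := fg_addset fX fK0.
have f3 := rdim_fin sB (fg_submodule fXK) (@subset_refl _ _) fXK XKB.
have f4 := rdim_fin sB (fg_submodule fK0) (@subset_refl _ _) fK0 K0B'.
move: leK0; have -> : qR @` mulset V M = mulset V
  (q @` M) by exact: quotm_mulset.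
have -> : qR @` B = qB by [].
rewrite -(fineK f2) -(fineK f3) -(fineK f4) -!EFinD lee_fin => leK0.
have i3 : (fine (dim (addset (mulset V M : set (restr iota N)) K0) B) - fine
  (dim K0 B))
    / (dimS iota V)%:R <= mean_dim (q @` M) qB V + e / 4.
  rewrite /mean_dim ler_pdivrMr// mulrDl divfK ?gt_eqF//.
  have : e / 4 <= e / 4 * (dimS iota V)%:R by rewrite ler_peMr// ltW.
  rewrite lerBlDl addrA => i4; apply: (le_trans leK0); lra.
lra.
Qed.

End Quotient.

Lemma dimF_bmr_quot (N : lmodType S) (A B : set N) : subpair A B ->
  dimF B B = (dimF A B + dimF (quotm_pi A @` B) (quotm_pi A @` B))%E.
Proof.
move=> [sA sB AB]; apply/le_anti.
by rewrite dimF_quot_le// dimF_quot_ge.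
Qed.

Lemma dimF_bivariant : bivariant_module_rank dimF.
Proof.
split.
- exact: (dimF_bmr_ge0).
- exact: (dimF_bmr_iso).
- exact: (dimF_bmr_0).
- exact: (dimF_bmr_1).
- exact: (dimF_bmr_sum).
- exact: (dimF_bmr_sup).
- exact: (dimF_bmr_inf).
- exact: dimF_bmr_quot.
Qed.

(** * Identification with [rkF] *)

Lemma rowset_basis n W : F W -> exists l (w : 'I_l -> restr iota 'rV[S]_n),
  is_basis (rowset iota n W) w.
Proof.
move=> FW; have [k [v [_ bv]]] := F_basis HN FW.
pose w (t : 'I_n * 'I_k) : restr iota 'rV[S]_n := v t.2 *: delta_mx 0 t.1.
have sumE (c : 'I_n * 'I_k -> R) j :
    (\sum_t c t *: w t : 'rV[S]_n) 0 j = \sum_i iota (c (j, i)) * v i.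
  have -> : \sum_t c t *: w t = \sum_a \sum_b c (a, b) *: w (a, b).
    by rewrite pair_bigA; apply: eq_bigr => -[].
  rewrite summxE (bigD1 j)//=.
  rewrite [X in _ + X]big1 ?addr0 => [|i ij].
    rewrite summxE; apply: eq_bigr => i _.
    by rewrite mxE mxE mxE !eqxx mulr1.
  rewrite summxE big1// => i' _.
  by rewrite mxE mxE mxE eqxx /= eq_sym (negPf ij) !mulr0.
exists #|{: 'I_n * 'I_k}|, (w \o (@enum_val _ predT)); apply: basis_reindex.
  move=> c c0 [j i]; apply: (bv.1 (fun i => c (j, i))).
  by have := sumE c j; rewrite c0 mxE => <-.
move=> x; split=> [Wx|[c ->] j]; last first.
  by rewrite sumE bv.2 gen_rangeE; exists (fun i => c (j, i)).
have /choice[c cE] : forall j, exists c : 'I_k ->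
  R, (x : 'rV[S]_n) 0 j = \sum_i iota (c i) * v i.
  by move=> j; have := Wx j; rewrite bv.2 gen_rangeE => -[c ->]; exists c.
exists (fun t => c t.1 t.2); apply/rowP => j; rewrite cE.
by rewrite (sumE (fun t => c t.1 t.2)).
Qed.

Lemma rowset_submodule n W : F W -> submodule (rowset iota n W).
Proof.
by move=> /(rowset_basis n)[l [w [_ ->]]]; exact: gen_submodule.
Qed.

(** [W^m] is locally a summand of [S^m]: the entries of finitely many vectors lie in some [W + V] in
    [F], and a complement of [W] there gives one coordinatewise. *)
Lemma dim_rowset m W (X : set (restr iota 'rV[S]_m)) : F W -> fg X ->
  X `<=` rowset iota m W -> dim X setT = dim X (rowset iota m W).
Proof.
move=> FW fX XW; have srW := rowset_submodule m FW.
apply: (dim_summand Hdim) => //; first exact: submoduleT.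
move=> B1 /fg_ex[k [b ->]] _.
have [V FV bV] := F_finite HF (finite_range (fun kj : 'I_#|{: 'I_k * 'I_m}| =>
  (b (enum_val kj).1 : 'rV[S]_m) 0 (enum_val kj).2)).
have FWV := fas_add HF FW FV.
have [sW sV] := (F_submodule HN FW, F_submodule HN FV).
have WWV : W `<=` addset W V by exact: (@addset_subl _ (restr iota S^o)).
have [C [FC WVE cap]] := fas_compl HF FW FWV WWV.
have sC := F_submodule HN FC.
exists (rowset iota m C); split=> //; first exact: rowset_submodule.
  apply/seteqP; split=> [x [Wx Cx]|_ ->].
    apply/rowP => j; rewrite mxE.
    by have : (W `&` C) ((x : 'rV[S]_m) 0 j) by []; rewrite cap.
  by split; apply: submod0 => //; exact: rowset_submodule.
rewrite -gen_rangeE; apply: gen_sub.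
  by apply: submodule_addset => //; exact: rowset_submodule.
move=> _ [i _ <-].
have /choice[c cE] : forall j, exists c, [/\ W c.1, C c.2 & c.1 + c.2 =
  (b i : 'rV[S]_m) 0 j].
  move=> j; have : addset W V ((b i : 'rV[S]_m) 0 j).
    apply: (@addset_subr _ (restr iota S^o)) => //; apply: bV.
    by exists (enum_rank (i, j)) => //; rewrite enum_rankK.
  by rewrite WVE => -[x Wx [y Cy xyE]]; exists (x, y).
exists (\row_j (c j).1); first by move=> j; rewrite mxE; case: (cE j).
exists (\row_j (c j).2); first by move=> j; rewrite mxE; case: (cE j).
by apply/rowP => j; rewrite !mxE; case: (cE j).
Qed.

Section Matrix.
Context (n m : nat) (A : 'M[S]_(n, m)).
Let rows : 'I_n -> restr iota 'rV[S]_m := fun i => row i A.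
Let M : set 'rV[S]_m := gen (range rows).

Lemma rows_fg : rfg 'rV[S]_m M.
Proof. by rewrite /M gen_rangeE; exact: fg_lspan. Qed.

Lemma rowspace_gen : rowspace A = gen M.
Proof.
rewrite /M gen_gen_restr gen_rangeE -rowspace_lspan; congr rowspace.
by apply/matrixP => i j; rewrite !mxE.
Qed.

(** In a product [w c x] with [x] a row of [A], the element [w c] is again in [W], so [W M] consists
    of the combinations of rows with coefficients in [W]. *)
Lemma mulset_rows W : F W ->
  mulset W M = (fun v => v *m A) @` (rowset iota n W : set 'rV[S]_n).
Proof.
move=> FW; have sW := F_submodule HN FW; have srW := rowset_submodule n FW.
have sI : submodule ((fun v => v *m A) @` (rowset iota n W : set 'rV[S]_n)
    : set (restr iota 'rV[S]_m)).
  apply: (@submodule_image _ (restr iota 'rV[S]_n) (restr iota 'rV[S]_m)) => //.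
  by move=> a u v; rewrite mulmxDl -scalemxAl.
apply/seteqP; split.
  apply: (@mulset_sub _ _ iota) => // w x Ww; rewrite /M gen_rangeE => -[c ->].
  exists (\row_i (w * iota (c i))).
    by move=> j; rewrite mxE; exact: (F_mulr iota_inj Hra HN).
  rewrite mulmx_sum_row scaler_sumr; apply: eq_bigr => i _.
  by rewrite mxE -scalerA.
move=> _ [v Wv <-]; exists n, (fun i => v 0 i), rows; split=> //.
  by move=> i; apply: sub_gen; exists i.
by rewrite mulmx_sum_row.
Qed.

(** The ambient [S^m] is cut down to [W'^m] by [dim_rowset], and coordinates in the basis [w']
    identify [W M] with the row space of [B]. The resulting value involves none of the choices made
    in [rkW_spec]. *)
Lemma rkW_spec_dim W r : F W -> rkW_spec iota F rk W A r ->
  r%:E = dim (mulset W M : set (restr iota 'rV[S]_m)) setT.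
Proof.
move=> FW [W' [hW' WA [l [p [w [w' [B [bw bw' wA ->]]]]]]]].
have FW' := hW'.1.
have AE : mulset W M = lincomb w' @` rowspace B.
  rewrite mulset_rows//.
  have wE : rowset iota n W = lincomb w @` setT.
    by rewrite lincomb_range -gen_rangeE; exact: bw.2.
  have h u : (lincomb w u : 'rV[S]_n) *m A = lincomb w' (u *m B).
    rewrite /lincomb mulmx_suml.
    transitivity (\sum_i \sum_j (u 0 i * B i j) *: w' j).
      apply: eq_bigr => i _; rewrite -scalemxAl wA.
      rewrite -[_ *: _]/(u 0 i *: (_ : restr iota 'rV[S]_m)) scaler_sumr.
      by apply: eq_bigr => j _; rewrite scalerA.
    rewrite exchange_big; apply: eq_bigr => j _.
    by rewrite mxE scaler_suml.
  rewrite wE; apply/seteqP; split=> [_ [_ [u _ <-] <-]|_ [_ [u _ <-] <-]].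
    by rewrite h; exists (u *m B) => //; exists u.
  by exists (lincomb w u); [exists u|rewrite h].
have fWM := mulset_fg iota_inj HF HN FW rows_fg.
have XW' : mulset W M `<=` rowset iota m W'.
  rewrite AE bw'.2 gen_rangeE -lincomb_range.
  by move=> _ [u _ <-]; exists u.
rewrite (dim_rowset FW' fWM XW') Hcor.
have rE : rowset iota m W' = lincomb w' @` setT.
  by rewrite lincomb_range -gen_rangeE; exact: bw'.2.
apply: (bmr_iso Hdim (f := lincomb w')).
- by split=> //; [exact: rowspace_submodule|exact: submoduleT].
- by split=> //; [exact: fg_submodule fWM|exact: rowset_submodule].
- by move=> a u v _ _; exact: lincomb_lin.
- split; first by move=> u _; rewrite rE; exists u.
    by move=> u v _ _; exact: (basis_inj bw').
  by rewrite rE.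
- by rewrite AE.
Qed.

(** Rules out the default value in [rkW]. The target is [W + V], where [V] contains the products of
    a basis of [W] with the entries of [A]; adding [W] makes it nonzero. *)
Lemma rkW_spec_ex W : Fhat F W -> exists r, rkW_spec iota F rk W A r.
Proof.
move=> hW; have FW := hW.1; have sW := F_submodule HN FW.
have [k [v [_ bv]]] := F_basis HN FW.
pose x (t : 'I_#|{: 'I_k * ('I_n * 'I_m)}|) : S :=
  let u := enum_val t in v u.1 * A u.2.1 u.2.2.
have [V FV xV] := F_finite HF (finite_range x).
have sV := F_submodule HN FV.
have FW' := fas_add HF FW FV.
have VW' : V `<=` addset W V by exact: (@addset_subr _ (restr iota S^o)).
have WW' : W `<=` addset W V by exact: (@addset_subl _ (restr iota S^o)).
have WA i j y : W y -> addset W V (y * A i j).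
  rewrite {1}bv.2 gen_rangeE => -[c ->]; apply: VW'; rewrite mulr_suml.
  apply: (submod_sum (M := restr iota S^o)) => // a _.
  rewrite [X in V X](_ : _ = c a *: (v a * A i j : restr iota S^o)).
    apply: (submodZ (M := restr iota S^o)) => //; apply: xV.
    by exists (enum_rank (a, (i, j))) => //; rewrite /x enum_rankK.
  by rewrite -[RHS]/(iota (c a) * (v a * A i j)) mulrA.
have [l [w bw]] := rowset_basis n FW; have [p [w' bw']] := rowset_basis m FW'.
have sW' := F_submodule HN FW'.
have /choice[B BE] : forall i, exists c : 'I_p -> R,
    (w i : 'rV[S]_n) *m A = \sum_j c j *: w' j.
  move=> i; suff : rowset iota m (addset W V) ((w i : 'rV[S]_n) *m A).
    by rewrite bw'.2 gen_rangeE => -[c cE]; exists c.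
  move=> j; rewrite mxE; apply: (submod_sum (M := restr iota S^o)) => // a _.
  apply: WA; have : rowset iota n W (w i) by rewrite bw.2; apply: sub_gen;
    exists i.
  exact.
exists (rk (\matrix_(i, j) B i j)), (addset W V); split=> //.
  split=> //; apply/eqP => W0; case: hW => _ /eqP; apply.
  apply/seteqP; split=> [y /WW'|_ ->]; first by rewrite W0.
  exact: (submod0 sW).
exists l, p, w, w', (\matrix_(i, j) B i j); split=> // i.
by rewrite BE; apply: eq_bigr => j _; rewrite mxE.
Qed.

Lemma rkWE W : Fhat F W ->
  rkW iota F rk W A / (dimS iota W)%:R = mean_dim M setT W.
Proof.
move=> hW; rewrite /mean_dim; congr (_ / _); rewrite /rkW.
case: xgetP => [r _ /(rkW_spec_dim hW.1) <-//|h].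
by have [r /h] := rkW_spec_ex hW.
Qed.

End Matrix.

(** Invariance under a member of [F] follows from invariance under a finite basis of it, which
    [omega] controls. Hence limits along [inv_filter] are limits along [omega]. *)
Lemma invariant_ultrafilter_inv_filter (omega : set_system (set S)) :
  invariant_ultrafilter K iota F omega -> inv_filter K iota F `<=` omega.
Proof.
move=> [ultra hom] P [V [d [FV d0 VP]]].
have [k [v [_ VE _]]] := F_gen_basis HF HN FV.
apply: filterS (hom _ _ (finite_range v) d0) => W [hW invW].
by apply: VP => //; exact: (fin_F_invariant iota_inj Hra HN hW.1 FV VE).
Qed.

Lemma rkF_corresponding (omega : set_system (set S)) :
  invariant_ultrafilter K iota F omega ->
  corresponding (fun n m => @rkF K R S iota F rk omega n m) dimF.
Proof.
move=> Hom n m A.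
have ultra : UltraFilter omega := Hom.1.
have sub := invariant_ultrafilter_inv_filter Hom.
have sT := submoduleT 'rV[S]_m.
rewrite (rowspace_gen A) (dimF_gen sT (rows_fg A))//.
congr EFin; apply: cvg_lim => //.
have psi_cvg := mean_dim_cvg sT (rows_fg A) (@subsetT _ _).
apply: (@cvg_trans _ (mean_dim (gen (range (fun i => row i A : restr iota _)))
  setT @ omega)); last by apply: cvg_trans psi_cvg => P /= /sub.
apply: near_eq_cvg; apply: filterS (sub _ (inv_filter_Fhat Hra HN)) => W hW.
by rewrite rkWE.
Qed.

End AmenableExtension.

Theorem theorem8p3 (K : realType) (R S : pzRingType)
    (iota : {rmorphism R -> S})
    (rk : forall n m, 'M[R]_(n, m) -> K)
    (dim : forall M : lmodType R, set M -> set M -> \bar K)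
    (F : set (set S)) (U : set S) (omega : set_system (set S)) :
  sylvester_matrix_rank rk ->
  bivariant_module_rank dim ->
  corresponding rk dim ->
  amenable_normal_extension iota F U rk ->
  invariant_ultrafilter K iota F omega ->
  weak_quasitiling K iota F U ->
  bivariant_module_rank (dimF iota F dim) /\
  corresponding (fun n m => @rkF K R S iota F rk omega n m) (dimF iota F dim).
Proof.
move=> Hrk Hdim Hcor Hext Hom _; split.
  exact: dimF_bivariant Hrk Hdim Hcor Hext.
exact (rkF_corresponding Hrk Hdim Hcor Hext Hom).
Qed.
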